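(* Consider the Laplace operator $\Delta u=u''$ as $$\Delta: H^{2}_{0}(0,\pi)\subset L^{2}_{loc}(0,\pi)\longrightarrow L^{2}_{loc}(0,\pi)$$ and its adjoint $$\Delta^{*}: H^{2}_{c}(0,\pi)\subset L^{2}_{c}(0,\pi)\longrightarrow L^{2}_{c}(0,\pi).$$ Both have empty resolvent set, and $$\sigma_p(\Delta)=\sigma_p(\Delta^{*})=\emptyset,\qquad \sigma_r(\Delta)=\sigma_c(\Delta^{*})=\emptyset,\qquad \sigma_c(\Delta)=\sigma_r(\Delta^{*})=\mathbb{C}.$$
   Context: Let $I=(0,\pi)$; functions are complex valued. $L^2_{loc}(I)$ is the Fréchet space of locally square integrable functions on $I$, with seminorms $u\mapsto\|\varphi_j u\|_{L^2(\mathbb{R})}$, where $I_j=(a_j,b_j)$, $[a_j,b_j]\subset(a_{j+1},b_{j+1})$, $I=\bigcup_j[a_j,b_j]$, $\varphi_j\in C_c^\infty(I_{j+1})$ and $\varphi_j=1$ on $[a_j,b_j]$. $H^2_0(I)$ is the closure of $C_c^\infty(I)$ in $H^2(I)$ and carries, as the domain of $\Delta$, the topology induced from $L^2_{loc}(I)$. $L^2_c(I)$ and $H^2_c(I)$ are the spaces of elements of $L^2(\mathbb{R})$, respectively $H^2(\mathbb{R})$, with compact support contained in $I$. $L^2_c(I)$ is identified with the dual of $L^2_{loc}(I)$ via $\langle g,u\rangle=\int_I gu\,dx$ and equipped with the weak* topology. The adjoint $\Delta^*$ has as domain the set of $g\in L^2_c(I)$ such that $u\mapsto\langle g,u''\rangle$,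 $u\in H^2_0(I)$, is continuous for the topology of $L^2_{loc}(I)$ (this set is $H^2_c(I)$). $\Delta^*g$ represents the continuous extension of this functional, and $\Delta^* g=g''$. For a linear operator $A:D(A)\subset X\to X$ on one of these topological vector spaces, $\rho(A)$ (the resolvent set) is the set of $\lambda\in\mathbb{C}$ such that $\lambda-A$ is injective, its range $R(\lambda-A)$ is dense in $X$, and $(\lambda-A)^{-1}:R(\lambda-A)\to X$ is continuous. $\sigma_p(A)$ is the set of $\lambda$ with $\lambda-A$ not injective. $\sigma_r(A)$ is the set of $\lambda$ with $\lambda-A$ injective and $\overline{R(\lambda-A)}\neq X$. $\sigma_c(A)$ is the set of $\lambda$ with $\lambda-A$ injective, $\overline{R(\lambda-A)}=X$, and $(\lambda-A)^{-1}:R(\lambda-A)\to X$ not continuous. *)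

(* Defs.v *)
From HB Require Import structures.
From mathcomp Require Import all_boot all_order all_algebra.
From mathcomp Require Import ring.
From mathcomp Require Import generic_quotient ring_quotient complex.
From mathcomp Require Import all_classical all_reals all_analysis.
From mathcomp Require Import measurable_realfun.
Set Implicit Arguments.
Unset Strict Implicit.
Unset Printing Implicit Defensive.
Import Order.TTheory GRing.Theory Num.Theory.
Import numFieldNormedType.Exports.
Local Open Scope classical_set_scope.
Local Open Scope ring_scope.
Local Open Scope quotient_scope.

Record operator (X : Type) := Operator { op_dom : set X; op_fun :> X -> X }.
Arguments Operator {X}.

Section Spectrum.
Context (K : numFieldType) (X : preTopologicalLmodType K) (A : operator X).

Definition pencil (l : K) : X -> X := fun x => l *: x - A x.

Definition pencil_range (l : K) : set X := pencil l @` op_dom A.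

Definition pencil_inj (l : K) : Prop := {in op_dom A &, injective (pencil l)}.

Definition pencil_dense (l : K) : Prop := closure (pencil_range l) = setT.

(* The default value [0] of the partial inverse only matters outside the
   range, which is not seen by [within]. *)
Definition pencil_inv_continuous (l : K) : Prop :=
  {within pencil_range l,
    continuous ('pinv_(fun=> 0) (op_dom A) (pencil l))}.

Definition resolvent_set : set K :=
  [set l | [/\ pencil_inj l, pencil_dense l & pencil_inv_continuous l]].

Definition point_spectrum : set K := [set l | ~ pencil_inj l].

Definition residual_spectrum : set K :=
  [set l | pencil_inj l /\ ~ pencil_dense l].

Definition continuous_spectrum : set K :=
  [set l | [/\ pencil_inj l, pencil_dense l & ~ pencil_inv_continuous l]].

End Spectrum.

(* [Y] stands for the dual of [X], through [b].  The element representing the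
   extended functional is unique when [op_dom A] is dense and [b] is
   nondegenerate. *)
Section Adjoint.
Context (K : numFieldType) (X Y : preTopologicalLmodType K).
Context (b : Y -> X -> K) (A : operator X).

Definition adjoint : operator Y := Operator
  [set g | {within op_dom A, continuous (fun x => b g (A x) : K^o)}]
  (fun g => xget 0 [set h | forall x, op_dom A x -> b h x = b g (A x)]).

End Adjoint.

Definition seminorm_topology (R : realType) (V : zmodType)
  (p : nat -> V -> R) : Type := V.

Section SeminormTopology.
Context (R : realType) (V : zmodType) (p : nat -> V -> R).
Local Notation T := (seminorm_topology p).

Definition seminorm_open : set (set V) := [set U | forall u, U u ->
  exists n (e : R), 0 < e /\
    forall v, (forall j, (j <= n)%N -> p j (v - u) < e) -> U v].

Let opT : seminorm_open setT.
Proof. by move=> u _; exists 0%N, 1. Qed.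

Let opI : setI_closed seminorm_open.
Proof.
move=> U W oU oW u [Uu Wu].
have [n [e [e0 HU]]] := oU _ Uu; have [m [d [d0 HW]]] := oW _ Wu.
exists (maxn n m), (Num.min e d); split; first by rewrite lt_min e0.
move=> v Hv; split.
  by apply: HU => j jn; have := Hv j; rewrite leq_max jn lt_min => /(_ isT) /andP[].
by apply: HW => j jn; have := Hv j; rewrite leq_max jn orbT lt_min => /(_ isT) /andP[].
Qed.

Let op_bigU (I : Type) (f : I -> set V) :
  (forall i, seminorm_open (f i)) -> seminorm_open (\bigcup_i f i).
Proof.
move=> of_ u [i _ fiu]; have [n [e [e0 H]]] := of_ i u fiu.
by exists n, e; split => // v Hv; exists i => //; exact: H.
Qed.

HB.instance Definition _ := GRing.Zmodule.on T.
HB.instance Definition _ := isOpenTopological.Build T opT opI op_bigU.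

End SeminormTopology.

HB.instance Definition _ (R : realType) (K : pzRingType) (V : lmodType K)
  (p : nat -> V -> R) := GRing.Lmodule.copy (seminorm_topology p) V.

Definition submodule (K : pzRingType) (V : lmodType K) (P : submodClosed V) :=
  {x : V | x \in P}.

Section Submodule.
Context (K : pzRingType) (V : lmodType K) (P : submodClosed V).
HB.instance Definition _ := SubChoice.on (submodule P).
HB.instance Definition _ := [SubChoice_isSubLmodule of submodule P by <:].
End Submodule.

Definition inner_pred (K : pzRingType) (V : lmodType K)
  (P N : submodClosed V) : {pred submodule P} := [pred u | \val u \in N].
Arguments inner_pred {K V} P N.

Section InnerPred.
Context (K : pzRingType) (V : lmodType K) (P N : submodClosed V).

Let inner_closed : subsemimod_closed (inner_pred P N).
Proof.
split; first split.
- by rewrite inE /= rpred0.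
- by move=> u v; rewrite !inE /= => uN vN; rewrite rpredD.
- by move=> a u; rewrite !inE /= => uN; rewrite rpredZ.
Qed.

HB.instance Definition _ :=
  GRing.isSubmodClosed.Build K (submodule P) (inner_pred P N) inner_closed.

End InnerPred.

(* [P / (P `&` N)] *)
Definition quotient_module (K : pzRingType) (V : lmodType K)
  (P N : submodClosed V) : Type := Quotient.quot (inner_pred P N).

Section QuotientModule.
Context (K : pzRingType) (V : lmodType K) (P N : submodClosed V).
Local Notation Q := (quotient_module P N).

HB.instance Definition _ := GRing.Zmodule.on Q.
HB.instance Definition _ := EqQuotient.on Q.

Definition quotient_scale (a : K) : Q -> Q := fun x => \pi_Q (a *: repr x).

Let pi_scale a u : quotient_scale a (\pi_Q u) = \pi_Q (a *: u).
Proof.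
apply/eqmodP => /=; rewrite /Quotient.equiv -scalerBr rpredZ//.
have : repr (\pi_Q u) = u %[mod Q] by rewrite reprK.
by move/eqmodP.
Qed.

Let piD u v : \pi_Q u + \pi_Q v = \pi_Q (u + v).
Proof. by rewrite [RHS](Quotient.pi_add (inner_pred P N)). Qed.

Let scaleA a b x :
  quotient_scale a (quotient_scale b x) = quotient_scale (a * b) x.
Proof. by elim/quotW: x => u; rewrite (pi_scale b u) !pi_scale scalerA. Qed.

Let scale1 : left_id 1 quotient_scale.
Proof. by elim/quotW => u; rewrite pi_scale scale1r. Qed.

Let scaleDr : right_distributive quotient_scale +%R.
Proof.
move=> a; elim/quotW => u; elim/quotW => v.
by rewrite piD !pi_scale piD scalerDr.
Qed.

Let scaleDl x : {morph quotient_scale^~ x : a b / a + b}.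
Proof. by move=> a b; elim/quotW: x => u; rewrite !pi_scale piD scalerDl. Qed.

HB.instance Definition _ := GRing.Zmodule_isLmodule.Build K Q
  scaleA scale1 scaleDr scaleDl.

Definition quotient_repr (x : Q) : V := \val (repr x).

End QuotientModule.

Section ComplexFunctions.
Context (R : realType).
Local Notation C := R[i].
Local Notation mu := (@lebesgue_measure R).
Implicit Types (D J : set R) (f g : R -> C).

Definition reF f : R -> R := fun x => complex.Re (f x).
Definition imF f : R -> R := fun x => complex.Im (f x).

Definition cmeasurable D f : Prop :=
  measurable_fun D (reF f) /\ measurable_fun D (imF f).

Definition cintegral D f : C :=
  Complex (\int[mu]_(x in D) reF f x) (\int[mu]_(x in D) imF f x).

Definition csqr (z : C) : R := complex.Re z ^+ 2 + complex.Im z ^+ 2.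

(* The square of the norm of [f] in [L^2(D)]. *)
Definition L2sqnorm D f : \bar R := (\int[mu]_(x in D) (csqr (f x))%:E)%E.

Definition L2norm D f : R := Num.sqrt (fine (L2sqnorm D f)).

Definition L2 D : set (R -> C) :=
  [set f | cmeasurable D f /\ (L2sqnorm D f < +oo)%E].

(* [f] has compact support contained in [J], as a class of functions modulo
   equality almost everywhere. *)
Definition ae_compact_support J f : Prop := exists S : set R,
  [/\ compact S, S `<=` J & \forall x \ae mu, ~ S x -> f x = 0].

Definition cderive f : R -> C :=
  fun x => Complex (derive1 (reF f) x) (derive1 (imF f) x).

Definition smooth (f : R -> R) : Prop :=
  forall n x, derivable (derive1n n f) x 1.

(* [C_c^oo(J)], for [J] open *)
Definition test_function J : set (R -> C) :=
  [set phi | [/\ smooth (reF phi), smooth (imF phi) & exists S : set R,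
    [/\ compact S, S `<=` J & forall x, ~ S x -> phi x = 0]]].

Definition weak_derivative J f g : Prop := forall phi, test_function J phi ->
  cintegral J (f \* cderive phi) = - cintegral J (g \* phi).

(* [f] is in [H^2(J)], with [f' = f1] and [f'' = f2] *)
Definition H2_jet J f f1 f2 : Prop :=
  [/\ L2 J f, L2 J f1, L2 J f2, weak_derivative J f f1
    & weak_derivative J f1 f2].

Definition H2 J : set (R -> C) := [set f | exists f1 f2, H2_jet J f f1 f2].

(* The closure of [C_c^oo(J)] in [H^2(J)], for the norm
   [|f|^2 + |f'|^2 + |f''|^2] *)
Definition H20 J : set (R -> C) := [set f | exists f1 f2, H2_jet J f f1 f2 /\
  forall e : R, 0 < e -> exists phi, test_function J phi /\
    (L2sqnorm J (f \- phi)%R + L2sqnorm J (f1 \- cderive phi)%R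
     + L2sqnorm J (f2 \- cderive (cderive phi))%R < e%:E)%E].

Definition L2loc_pred J : {pred R -> C} :=
  mem [set f | forall S, compact S -> S `<=` J -> L2 S f].

Definition L2c_pred J : {pred R -> C} :=
  mem [set f | L2 setT f /\ ae_compact_support J f].

Definition aezero_pred D : {pred R -> C} :=
  mem [set f | \forall x \ae mu, D x -> f x = 0].

Let ReD (z w : C) : complex.Re (z + w) = complex.Re z + complex.Re w.
Proof. by case: z w => ? ? []. Qed.

Let ImD (z w : C) : complex.Im (z + w) = complex.Im z + complex.Im w.
Proof. by case: z w => ? ? []. Qed.

Let ReM (z w : C) : complex.Re (z * w) =
  complex.Re z * complex.Re w - complex.Im z * complex.Im w.
Proof. by case: z w => ? ? []. Qed.

Let ImM (z w : C) : complex.Im (z * w) =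
  complex.Re z * complex.Im w + complex.Im z * complex.Re w.
Proof. by case: z w => ? ? []. Qed.

Lemma csqr_ge0 z : 0 <= csqr z.
Proof. by rewrite addr_ge0 ?sqr_ge0. Qed.

Lemma csqrD z w : csqr (z + w) <= 2 * csqr z + 2 * csqr w.
Proof.
case: z w => [a b] [c d]; rewrite /csqr /= -subr_ge0.
have -> : 2 * (a ^+ 2 + b ^+ 2) + 2 * (c ^+ 2 + d ^+ 2)
  - ((a + c) ^+ 2 + (b + d) ^+ 2) = (a - c) ^+ 2 + (b - d) ^+ 2 by ring.
by rewrite addr_ge0 ?sqr_ge0.
Qed.

Lemma csqrM z w : csqr (z * w) = csqr z * csqr w.
Proof. by case: z w => [a b] [c d]; rewrite /csqr /=; ring. Qed.

Lemma cmeasurable_csqr D f :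
  cmeasurable D f -> measurable_fun D (EFin \o (csqr \o f)).
Proof.
move=> [mr mi]; apply/measurable_EFinP.
by apply: measurable_funD; apply: measurable_funX.
Qed.

Lemma L2_0 D : measurable D -> L2 D 0.
Proof.
move=> mD; split; first by split; exact: measurable_cst.
rewrite /L2sqnorm integral0_eq// => x _.
by rewrite /csqr /= expr0n addr0.
Qed.

Lemma L2_D D f g : measurable D -> L2 D f -> L2 D g -> L2 D (f + g).
Proof.
move=> mD [mf lf] [mg lg].
have mfg : cmeasurable D (f + g).
  case: mf mg => fr fi [gr gi]; split.
    rewrite (_ : reF _ = reF f \+ reF g); first exact: measurable_funD.
    by apply/funext => x; rewrite /reF /= -ReD.
  rewrite (_ : imF _ = imF f \+ imF g); first exact: measurable_funD.
  by apply/funext => x; rewrite /imF /= -ImD.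
split => //.
have m2 h : cmeasurable D h ->
    measurable_fun D (fun x => 2%:E * (csqr (h x))%:E)%E.
  by move=> mh; apply: measurable_funeM; exact: cmeasurable_csqr.
have i2 h : cmeasurable D h -> (L2sqnorm D h < +oo)%E ->
    (\int[mu]_(x in D) (2%:E * (csqr (h x))%:E) < +oo)%E.
  move=> mh lh; rewrite ge0_integralZl//.
  - by rewrite lte_mul_pinfty// lee_fin.
  - exact: cmeasurable_csqr.
  - by move=> x _; rewrite lee_fin csqr_ge0.
apply: (@le_lt_trans _ _
  (\int[mu]_(x in D) (2%:E * (csqr (f x))%:E + 2%:E * (csqr (g x))%:E))%E).
  apply: ge0_le_integral => //.
  - by move=> x _; rewrite lee_fin csqr_ge0.
  - exact: cmeasurable_csqr.
  - by apply: emeasurable_funD; exact: m2.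
  - by move=> x _; rewrite -!EFinM -EFinD lee_fin csqrD.
rewrite ge0_integralD//.
- by rewrite lte_add_pinfty ?i2.
- by move=> x _; rewrite -!EFinM lee_fin mulr_ge0 ?csqr_ge0.
- exact: m2.
- by move=> x _; rewrite -!EFinM lee_fin mulr_ge0 ?csqr_ge0.
- exact: m2.
Qed.

Lemma L2_Z D a f : measurable D -> L2 D f -> L2 D (a *: f).
Proof.
move=> mD [[fr fi] lf].
split.
  split.
    rewrite (_ : reF _ = complex.Re a \*o reF f \- complex.Im a \*o imF f).
      by apply: measurable_funB; exact: measurable_funM.
    by apply/funext => x; rewrite /reF /= -ReM.
  rewrite (_ : imF _ = complex.Re a \*o imF f \+ complex.Im a \*o reF f).
    by apply: measurable_funD; exact: measurable_funM.
  by apply/funext => x; rewrite /imF /= -ImM.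
rewrite /L2sqnorm.
under eq_integral do rewrite csqrM EFinM.
rewrite ge0_integralZl//.
- by rewrite lte_mul_pinfty// lee_fin csqr_ge0.
- exact: cmeasurable_csqr.
- by move=> x _; rewrite lee_fin csqr_ge0.
- by rewrite lee_fin csqr_ge0.
Qed.

Let ae_filter : Filter (nbhs (almost_everywhere mu)).
Proof. exact: ae_filter_ringOfSetsType. Qed.

Let L2loc_closed J : subsemimod_closed (L2loc_pred J).
Proof.
split; first split.
- by rewrite inE => S cS _; apply: L2_0; exact: compact_measurable.
- move=> f g; rewrite !inE => Jf Jg S cS SJ.
  exact: L2_D (compact_measurable cS) (Jf _ cS SJ) (Jg _ cS SJ).
- move=> a f; rewrite !inE => Jf S cS SJ.
  exact: L2_Z (compact_measurable cS) (Jf _ cS SJ).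
Qed.

HB.instance Definition _ J :=
  GRing.isSubmodClosed.Build C (R -> C) (L2loc_pred J) (L2loc_closed J).

Let L2c_closed J : subsemimod_closed (L2c_pred J).
Proof.
split; first split.
- rewrite inE; split; first exact: L2_0.
  by exists set0; split; [exact: compact0|exact: sub0set|exact: aeW].
- move=> f g; rewrite !inE => -[f2 [S [cS SJ Sf]]] [g2 [T [cT TJ Tg]]].
  split; first exact: L2_D.
  exists (S `|` T); split; [exact: compactU|by rewrite subUset|].
  apply: (filterS2 ae_filter _ Sf Tg) => x fS gT /not_orP[/fS fx /gT gx].
  by rewrite [LHS]/(f x + g x) fx gx; exact: (@addr0 C 0).
- move=> a f; rewrite !inE => -[f2 [S [cS SJ Sf]]].
  split; first exact: L2_Z.
  exists S; split => //.
  by apply: (@filterS _ _ ae_filter _ _ _ Sf) => x fS /fS fx;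
    rewrite [LHS]/(a * f x) fx; exact: (@mulr0 C a).
Qed.

HB.instance Definition _ J :=
  GRing.isSubmodClosed.Build C (R -> C) (L2c_pred J) (L2c_closed J).

Let aezero_closed D : subsemimod_closed (aezero_pred D).
Proof.
split; first split.
- by rewrite inE; exact: aeW.
- move=> f g; rewrite !inE; apply: (filterS2 ae_filter) => x Df Dg Dx.
  by rewrite [LHS]/(f x + g x) Df// Dg//; exact: (@addr0 C 0).
- move=> a f; rewrite !inE; apply: (@filterS _ _ ae_filter) => x Df Dx.
  by rewrite [LHS]/(a * f x) Df//; exact: (@mulr0 C a).
Qed.

HB.instance Definition _ D :=
  GRing.isSubmodClosed.Build C (R -> C) (aezero_pred D) (aezero_closed D).

End ComplexFunctions.

(* Functions modulo equality almost everywhere on [J], respectively on the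
   real line. *)
Definition L2loc (R : realType) (J : set R) : Type :=
  quotient_module (L2loc_pred J) (aezero_pred J).
Definition L2c (R : realType) (J : set R) : Type :=
  quotient_module (L2c_pred J) (aezero_pred setT).

HB.instance Definition _ (R : realType) (J : set R) :=
  GRing.Lmodule.on (L2loc J).
HB.instance Definition _ (R : realType) (J : set R) :=
  GRing.Lmodule.on (L2c J).

Definition L2loc_fun (R : realType) (J : set R) (u : L2loc J) : R -> R[i] :=
  quotient_repr u.
Definition L2c_fun (R : realType) (J : set R) (g : L2c J) : R -> R[i] :=
  quotient_repr g.
Coercion L2loc_fun : L2loc >-> Funclass.
Coercion L2c_fun : L2c >-> Funclass.

(* [<g, u>], without complex conjugation *)
Definition pairing (R : realType) (J : set R) (g : L2c J) (u : L2loc J)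
  : R[i] := cintegral J (g \* u).

(* The intervals [I_j] and the cut-off functions that define the seminorms of
   [L^2_loc(J)]. *)
Record exhaustion (R : realType) (J : set R) := Exhaustion {
  lend : nat -> R;
  rend : nat -> R;
  cutoff : nat -> R -> R[i];
  lend_lt_rend : forall j, lend j < rend j;
  exhaustion_sub : forall j,
    `[lend j, rend j]%classic `<=` `]lend j.+1, rend j.+1[%classic;
  exhaustion_cover : J = \bigcup_j `[lend j, rend j]%classic;
  cutoff_test : forall j, test_function `]lend j.+1, rend j.+1[%classic (cutoff j);
  cutoff_eq1 : forall j x, `[lend j, rend j]%classic x -> cutoff j x = 1
}.

Section Spaces.
Context (R : realType) (J : set R).

Definition L2loc_seminorm (E : exhaustion J) (j : nat) (u : L2loc J) : R :=
  L2norm setT (cutoff E j \* u).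

(* [L^2_loc(J)] with its Frechet topology *)
Definition L2loc_space (E : exhaustion J) : Type :=
  seminorm_topology (L2loc_seminorm E).

HB.instance Definition _ E := Topological.on (L2loc_space E).
HB.instance Definition _ E := GRing.Lmodule.copy (L2loc_space E) (L2loc J).

(* [L^2_c(J)] with the weak* topology, i.e. that of pointwise convergence on
   [L^2_loc(J)] *)
Definition L2c_space : Type :=
  initial_topology (@pairing R J : L2c J -> {ptws L2loc J -> R[i]^o}).

HB.instance Definition _ := Topological.on L2c_space.
HB.instance Definition _ := GRing.Lmodule.copy L2c_space (L2c J).

(* The weak derivative, with value [0] if there is none in the space; its
   values are only used on elements of [H^2]. *)
Definition L2loc_derive (u : L2loc J) : L2loc J :=
  xget 0 [set v : L2loc J | weak_derivative J u v].
Definition L2c_derive (g : L2c J) : L2c J :=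
  xget 0 [set h : L2c J | weak_derivative setT g h].

Definition H2c_space : set L2c_space := [set g : L2c J | H2 setT g].

Definition Laplacian (E : exhaustion J) : operator (L2loc_space E) :=
  Operator [set u : L2loc J | H20 J u] (fun u => L2loc_derive (L2loc_derive u)).

Definition Laplacian_adjoint (E : exhaustion J) : operator L2c_space :=
  adjoint (@pairing R J : L2c_space -> L2loc_space E -> R[i]) (Laplacian E).

End Spaces.

Arguments H2c_space {R J}.

(* Main.v *)
Require Import Defs.
From HB Require Import structures.
From mathcomp Require Import all_boot all_order all_algebra.
From mathcomp Require Import ring lra complex generic_quotient ring_quotient.
From mathcomp Require Import all_classical all_reals all_analysis.
From mathcomp Require Import measurable_realfun.

(** Two elementary facts are used throughout: for every complex [l] and
    polynomial [p] the equation [w'' - l w = p] has a polynomial solution [w],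
    and polynomials are dense in [L^2] of a compact interval.  Testing against
    such [w] (no boundary conditions are needed, since the elements of
    [H^2_0] carry them all) gives the injectivity of [l - Delta] and of
    [l - Delta^*]; multiplying [w] by a cut-off gives the density of the range
    of [l - Delta].  A solution of [w'' = l w], cut off far away, is mapped by
    [l - Delta] to a function that vanishes on a given compact set, so that
    [(l - Delta)^-1] is not continuous; and integration against [w] annihilates
    the range of [l - Delta^*].

    If [u |-> <g, u''>] is continuous then [phi |-> \int g phi''] is bounded for
    the [L^2] norm, and so is [psi |-> \int g psi'] because [psi] has a
    primitive that is bounded by its [L^2] norm; the Riesz representation
    theorem then yields the two weak derivatives of [g]. *)

Set Implicit Arguments.
Unset Strict Implicit.
Unset Printing Implicit Defensive.
Import Order.TTheory GRing.Theory Num.Theory.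
Import numFieldNormedType.Exports.
Local Open Scope classical_set_scope.
Local Open Scope ring_scope.

(** * Square-integrable functions *)

(** The asymmetry between the two operators has one source. The topology of [L2loc_space] sees only
    compact subsets of the interval, while the conditions imposed by [H20] sit at the endpoints.
    Approximation in [L2loc_space] therefore meets no constraint from the boundary, whereas a change
    of [u] near an endpoint can propagate inside without being noticed there. Dually, an element of
    [L2c_space] may be integrated against any function of [L2loc], including a solution of
    [w'' = l w] with no boundary condition, and this integration is weak* continuous.

    Two technical points shape the text. [Delta] and its adjoint are chosen by [xget] on classes of
    functions, so even their values at simple elements, or their additivity inside an integral, have
    to be recovered from integral identities. And many auxiliary functions (polynomials,
    exponentials, primitives of test functions) lack compact support; a cut-off equal to [1] near
    the support of [g], or near the compact set under consideration, turns them into test functions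
    without changing the integrals or values that matter. *)

Section SquareIntegrable.
Context d (T : measurableType d) (R : realType).
Variables (mu : {measure set T -> \bar R}) (D : set T) (mD : measurable D).
Implicit Types (f g h : T -> R).

Definition sqint f := measurable_fun D f /\
  mu.-integrable D (EFin \o (fun x => f x * f x)).

Definition ip f g : R := \int[mu]_(x in D) (f x * g x).

Lemma sqint_mul f g : sqint f -> sqint g ->
  mu.-integrable D (EFin \o (fun x => f x * g x)).
Proof.
move=> [mf f2] [mg g2].
have fg2 : mu.-integrable D (EFin \o (fun x => f x * f x + g x * g x)).
  exact: (integrableD mD f2 g2).
apply: le_integrable fg2 => //.
  by apply/measurable_EFinP; exact: measurable_funM.
move=> x _ /=; rewrite lee_fin [leRHS]ger0_norm ?addr_ge0 ?sqr_ge0 -?expr2 ?sqr_ge0//.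
by case: (ger0P (f x * g x)) => _; nra.
Qed.

Lemma integrable_mul_bounded f g (M : R) : mu.-integrable D (EFin \o f) ->
  measurable_fun D g -> (forall x, D x -> `|g x| <= M) ->
  mu.-integrable D (EFin \o (fun x => f x * g x)).
Proof.
move=> intf mg gM.
have mf : measurable_fun D f by apply/measurable_EFinP; case/integrableP : intf.
apply: (le_integrable mD _ _ (integrableZl mD M intf)).
  by apply/measurable_EFinP; exact: measurable_funM.
move=> x Dx /=; rewrite lee_fin !normrM mulrC ler_wpM2r//.
exact: le_trans (gM x Dx) (ler_norm _).
Qed.

Lemma integrable_scale c f : mu.-integrable D (EFin \o f) ->
  mu.-integrable D (EFin \o (fun x => c * f x)).
Proof.
by move=> ig; apply: eq_integrable (integrableZl mD c ig) => // x _ /=; rewrite EFinM.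
Qed.

Lemma integrable_add f g : mu.-integrable D (EFin \o f) ->
  mu.-integrable D (EFin \o g) ->
  mu.-integrable D (EFin \o (fun x => f x + g x)).
Proof.
by move=> fi gi; apply: eq_integrable (integrableD mD fi gi).
Qed.

Lemma integrable_sub f g : mu.-integrable D (EFin \o f) ->
  mu.-integrable D (EFin \o g) ->
  mu.-integrable D (EFin \o (fun x => f x - g x)).
Proof.
by move=> fi gi; apply: eq_integrable (integrableB mD fi gi).
Qed.

Lemma sqintZ a f : sqint f -> sqint (fun x => a * f x).
Proof.
move=> [mf f2]; split; first exact: measurable_funM.
apply: eq_integrable (integrableZl mD (a * a) f2) => // x _ /=.
by rewrite -EFinM; congr EFin; ring.
Qed.

Lemma sqintD f g : sqint f -> sqint g -> sqint (fun x => f x + g x).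
Proof.
move=> sf sg; split; first by apply: measurable_funD; [case: sf|case: sg].
have h := integrableD mD sf.2 (integrableD mD sg.2 (integrableZl mD 2 (sqint_mul sf sg))).
apply: eq_integrable h => // x _ /=.
by rewrite -EFinM -!EFinD; congr EFin; ring.
Qed.

Lemma sqintB f g : sqint f -> sqint g -> sqint (fun x => f x - g x).
Proof.
move=> sf sg; rewrite (_ : (fun x => _) = fun x => f x + (-1) * g x).
  exact/sqintD/sqintZ.
by apply/funext => x; rewrite mulN1r.
Qed.

Lemma ipC f g : ip f g = ip g f.
Proof. by apply: eq_Rintegral => x _; rewrite mulrC. Qed.

Lemma ipDr f g h : sqint f -> sqint g -> sqint h ->
  ip f (fun x => g x + h x) = ip f g + ip f h.
Proof.
move=> sf sg sh; rewrite /ip -RintegralD//; try exact: sqint_mul.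
by apply: eq_Rintegral => x _; rewrite mulrDr.
Qed.

Lemma ipZr a f g : sqint f -> sqint g ->
  ip f (fun x => a * g x) = a * ip f g.
Proof.
move=> sf sg; rewrite /ip -RintegralZl//; try exact: sqint_mul.
by apply: eq_Rintegral => x _; rewrite mulrCA.
Qed.

Lemma ipDl f g h : sqint f -> sqint g -> sqint h ->
  ip (fun x => g x + h x) f = ip g f + ip h f.
Proof. by move=> sf sg sh; rewrite ipC ipDr// ipC (ipC f). Qed.

Lemma ipZl a f g : sqint f -> sqint g ->
  ip (fun x => a * g x) f = a * ip g f.
Proof. by move=> sf sg; rewrite ipC ipZr// ipC. Qed.

Lemma ipBr f g h : sqint f -> sqint g -> sqint h ->
  ip f (fun x => g x - h x) = ip f g - ip f h.
Proof.
move=> sf sg sh; rewrite (_ : (fun x => _) = fun x => g x + (-1) * h x).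
  by rewrite ipDr ?ipZr ?mulN1r//; exact: sqintZ.
by apply/funext => x; rewrite mulN1r.
Qed.

Lemma ipBl f g h : sqint f -> sqint g -> sqint h ->
  ip (fun x => g x - h x) f = ip g f - ip h f.
Proof. by move=> sf sg sh; rewrite ipC ipBr// ipC (ipC f). Qed.

Lemma ip_ge0 f : 0 <= ip f f.
Proof. by apply: Rintegral_ge0 => x _; rewrite -expr2 sqr_ge0. Qed.

Lemma ip_comb f g (t : R) : sqint f -> sqint g ->
  ip (fun x => f x + t * g x) (fun x => f x + t * g x) =
  ip f f + 2 * t * ip f g + t ^+ 2 * ip g g.
Proof.
move=> sf sg; have sg' := sqintZ t sg.
rewrite ipDr ?ipDl ?ipZr ?ipZl//; try exact: sqintD.
by rewrite (ipC g f); ring.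
Qed.

(** The discriminant criterion. It gives both forms of Cauchy-Schwarz below and, in [riesz], the
    Euler-Lagrange estimate for an almost minimiser. *)
Lemma quadratic_ge0 (a b c : R) : 0 <= c ->
  (forall t : R, 0 <= a + 2 * t * b + t ^+ 2 * c) -> b ^+ 2 <= a * c.
Proof.
move=> c0 H; have [c_eq0|cn0] := eqVneq c 0.
  rewrite c_eq0 mulr0; have [->|bn0] := eqVneq b 0; first by rewrite expr0n.
  (* With [c = 0] the form is affine in [t]; this [t] gives it the value [-1]. *)
  have := H (- (a + 1) / (2 * b)).
  have -> : a + 2 * (- (a + 1) / (2 * b)) * b + (- (a + 1) / (2 * b)) ^+ 2 * c = -1.
    by rewrite c_eq0; field; rewrite bn0.
  by rewrite oppr_ge0 ler10.
have cgt0 : 0 < c by rewrite lt_neqAle eq_sym cn0.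
have := H (- b / c); rewrite -subr_ge0 => h.
have -> : a * c = (a + 2 * (- b / c) * b + (- b / c) ^+ 2 * c) * c + b ^+ 2.
  by field.
by rewrite lerDr mulr_ge0// -(subr0 (_ + _)).
Qed.

Lemma ip_CS f g : sqint f -> sqint g -> ip f g ^+ 2 <= ip f f * ip g g.
Proof.
move=> sf sg; apply: quadratic_ge0; first exact: ip_ge0.
by move=> t; rewrite -ip_comb ?ip_ge0.
Qed.

Lemma EFin_ip f : sqint f -> (ip f f)%:E = (\int[mu]_(x in D) (f x * f x)%:E)%E.
Proof. by move=> [mf f2]; rewrite fineK//; exact: integrable_fin_num. Qed.

Lemma sqintP f : measurable_fun D f ->
  (\int[mu]_(x in D) (f x * f x)%:E < +oo)%E -> sqint f.
Proof.
move=> mf f2; split => //; apply/integrableP; split.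
  by apply/measurable_EFinP; exact: measurable_funM.
under eq_integral => x _ do rewrite /= ger0_norm -?expr2 ?sqr_ge0// expr2.
exact: f2.
Qed.

(** The weight [4 ^+ n] forces the increments below a constant times [2^-n], so their series
    converges absolutely. Taking [M + 1] as that constant avoids a square root, since
    [M <= (M + 1) ^+ 2]. *)
Lemma cvgn_of_geometric_increments (u : R ^nat) (M : R) :
  (forall n, 4 ^+ n * (u n.+1 - u n) ^+ 2 <= M) -> cvgn u.
Proof.
move=> H; have M0 : 0 <= M by apply: le_trans (H 0%N); rewrite expr0 mul1r sqr_ge0.
have [C [C0 HC]] : exists C : R, 0 <= C /\ M <= C ^+ 2.
  by exists (M + 1); split; [rewrite addr_ge0|nra].
have bnd n : `|u n.+1 - u n| <= geometric C (2^-1) n.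
  rewrite /geometric /= -ler_sqr ?nnegrE ?mulr_ge0 ?exprn_ge0//.
  rewrite real_normK ?num_real// exprMn -exprM mulnC exprM.
  have -> : (2^-1 : R) ^+ 2 = 4^-1 by field.
  rewrite exprVn -ler_pdivrMr ?invr_gt0 ?exprn_gt0// invrK mulrC.
  exact: le_trans (H n) HC.
have cs : cvgn (series (fun n => u n.+1 - u n)).
  apply: (@normed_cvg R R^o); apply: series_le_cvg bnd _ => //.
    by move=> n; rewrite mulr_ge0// exprn_ge0.
  by apply: is_cvg_geometric_series; rewrite ger0_norm// invf_lt1// ltr1n.
have -> : u = (fun n => u 0%N + series (fun n => u n.+1 - u n) n).
  apply/funext => n; rewrite /series/= telescope_sumr//.
  by rewrite addrC subrK.
by apply: is_cvgD => //; exact: is_cvg_cst.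
Qed.

(** Riesz-Fischer for a sequence whose Cauchy rate is prescribed. The rate [8 ^- n] is fast enough
    to absorb the weight [4 ^+ n]: the series [G] of weighted squared increments has integral at
    most [2 * c], hence is finite almost everywhere, and there the sequence converges pointwise.
    Fatou's lemma carries the rate over to the limit. *)
Lemma sqint_complete (f : nat -> T -> R) (c : R) : (forall n, sqint (f n)) ->
  (forall n m, (n <= m)%N ->
    ip (fun x => f m x - f n x) (fun x => f m x - f n x) <= c * 8 ^- n) ->
  exists h, sqint h /\ forall n,
    ip (fun x => h x - f n x) (fun x => h x - f n x) <= c * 8 ^- n.
Proof.
move=> sf cau.
have c0 : 0 <= c.
  have := cau 0%N 0%N isT; rewrite expr0 invr1 mulr1; apply: le_trans.
  exact: ip_ge0.
have sd n m := sqintB (sf m) (sf n).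
pose F n x := ((4 ^+ n * ((f n.+1 x - f n x) * (f n.+1 x - f n x)))%:E).
pose G x := (\sum_(0 <= n <oo) F n x)%E.
have F0 n x : (0 <= F n x)%E.
  by rewrite lee_fin mulr_ge0 ?exprn_ge0// -expr2 sqr_ge0.
have mF n : measurable_fun D (F n).
  apply/measurable_EFinP; apply: measurable_funM => //.
  by apply: measurable_funM; case: (sd n n.+1).
have mG : measurable_fun D G.
  by apply: ge0_emeasurable_sum => // n x Dx _; exact: mF.
have G0 x : (0 <= G x)%E by exact: nneseries_ge0.
have iG : (\int[mu]_(x in D) G x < +oo)%E.
  rewrite integral_nneseries//.
  apply: (@le_lt_trans _ _ (\sum_(0 <= n <oo) ((2 * c) / (2 ^ n.+1)%:R)%:E)%E).
    apply: lee_nneseries; first by move=> n _ _; exact: integral_ge0.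
    move=> n _; under eq_integral => x _ do rewrite /F EFinM.
    rewrite ge0_integralZl//; last 2 first.
    - apply/measurable_EFinP; apply: measurable_funM; by case: (sd n n.+1).
    - by move=> x _; rewrite lee_fin -expr2 sqr_ge0.
    rewrite -EFin_ip// -EFinM lee_fin (le_trans (ler_wpM2l _ (cau n n.+1 _)))// ?exprn_ge0//.
    rewrite natrX exprS (_ : (8 : R) ^+ n = 4 ^+ n * 2 ^+ n).
      by rewrite le_eqVlt; apply/orP; left; apply/eqP; field; rewrite !expf_neq0.
    by rewrite -exprMn; congr (_ ^+ _); ring.
  apply: le_lt_trans (epsilon_trick0 xpredT _) _; last exact: ltry.
  by rewrite mulr_ge0.
have GI : mu.-integrable D G.
  apply/integrableP; split => //.
  by under eq_integral => x _ do rewrite gee0_abs//.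
pose N := D `&` [set x | G x = +oo%E].
have mN : measurable N.
  exact: mG mD _ (emeasurable_set1 +oo%E).
have muN : mu N = 0%E.
  have := integrable_ae mD GI.
  case=> N' [mN' muN' sN']; apply/eqP; rewrite -measure_le0 -muN'.
  apply: le_measure; rewrite ?inE// => x [Dx /= Gx]; apply: sN' => /=.
  by rewrite Gx => /(_ Dx).
pose A := D `\` N.
have mA : measurable A by exact: measurableD.
have AD : A `<=` D by move=> x [].
have cvgA x : A x -> cvgn (f^~ x).
  move=> [Dx nN].
  have Gf : G x \is a fin_num.
    by rewrite ge0_fin_numE// ltey; apply/eqP => Gx; exact: nN.
  apply: (@cvgn_of_geometric_increments _ (fine (G x))) => n.
  rewrite -lee_fin fineK// expr2; apply: (@le_trans _ _ (\sum_(0 <= i < n.+1) F i x)%E).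
    by rewrite big_nat_recr//= leeDr// sume_ge0.
  exact: nneseries_lim_ge.
(* Cutting off to [0] outside [A] makes the limit exist at every point, which yields the
   measurability of [h]. *)
pose g n := f n \_ A.
pose h x := limn (g^~ x).
have cg x : g^~ x @ \oo --> h x.
  rewrite /h /g; case: (pselect (A x)) => Ax.
    rewrite (_ : (fun n => _) = f^~ x); first exact: cvgA.
    by apply/funext => n; rewrite patchE mem_set.
  rewrite (_ : (fun n => _) = cst 0); first exact: is_cvg_cst.
  by apply/funext => n; rewrite patchE memNset.
have mg n : measurable_fun D (g n).
  apply/(measurable_restrict _ mA mD); rewrite setIidr//.
  by apply: measurable_funS AD _ => //; case: (sf n).
have mh : measurable_fun D h by apply: measurable_fun_cvg mg _ => x _; exact: cg.
have bound n : (\int[mu]_(x in D) ((h x - f n x) * (h x - f n x))%:E <= (c * 8 ^- n)%:E)%E.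
  have mhn : measurable_fun D (fun x => ((h x - f n x) * (h x - f n x))%:E).
    have mB : measurable_fun D (fun x => h x - f n x).
      by apply: measurable_funB => //; case: (sf n).
    by apply/measurable_EFinP; exact: measurable_funM.
  pose u m x := ((f (m + n)%N x - f n x) * (f (m + n)%N x - f n x))%:E.
  have mu_ m : measurable_fun D (u m).
    by apply/measurable_EFinP; apply: measurable_funM; case: (sd n (m + n)%N).
  have u0 m x : (0 <= u m x)%E by rewrite lee_fin -expr2 sqr_ge0.
  rewrite (ge0_negligible_integral mN mD)//; last first.
    by move=> x _; rewrite lee_fin -expr2 sqr_ge0.
  rewrite (_ : integral _ _ _ = \int[mu]_(x in A) limn_einf (u^~ x))%E; last first.
    apply: eq_integral => x /set_mem Ax; apply/esym.
    suff : u^~ x @ \oo --> ((h x - f n x) * (h x - f n x))%:E.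
      by move=> /cvg_limn_einf_sup[].
    have cf : (f (m + n)%N x - f n x) @[m --> \oo] --> h x - f n x.
      apply: cvgB; last exact: cvg_cst.
      rewrite (cvg_shiftn n (f^~ x)) (_ : f^~ x = g^~ x); first exact: cg.
      by apply/funext => m; rewrite /g patchE mem_set.
    by apply: cvg_EFin; [exact: nearW|exact: cvgM].
  apply: (le_trans (fatou mu mA _ _)) => //.
    by move=> m; exact: measurable_funS (mu_ m).
  rewrite limn_einf_lim; apply: lime_le; first exact: is_cvg_einfs.
  apply: nearW => m; apply: (@le_trans _ _ (\int[mu]_(x in A) u m x)%E).
    by apply: ereal_inf_lbound; exists m => /=.
  apply: (@le_trans _ _ (\int[mu]_(x in D) u m x)%E).
    exact: ge0_subset_integral.
  by rewrite -EFin_ip// lee_fin; apply: cau; exact: leq_addl.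
have sh n : sqint (fun x => h x - f n x).
  apply: sqintP; first by apply: measurable_funB => //; case: (sf n).
  exact: le_lt_trans (bound n) (ltry _).
exists h; split.
  rewrite (_ : h = fun x => (h x - f 0%N x) + f 0%N x); first exact: sqintD.
  by apply/funext => x; rewrite subrK.
by move=> n; rewrite -lee_fin EFin_ip.
Qed.

(* The representing element is the limit of a minimising sequence of
   [ip f f - 2 * L f] over [V]. *)
Lemma riesz (V : set (T -> R)) (L : (T -> R) -> R) (C : R) :
  0 <= C -> V (fun=> 0) ->
  (forall a f g, V f -> V g -> V (fun x => f x + a * g x)) ->
  (forall a f g, V f -> V g -> L (fun x => f x + a * g x) = L f + a * L g) ->
  (forall f, V f -> sqint f) ->
  (forall f, V f -> L f ^+ 2 <= C * ip f f) ->
  exists h, [/\ sqint h, forall f, V f -> L f = ip h f &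
    forall e, 0 < e -> exists2 f, V f &
      ip (fun x => h x - f x) (fun x => h x - f x) < e].
Proof.
move=> C0 V0 Vlin Llin Vs Lb.
pose J f := ip f f - 2 * L f.
(* From [L f ^+ 2 <= C * q] with [q = ip f f], the arithmetic-geometric mean inequality gives
   [2 * L f <= q + C]. *)
have Jlb f : V f -> - C <= J f.
  move=> Vf; have := Lb _ Vf; have := ip_ge0 f; rewrite /J.
  move: (ip f f) (L f) => q l q0 lq; rewrite lerNl leNgt; apply/negP => h.
  by have := sqr_ge0 (q - C); nra.
pose S := [set J f | f in V].
have hS : has_inf S.
  split; first by exists (J (fun=> 0)), (fun=> 0).
  by exists (- C) => _ [f Vf <-]; exact: Jlb.
pose m := inf S.
have Jm f : V f -> m <= J f by move=> Vf; apply: ge_inf; [case: hS|exists f].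
have ex n : exists f, V f /\ J f < m + 8 ^- n.
  have [] := @inf_adherent _ S (8 ^- n) _ hS; first by rewrite invr_gt0 exprn_gt0.
  by move=> _ [f Vf <-] ?; exists f.
pose v n := projT1 (cid (ex n)).
have Vv n : V (v n) by rewrite /v; case: cid => ? [].
have Jv n : J (v n) < m + 8 ^- n by rewrite /v; case: cid => ? [].
have sv n : sqint (v n) by exact: Vs.
have V2 n k : V (fun x => v n x + (-1) * v k x) by exact: Vlin.
(* Along the line [v n + t * f] the functional [J] drops by at most [8 ^- n] below its value at
   [v n]. The resulting quadratic in [t] is nonnegative, so its discriminant bounds the residual
   [ip (v n) f - L f]. *)
have variation n f : V f -> (ip (v n) f - L f) ^+ 2 <= 8 ^- n * ip f f.
  move=> Vf; apply: quadratic_ge0; first exact: ip_ge0.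
  move=> t; have := Jm _ (Vlin t _ _ (Vv n) Vf); have := Jv n.
  rewrite /J Llin// ip_comb//; last exact: Vs.
  by lra.
have decr n k : (n <= k)%N -> (8 : R) ^- k <= 8 ^- n.
  by move=> nk; rewrite lef_pV2 ?posrE ?exprn_gt0// ler_weXn2l// ler1n.
have [h [sh hv]] : exists h, sqint h /\ forall n,
    ip (fun x => h x - v n x) (fun x => h x - v n x) <= 4 * 8 ^- n.
  apply: sqint_complete => // n k nk.
  rewrite (_ : (fun x => v k x - v n x) = fun x => v k x + (-1) * v n x); last first.
    by apply/funext => x; rewrite mulN1r.
  set f := (fun x => _); have sf : sqint f by exact/Vs/V2.
  (* For [f = v k - v n] the squared norm is the difference of two residuals. Each has square at
     most [8 ^- n * ip f f], so one factor [ip f f] cancels and [4 * 8 ^- n] remains. *)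
  have qE : ip f f = (ip (v k) f - L f) - (ip (v n) f - L f).
    transitivity (ip (v k) f - ip (v n) f); last by ring.
    rewrite -ipBl//; congr ip.
    by apply/funext => x; rewrite /f mulN1r.
  have := variation n f (V2 _ _); have := variation k f (V2 _ _).
  have := decr _ _ nk; have := ip_ge0 f.
  have : 0 < (8 : R) ^- n by rewrite invr_gt0 exprn_gt0.
  move: qE; move: (ip (v k) f - L f) (ip (v n) f - L f) (ip f f) (8 ^- n) (8 ^- k).
  move=> a b q e e' -> {q} e0 q0 ee' qa qb.
  have [->|qn0] := eqVneq (a - b) 0; first by nra.
  have qgt0 : 0 < a - b by rewrite lt_neqAle eq_sym qn0.
  rewrite -(ler_pM2r qgt0) -expr2.
  have : (a - b) ^+ 2 <= 2 * a ^+ 2 + 2 * b ^+ 2 by have := sqr_ge0 (a + b); nra.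
  by nra.
have exp8 e : 0 < e -> exists n, 8 ^- n < e :> R.
  move=> e0.
  have : (8^-1 : R) ^+ n @[n --> \oo] --> 0.
    by apply: cvg_expr; rewrite ger0_norm// invf_lt1// ltr1n.
  move=> /cvgrPdist_lt /(_ _ e0)[n _ /(_ n (leqnn _))].
  by rewrite sub0r normrN ger0_norm ?exprn_ge0// exprVn => ?; exists n.
exists h; split => //.
- move=> f Vf; have sf := Vs _ Vf.
  apply/eqP; rewrite -subr_eq0; apply/negPn/negP => dn0.
  have d2 : 0 < (L f - ip h f) ^+ 2 by rewrite exprn_even_gt0.
  (* Splitting [L f - ip h f] at [ip (v n) f] bounds its square by [2 * 4 + 2 * 1 = 10] times
     [8 ^- n * ip f f]; the [+ 1] keeps the divisor positive. *)
  have r1 : 0 < 10 * ip f f + 1 by rewrite ltr_wpDl// mulr_ge0// ip_ge0.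
  have [n] := exp8 _ (divr_gt0 d2 r1).
  apply/negP; rewrite -leNgt ler_pdivrMr//.
  have := variation n f Vf; have := ip_CS (sqintB sh (sv n)) sf.
  rewrite ipBl//; have := hv n; have := ip_ge0 f.
  have : 0 < (8 : R) ^- n by rewrite invr_gt0 exprn_gt0.
  move: (ip (fun x => _) (fun x => _)) (8 ^- n) (ip f f) (ip h f) (ip (v n) f) (L f).
  move=> q e r a b l e0 r0 qe abq bl.
  have h1 : (l - a) ^+ 2 <= 2 * (a - b) ^+ 2 + 2 * (b - l) ^+ 2.
    by have := sqr_ge0 ((a - b) - (b - l)); nra.
  have h2 : q * r <= 4 * e * r by exact: ler_wpM2r.
  by nra.
- move=> e e0; have [n ne] := exp8 (e / 4) (divr_gt0 e0 (ltr0Sn _ _)).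
  by exists (v n) => //; apply: le_lt_trans (hv n) _; rewrite -ltr_pdivlMl// mulrC.
Qed.

End SquareIntegrable.

Arguments integrable_mul_bounded {d T R} mu {D} mD {f g} M.
Arguments integrable_scale {d T R} mu {D} mD c {f}.
Arguments integrable_add {d T R} mu {D} mD {f g}.
Arguments integrable_sub {d T R} mu {D} mD {f g}.
Arguments sqint_mul {d T R} mu {D} mD {f g}.
Arguments sqintZ {d T R} mu {D} mD a {f}.
Arguments sqintD {d T R} mu {D} mD {f g}.
Arguments sqintB {d T R} mu {D} mD {f g}.
Arguments ipDr {d T R} mu {D} mD {f g h}.
Arguments ipZr {d T R} mu {D} mD a {f g}.
Arguments ipDl {d T R} mu {D} mD {f g h}.
Arguments ipZl {d T R} mu {D} mD a {f g}.
Arguments ipBr {d T R} mu {D} mD {f g h}.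
Arguments ipBl {d T R} mu {D} mD {f g h}.
Arguments ip_comb {d T R} mu {D} mD {f g} t.
Arguments ip_CS {d T R} mu {D} mD {f g}.
Arguments EFin_ip {d T R} mu {D} mD {f}.
Arguments sqintP {d T R} mu {D f}.
Arguments riesz {d T R} mu {D} mD V L C.

(** * Density of polynomials *)

Section SignPolynomials.
Context {R : realType}.
Implicit Types (x s : R) (n : nat).

(* On [[-1, 1]] the iterates of [(3 x - x^3) / 2] converge boundedly to the
   sign of [x]. *)
Fixpoint sign_poly n : {poly R} :=
  if n is m.+1 then (3 / 2) *: sign_poly m - 2^-1 *: sign_poly m ^+ 3 else 'X.

Lemma sign_polyS n x :
  (sign_poly n.+1).[x] = (3 * (sign_poly n).[x] - (sign_poly n).[x] ^+ 3) / 2.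
Proof. by rewrite /= hornerD hornerN !hornerZ horner_exp; field. Qed.

Lemma sign_polyN n x : (sign_poly n).[- x] = - (sign_poly n).[x].
Proof.
elim: n => [|n IH]; first by rewrite /= !hornerX.
by rewrite !sign_polyS IH; field.
Qed.

Lemma sign_poly0 n : (sign_poly n).[0] = 0.
Proof. by have := sign_polyN n 0; rewrite oppr0; lra. Qed.

(** One iteration adds [s * (1 - s) * (1 + s) / 2] to the value [s] and leaves the distance
    [(1 - s) ^+ 2 * (2 + s) / 2] to [1]; both are nonnegative on the unit interval. *)
Lemma sign_poly_bound n x : 0 <= x <= 1 -> x <= (sign_poly n).[x] <= 1.
Proof.
move=> x01; elim: n => [|n]; first by rewrite /= hornerX; lra.
rewrite sign_polyS; move: (_.[x]) => s IH.
have h1 : 0 <= s * (1 - s) * (1 + s) by rewrite !mulr_ge0//; lra.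
have h2 : 0 <= (1 - s) * (1 - s) * (2 + s) by rewrite !mulr_ge0//; lra.
by nra.
Qed.

(** The distance to [1] is multiplied at each step by [1 - s / 2 - s ^+ 2 / 2], which is at most
    [1 - x / 2] because the iterates stay above [x]. *)
Lemma sign_poly_rate n x : 0 <= x <= 1 ->
  1 - (sign_poly n).[x] <= (1 - x / 2) ^+ n.
Proof.
move=> x01; elim: n => [|n IH]; first by rewrite /= hornerX expr0; lra.
rewrite sign_polyS [leRHS]exprS; have := sign_poly_bound n x01.
move: (_.[x]) IH => s IH xs.
have x2 : 0 <= 1 - x / 2 by lra.
apply: le_trans (ler_wpM2l x2 IH).
have h1 : 0 <= (1 - s) * (s - x) by rewrite !mulr_ge0//; lra.
have h2 : 0 <= (1 - s) * (s * s) by rewrite !mulr_ge0//; lra.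
by nra.
Qed.

Lemma sign_poly_norm n x : -1 <= x <= 1 -> `|(sign_poly n).[x]| <= 1.
Proof.
move=> x1; rewrite ler_norml; have [x0|x0] := leP 0 x.
  by have := @sign_poly_bound n x; lra.
by have := @sign_poly_bound n (- x); rewrite sign_polyN; lra.
Qed.

Lemma cvg_sign_poly x : -1 <= x <= 1 ->
  (sign_poly n).[x] @[n --> \oo] --> Num.sg x.
Proof.
have pos (y : R) : 0 < y -> y <= 1 -> (sign_poly n).[y] @[n --> \oo] --> (1 : R).
  move=> y0 y1; have y01 : 0 <= y <= 1 by lra.
  rewrite -[X in _ --> X]subr0.
  rewrite (_ : (fun n => _) = (fun n => 1 - (1 - (sign_poly n).[y]))); last first.
    by apply/funext => n; rewrite opprB addrC subrK.
  apply: cvgB; first exact: cvg_cst.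
  apply: (@squeeze_cvgr _ _ _ _ (fun=> 0) (fun n => (1 - y / 2) ^+ n)).
  - apply: nearW => n; rewrite sign_poly_rate// andbT.
    by have := sign_poly_bound n y01; lra.
  - exact: cvg_cst.
  - by apply: cvg_expr; rewrite ger0_norm; lra.
move=> x1; have [x0|x0|x0] := ltgtP x 0.
- rewrite ltr0_sg// (_ : (fun n => _) = (fun n => - (sign_poly n).[- x])); last first.
    by apply/funext => n; rewrite sign_polyN opprK.
  by apply: cvgN; apply: pos; lra.
- by rewrite gtr0_sg//; apply: pos => //; lra.
- rewrite x0 sgr0 (_ : (fun n => _) = fun=> 0); first exact: cvg_cst.
  by apply/funext => n; rewrite sign_poly0.
Qed.

End SignPolynomials.

Section PolynomialDensity.
Context {R : realType}.
Notation mu := (@lebesgue_measure R).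
Implicit Types (a b c : R) (f : R -> R).

Let ae_filter : Filter (nbhs (almost_everywhere mu)).
Proof. exact: ae_filter_ringOfSetsType. Qed.

Lemma aeS (P Q : R -> Prop) : (forall x, P x -> Q x) ->
  (\forall x \ae mu, P x) -> \forall x \ae mu, Q x.
Proof. by move=> PQ; apply: (@filterS _ _ ae_filter). Qed.

Lemma aeS2 (P Q S : R -> Prop) : (forall x, P x -> Q x -> S x) ->
  (\forall x \ae mu, P x) -> (\forall x \ae mu, Q x) ->
  \forall x \ae mu, S x.
Proof. by move=> PQ; apply: (filterS2 ae_filter). Qed.

Lemma ae_neq c : \forall x \ae mu, x != c.
Proof.
exists [set c]; split; [exact: measurable_set1|exact: lebesgue_measure_set1|].
by move=> x /= /negP; rewrite negbK => /eqP.
Qed.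

Lemma measurable_fun_horner (D : set R) (p : {poly R}) :
  measurable_fun D (fun x => p.[x]).
Proof.
apply: measurable_funTS; apply: continuous_measurable_fun.
exact: continuous_horner.
Qed.

(** The polynomials [q n] converge boundedly to [1 - Num.sg (x - c)], which is [2] to the left of
    [c] and [0] to the right. By dominated convergence twice the integral of [f] up to [c] vanishes;
    the value [1] at [c] itself is removed by passing to half-open intervals. *)
Lemma poly_annihilator_half f a b c : a < b -> c \in `[a, b] ->
  mu.-integrable `[a, b] (EFin \o f) ->
  (forall p : {poly R}, \int[mu]_(x in `[a, b]) (f x * p.[x]) = 0) ->
  \int[mu]_(x in `[a, c]) f x = 0.
Proof.
move=> ab cab intf H.
have mD : measurable `[a, b]%classic by exact: measurable_itv.
have mf : measurable_fun `[a, b] f by apply/measurable_EFinP; case/integrableP : intf.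
(* Dividing by [b - a] keeps the argument of [sign_poly] in the interval from [-1] to [1], where the
   iteration is bounded. *)
pose q n : {poly R} := 1 - (sign_poly n \Po ((b - a)^-1 *: ('X - c%:P))).
have qE n x : (q n).[x] = 1 - (sign_poly n).[(x - c) / (b - a)].
  by rewrite /q !(hornerE, horner_comp) mulrC.
have ba : 0 < b - a by rewrite subr_gt0.
have xc1 x : `[a, b]%classic x -> -1 <= (x - c) / (b - a) <= 1.
  move: cab; rewrite /= !in_itv/= => cab xab.
  by rewrite ler_pdivlMr// ler_pdivrMr//; lra.
have cq x : `[a, b]%classic x -> (q n).[x] @[n --> \oo] --> 1 - Num.sg (x - c).
  move=> xab; under eq_fun do rewrite qE.
  apply: cvgB; first exact: cvg_cst.
  rewrite (_ : Num.sg (x - c) = Num.sg ((x - c) / (b - a))).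
    exact: cvg_sign_poly (xc1 _ xab).
  by rewrite sgrM (gtr0_sg (x := _^-1)) ?invr_gt0// mulr1.
have lim0 : \int[mu]_(x in `[a, b]) (f x * (1 - Num.sg (x - c))) = 0.
  rewrite /Rintegral.
  have := @dominated_cvg _ _ _ mu _ mD (fun n x => (f x * (q n).[x])%:E)
    (fun x => (f x * (1 - Num.sg (x - c)))%:E) (fun x => (2 * `|f x|)%:E).
  move=> h; suff -> : (\int[mu]_(x in `[a, b]) (f x * (1 - Num.sg (x - c)))%:E = 0)%E by [].
  have {}h : (\int[mu]_(x in `[a, b]) (f x * (q n).[x])%:E)%E @[n --> \oo] -->
     (\int[mu]_(x in `[a, b]) (f x * (1 - Num.sg (x - c)))%:E)%E.
    apply: h => //.
    - move=> n; apply/measurable_EFinP; apply: measurable_funM => //.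
      exact: measurable_fun_horner.
    - move=> x xab; apply: cvg_EFin; first exact: nearW.
      by apply: cvgMr; exact: cq.
    - rewrite (_ : (fun x => _) = (fun x => 2%:E * (`|f x|)%:E)%E); last first.
        by apply/funext => x; rewrite EFinM.
      by apply: integrableZl => //; exact: integrable_norm.
    - move=> n x xab; rewrite abse_EFin lee_fin normrM mulrC ler_wpM2r//.
      rewrite qE; have := sign_poly_norm n (xc1 _ xab).
      by rewrite !ler_norml; lra.
  have z : (fun n => \int[mu]_(x in `[a, b]) (f x * (q n).[x])%:E)%E = cst 0%E.
    apply/funext => n; have := H (q n); rewrite /Rintegral => h0 /=.
    rewrite -[LHS]fineK ?h0//; apply: integrable_fin_num => //.
    apply: (@integrable_mul_bounded _ _ _ mu _ mD f (fun x => (q n).[x]) 2) => //.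
      exact: measurable_fun_horner.
    move=> x xab; rewrite qE; have := sign_poly_norm n (xc1 _ xab).
    by rewrite !ler_norml; lra.
  by rewrite z in h; have := cvg_unique _ h (cvg_cst 0%E) => <-.
have [ac cb] : a <= c /\ c <= b by move: cab; rewrite in_itv/= => /andP[].
have abU : `[a, b]%classic = `[a, c] `|` `]c, b].
  by rewrite -itv_bndbnd_setU// bnd_simp.
pose k x := f x * (1 - Num.sg (x - c)).
have intk : mu.-integrable `[a, b] (EFin \o k).
  apply: (@integrable_mul_bounded _ _ _ mu _ mD f (fun x => 1 - Num.sg (x - c)) 2) => //.
    by apply: measurable_fun_cvg cq => n; exact: measurable_fun_horner.
  move=> x _; rewrite ler_norml.
  by have [h|h|->] := ltgtP (x - c) 0; rewrite ?(ltr0_sg h) ?(gtr0_sg h) ?sgr0; lra.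
move: lim0; rewrite -[LHS]/(\int[mu]_(x in `[a, b]) k x) abU.
have intk1 : mu.-integrable `[a, c] (EFin \o k).
  by apply: integrableS intk => //; rewrite abU; exact: subsetUl.
have intf1 : mu.-integrable `[a, c] (EFin \o f).
  by apply: integrableS intf => //; rewrite abU; exact: subsetUl.
have oc : `[a, c[ `<=` `[a, c] by apply: subset_itvl; rewrite bnd_simp.
rewrite Rintegral_setU//; last 2 first.
- by rewrite -abU.
- apply/disj_setPS => y [/=]; rewrite 2!in_itv/= => /andP[_ yx] /andP[].
  by rewrite ltNge yx.
rewrite [X in _ + X](_ : _ = 0) ?addr0; last first.
  rewrite (@eq_Rintegral _ _ _ _ _ (fun=> 0)) ?Rintegral_cst ?mul0r// => x.
  rewrite inE/= in_itv/= => /andP[cx _].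
  by rewrite /k gtr0_sg ?subr_gt0// subrr mulr0.
rewrite -Rintegral_itv_bndo_bndc; last exact: integrableS intk1.
have -> : \int[mu]_(x in `[a, c[) k x = \int[mu]_(x in `[a, c[) (2 * f x).
  apply: eq_Rintegral => x; rewrite inE/= in_itv/= => /andP[_ xc].
  by rewrite /k ltr0_sg ?subr_lt0// opprK mulrC.
rewrite RintegralZl//; last exact: integrableS intf1.
rewrite Rintegral_itv_bndo_bndc; last exact: integrableS intf1.
by move=> h; apply/eqP; move/eqP: h; rewrite mulf_eq0 pnatr_eq0.
Qed.

(** The primitive of [f] from [a] vanishes identically on the interval, and by Lebesgue
    differentiation its derivative is [f] almost everywhere. *)
Lemma poly_annihilator f a b : a < b ->
  mu.-integrable `[a, b] (EFin \o f) ->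
  (forall p : {poly R}, \int[mu]_(x in `[a, b]) (f x * p.[x]) = 0) ->
  \forall x \ae mu, `[a, b]%classic x -> f x = 0.
Proof.
move=> ab intf H.
pose g := f \_ `[a, b].
have mD : measurable `[a, b]%classic by exact: measurable_itv.
have intg : mu.-integrable setT (EFin \o g).
  have := (@integrable_mkcond _ _ _ mu _ (EFin \o f) mD).1 intf.
  by rewrite restrict_EFin.
have gy y : mu.-integrable [set` Interval (BLeft a) (BRight y)] (EFin \o g).
  by apply: integrableS intg.
have := FTC1 gy (@integrable_locally _ _ _ mD intf).
(* The endpoints are discarded, since the primitive is known to vanish only in a neighbourhood of an
   interior point. *)
move=> ae1; move: (ae_neq a) (ae_neq b) ae1; apply: (filterS3 ae_filter) => x xa xb + xab.
have {xab}/andP[ax bx] : a < x < b.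
  by move: xab; rewrite /= in_itv/= !lt_neqAle xb eq_sym xa.
have ax' : (BLeft a < BRight (x : R))%E by rewrite /= lte_fin.
move=> /(_ ax')[_].
rewrite /g patchE mem_set/=; last by rewrite in_itv/= !ltW.
move=> <-; rewrite derive1E -(derive_cst 0 x 1); apply: near_eq_derive.
have : \forall y \near x, y \in `]a, b[.
  by apply: near_in_itvoo; rewrite in_itv/= ax.
apply: filterS => y; rewrite in_itv/= => /andP[ay yb].
rewrite -[RHS](poly_annihilator_half ab _ intf H (c := y)).
  apply: eq_Rintegral => z; rewrite inE/= in_itv/= => /andP[az zy].
  by rewrite patchE mem_set//= in_itv/= az (le_trans zy (ltW yb)).
by rewrite in_itv/= !ltW.
Qed.


Lemma sqint_bounded (D : set R) f (M : R) : measurable D -> (mu D < +oo)%E ->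
  measurable_fun D f -> (forall x, D x -> `|f x| <= M) -> sqint mu D f.
Proof.
move=> mD muD mf fM; split => //.
apply: (@measurable_bounded_integrable _ _ _ mu) => //; first exact: measurable_funM.
exists (M * M); split; first exact: num_real.
move=> N MN x Dx; rewrite /= normrM (le_trans _ (ltW MN))// ler_pM//; exact: fM.
Qed.

Lemma sqint_continuous a b f : continuous f -> sqint mu `[a, b] f.
Proof.
move=> cf; have mf : measurable_fun `[a, b] f.
  by apply: measurable_funTS; exact: continuous_measurable_fun.
split => //; apply: continuous_compact_integrable; first exact: segment_compact.
by apply: continuous_subspaceT => x; apply: cvgM; exact: cf.
Qed.

(** [riesz], applied to the space of polynomials and the functional [ip f], produces the projection
    [h] of [f] onto the closure of that space. Then [f - h] annihilates all polynomials, so [f = h]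
    almost everywhere, and [h] is approximable by construction. *)
Lemma poly_dense f a b (e : R) : a < b -> sqint mu `[a, b] f -> 0 < e ->
  exists p : {poly R},
    ip mu `[a, b] (fun x => f x - p.[x]) (fun x => f x - p.[x]) < e.
Proof.
move=> ab sf e0.
have mD : measurable `[a, b]%classic by exact: measurable_itv.
have sp (p : {poly R}) : sqint mu `[a, b] (fun x => p.[x]).
  exact/sqint_continuous/continuous_horner.
have [||||||h [sh hE dens]] := riesz mu mD
    [set g | exists p : {poly R}, g = fun x => p.[x]] (ip mu `[a, b] f)
    (ip mu `[a, b] f f).
- exact: ip_ge0.
- by exists 0; apply/funext => x; rewrite horner0.
- move=> c _ _ [p ->] [q ->]; exists (p + c *: q).
  by apply/funext => x; rewrite hornerD hornerZ.
- move=> c _ _ [p ->] [q ->].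
  by rewrite (ipDr mu mD sf (sp p) (sqintZ mu mD c (sp q))) (ipZr mu mD c sf (sp q)).
- by move=> _ [p ->].
- by move=> _ [p ->]; exact: (ip_CS mu mD sf (sp p)).
have sfh := sqintB mu mD sf sh.
have fh : \forall x \ae mu, `[a, b]%classic x -> f x - h x = 0.
  apply: (poly_annihilator ab).
    have := sqint_mul mu mD sfh (sp 1).
    rewrite (_ : _ \o _ = EFin \o (fun x => f x - h x))//.
    by apply/funext => x /=; rewrite hornerC mulr1.
  move=> p; rewrite -[LHS]/(ip mu `[a, b] (fun x => f x - h x) (fun x => p.[x])).
  by rewrite (ipBl mu mD (sp p) sf sh) hE ?subrr//; exists p.
have [_ [p ->] hp] := dens _ e0; exists p; apply: le_lt_trans hp.
rewrite le_eqVlt; apply/orP; left; apply/eqP; congr fine.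
have m2 g : sqint mu `[a, b] g ->
    measurable_fun `[a, b] (fun x => ((g x - p.[x]) * (g x - p.[x]))%:E).
  move=> sg; have [_ /integrableP[]] := sqintB mu mD sg (sp p).
  by [].
apply: ae_eq_integral => //; [exact: m2|exact: m2|].
apply: aeS fh => x xE xD.
by have /eqP := xE xD; rewrite subr_eq0 => /eqP ->.
Qed.

End PolynomialDensity.

(** * Smooth functions *)

Section SmoothFunctions.
Context {R : realType}.
Implicit Types (f g : R -> R).

(** Coinduction for smoothness. It replaces explicit formulas for iterated derivatives, such as the
    Leibniz rule, by a class of functions stable under one derivation. *)
Lemma smooth_coind (S : set (R -> R)) :
  (forall f, S f -> (forall x, derivable f x 1) /\ S (derive1 f)) ->
  forall f, S f -> smooth f.
Proof.
move=> HS f Sf n; have : S (derive1n n f).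
  by elim: n => [//|n IH]; rewrite derive1nS; case: (HS _ IH).
by move=> /HS[].
Qed.

Lemma smooth_derivable f x : smooth f -> derivable f x 1.
Proof. by move=> /(_ 0%N). Qed.

Lemma smooth_derive1 f : smooth f -> smooth (derive1 f).
Proof. by move=> sf n x; have := sf n.+1 x; rewrite derive1Sn. Qed.

Lemma smooth_continuous f : smooth f -> continuous f.
Proof. by move=> sf x; apply/differentiable_continuous/derivable1_diffP/smooth_derivable. Qed.

Lemma derive1_add f g : smooth f -> smooth g ->
  derive1 (fun x => f x + g x) = fun x => derive1 f x + derive1 g x.
Proof.
move=> sf sg; apply/funext => x; rewrite !derive1E.
by apply: deriveD; exact: smooth_derivable.
Qed.

Lemma derive1_mul f g : smooth f -> smooth g ->
  derive1 (fun x => f x * g x) = fun x => derive1 f x * g x + f x * derive1 g x.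
Proof.
move=> sf sg; apply/funext => x; rewrite !derive1E deriveM; try exact: smooth_derivable.
by rewrite /GRing.scale/= addrC mulrC.
Qed.

Lemma smooth_cst (c : R) : smooth (fun=> c).
Proof.
apply: (@smooth_coind [set f | exists c, f = fun=> c]); last by exists c.
move=> _ [d ->]; split; first by move=> x; exact: derivable_cst.
by exists 0; apply/funext => x; rewrite derive1_cst.
Qed.

Lemma smooth_add f g : smooth f -> smooth g -> smooth (fun x => f x + g x).
Proof.
move=> sf sg.
apply: (@smooth_coind [set h | exists f g, [/\ smooth f, smooth g &
  h = fun x => f x + g x]]); last by exists f, g.
move=> _ [u [v [su sv ->]]]; split.
  by move=> x; apply: derivableD; exact: smooth_derivable.
exists (derive1 u), (derive1 v); rewrite (derive1_add su sv).
by split; [exact: (smooth_derive1 su)|exact: (smooth_derive1 sv)|].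
Qed.

(** Products alone are not stable under derivation; this is their closure under sums, as required by
    [smooth_coind]. *)
Inductive smooth_product : (R -> R) -> Prop :=
| SmoothProduct f g : smooth f -> smooth g -> smooth_product (fun x => f x * g x)
| SmoothProductD f g : smooth_product f -> smooth_product g ->
    smooth_product (fun x => f x + g x).

Lemma smooth_mul f g : smooth f -> smooth g -> smooth (fun x => f x * g x).
Proof.
move=> sf sg; apply: (@smooth_coind smooth_product); last exact: SmoothProduct.
move=> h; elim=> {f g sf sg h} [f g sf sg|f g _ [df sf] _ [dg sg]].
  split; first by move=> x; apply: derivableM; exact: smooth_derivable.
  rewrite (derive1_mul sf sg); apply: SmoothProductD.
    exact: SmoothProduct (smooth_derive1 sf) sg.
  exact: SmoothProduct sf (smooth_derive1 sg).
split; first by move=> x; exact: derivableD.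
rewrite (_ : derive1 _ = fun x => derive1 f x + derive1 g x).
  exact: SmoothProductD.
by apply/funext => x; rewrite !derive1E; exact: deriveD.
Qed.

Lemma smooth_opp f : smooth f -> smooth (fun x => - f x).
Proof.
move=> sf; rewrite (_ : (fun x => _) = fun x => (fun=> -1) x * f x).
  exact/smooth_mul/sf/smooth_cst.
by apply/funext => x; rewrite mulN1r.
Qed.

Lemma derive1_opp f : smooth f -> derive1 (fun x => - f x) = fun x => - derive1 f x.
Proof.
move=> sf; apply/funext => x; rewrite !derive1E.
by apply: deriveN; exact: smooth_derivable.
Qed.

Lemma derive1_scale c f : smooth f ->
  derive1 (fun x => c * f x) = fun x => c * derive1 f x.
Proof.
move=> sf; have sc : smooth (fun=> c) by exact: smooth_cst.
rewrite (derive1_mul sc sf); apply/funext => x.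
by rewrite derive1_cst mul0r add0r.
Qed.

Lemma smooth_horner (p : {poly R}) : smooth (fun x => p.[x]).
Proof.
apply: (@smooth_coind [set f | exists p : {poly R}, f = horner p]); last by exists p.
move=> _ [q ->]; split; first by move=> x; exact: derivable_horner.
by exists q^`()%R; rewrite derivE.
Qed.

Lemma near_eq_derive1 f g x : (\forall y \near x, f y = g y) ->
  derive1 f x = derive1 g x.
Proof. by move=> fg; rewrite !derive1E; exact: near_eq_derive. Qed.

Lemma derive1_near0 f (S : set R) : compact S -> (forall x, ~ S x -> f x = 0) ->
  forall x, ~ S x -> derive1 f x = 0.
Proof.
move=> cS f0 x Sx; rewrite -(derive1_cst (0 : R) x); apply: near_eq_derive1.
have oS : open (~` S) by apply: closed_openC; apply: compact_closed => //; exact: Rhausdorff.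
by apply: filterS (open_nbhs_nbhs (conj oS Sx)) => y; exact: f0.
Qed.

Lemma compact_bounded_interval (S : set R) : compact S ->
  exists M : R, 0 < M /\ S `<=` `[- M, M].
Proof.
move=> /compact_bounded[M [_ HM]]; exists (`|M| + 1).
split; first by rewrite ltr_wpDl.
move=> x Sx; rewrite /= in_itv/= -ler_norml; apply: HM => //.
by rewrite (le_lt_trans (ler_norm M))// ltrDl.
Qed.

Lemma smooth_compact_bounded f (S : set R) : smooth f -> compact S ->
  (forall x, ~ S x -> f x = 0) -> exists M : R, 0 < M /\ forall x, `|f x| <= M.
Proof.
move=> sf cS f0.
have cf := smooth_continuous sf.
have : compact (f @` S).
  by apply: continuous_compact => //; exact: continuous_subspaceT.
move=> /compact_bounded_interval[M [M0 HM]]; exists M; split => // x.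
case: (pselect (S x)) => Sx; last by rewrite f0// normr0 ltW.
by have := HM (f x) (imageP f Sx); rewrite /= in_itv/= -ler_norml.
Qed.

Lemma smooth_itv_bounded f (a b : R) : smooth f ->
  exists M : R, 0 < M /\ forall x, a <= x <= b -> `|f x| <= M.
Proof.
move=> sf; have cf := smooth_continuous sf.
have : compact (f @` `[a, b]).
  by apply: continuous_compact; [exact: continuous_subspaceT|exact: segment_compact].
move=> /compact_bounded_interval[M [M0 HM]]; exists M; split => // x xab.
have xab' : `[a, b]%classic x by rewrite /= in_itv.
by have := HM (f x) (imageP f xab'); rewrite /= in_itv/= -ler_norml.
Qed.

Notation mu := (@lebesgue_measure R).

Lemma Rintegral_derive1 f (a b : R) : a < b -> smooth f ->
  \int[mu]_(x in `]a, b[) derive1 f x = f b - f a.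
Proof.
move=> ab sf.
have cf := smooth_continuous sf; have cf' := smooth_continuous (smooth_derive1 sf).
have intf' : mu.-integrable `[a, b] (EFin \o derive1 f).
  apply: continuous_compact_integrable; first exact: segment_compact.
  exact: continuous_subspaceT.
have h1 : mu.-integrable `[a, b[ (EFin \o derive1 f).
  by apply: integrableS intf' => //; apply: subset_itvl; rewrite bnd_simp.
have h2 : mu.-integrable `]a, b[ (EFin \o derive1 f).
  by apply: integrableS intf' => //; apply: subset_itv; rewrite bnd_simp.
rewrite Rintegral_itv_obnd_cbnd// Rintegral_itv_bndo_bndc// /Rintegral.
rewrite (continuous_FTC2 ab (F := f))//.
  exact: continuous_subspaceT.
split; first by move=> x _; exact: smooth_derivable.
- by apply: cvg_at_right_filter; exact: cf.
- by apply: cvg_at_left_filter; exact: cf.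
Qed.

End SmoothFunctions.

(** * Complex-valued functions *)

Section ComplexCalculus.
Context {R : realType}.
Local Notation C := R[i].
Notation mu := (@lebesgue_measure R).
Implicit Types (f g w phi : R -> C) (D J : set R) (z : C).

Lemma Re_mul (z w : C) : complex.Re (z * w) =
  complex.Re z * complex.Re w - complex.Im z * complex.Im w.
Proof. by case: z w => ? ? []. Qed.

Lemma Im_mul (z w : C) : complex.Im (z * w) =
  complex.Re z * complex.Im w + complex.Im z * complex.Re w.
Proof. by case: z w => ? ? []. Qed.

Lemma Re_add (z w : C) : complex.Re (z + w) = complex.Re z + complex.Re w.
Proof. by case: z w => ? ? []. Qed.

Lemma Im_add (z w : C) : complex.Im (z + w) = complex.Im z + complex.Im w.
Proof. by case: z w => ? ? []. Qed.

Lemma Re_opp z : complex.Re (- z) = - complex.Re z. Proof. by case: z. Qed.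

Lemma Im_opp z : complex.Im (- z) = - complex.Im z. Proof. by case: z. Qed.

Lemma complexP (z w : C) : complex.Re z = complex.Re w ->
  complex.Im z = complex.Im w -> z = w.
Proof. by case: z w => a b [c d] /= -> ->. Qed.

Lemma reF_mul f g : reF (f \* g) = fun x => reF f x * reF g x - imF f x * imF g x.
Proof. by apply/funext => x; rewrite /reF Re_mul. Qed.

Lemma imF_mul f g : imF (f \* g) = fun x => reF f x * imF g x + imF f x * reF g x.
Proof. by apply/funext => x; rewrite /imF Im_mul. Qed.

Lemma reF_add f g : reF (f \+ g) = fun x => reF f x + reF g x.
Proof. by apply/funext => x; rewrite /reF Re_add. Qed.

Lemma imF_add f g : imF (f \+ g) = fun x => imF f x + imF g x.
Proof. by apply/funext => x; rewrite /imF Im_add. Qed.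

Lemma reF_sub f g : reF (f \- g) = fun x => reF f x - reF g x.
Proof. by apply/funext => x; rewrite /reF Re_add Re_opp. Qed.

Lemma imF_sub f g : imF (f \- g) = fun x => imF f x - imF g x.
Proof. by apply/funext => x; rewrite /imF Im_add Im_opp. Qed.

Definition csmooth f := smooth (reF f) /\ smooth (imF f).

Lemma csmooth_cst z : csmooth (fun=> z).
Proof. by split; exact: smooth_cst. Qed.

Lemma csmooth_mul f g : csmooth f -> csmooth g -> csmooth (f \* g).
Proof.
move=> [fr fi] [gr gi]; split; rewrite ?reF_mul ?imF_mul.
  by apply: smooth_add; [|apply: smooth_opp]; exact: smooth_mul.
by apply: smooth_add; exact: smooth_mul.
Qed.

Lemma csmooth_derive f : csmooth f -> csmooth (cderive f).
Proof.
by move=> [fr fi]; split; [exact: (smooth_derive1 fr)|exact: (smooth_derive1 fi)].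
Qed.

Lemma cderive_mul f g : csmooth f -> csmooth g ->
  cderive (f \* g) = (cderive f \* g) \+ (f \* cderive g).
Proof.
move=> [fr fi] [gr gi]; apply/funext => x; rewrite /cderive reF_mul imF_mul.
have frgr := smooth_mul fr gr; have figi := smooth_mul fi gi.
have frgi := smooth_mul fr gi; have figr := smooth_mul fi gr.
rewrite (derive1_add frgr (smooth_opp figi)) (derive1_opp figi).
rewrite (derive1_add frgi figr) !derive1_mul//.
apply: complexP; rewrite /= ?Re_add ?Im_add ?Re_mul ?Im_mul/=;
  rewrite -/(reF f x) -/(reF g x) -/(imF f x) -/(imF g x).
  by ring.
by ring.
Qed.

Lemma cderive_cst z : cderive (fun=> z) = fun=> 0.
Proof. by apply/funext => x; rewrite /cderive /reF /imF !derive1_cst. Qed.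

Lemma cderive_near f g x : (\forall y \near x, f y = g y) -> cderive f x = cderive g x.
Proof.
move=> fg; rewrite /cderive; congr Complex; apply: near_eq_derive1;
by apply: filterS fg => y yE; rewrite /reF /imF yE.
Qed.

Lemma csmooth_test J phi : test_function J phi -> csmooth phi.
Proof. by case. Qed.

Lemma test_mul J phi w : test_function J phi -> csmooth w ->
  test_function J (phi \* w).
Proof.
move=> [pr pim [S [cS SJ S0]]] sw; have [? ?] := csmooth_mul (conj pr pim) sw.
by split => //; exists S; split => // x Sx; rewrite /= S0// mul0r.
Qed.

Lemma test_derive J phi : test_function J phi -> test_function J (cderive phi).
Proof.
move=> [pr pim [S [cS SJ S0]]]; have [? ?] := csmooth_derive (conj pr pim).
split => //; exists S; split => // x Sx; apply: complexP => /=.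
  by apply: (derive1_near0 cS) => // y Sy; rewrite /reF S0.
by apply: (derive1_near0 cS) => // y Sy; rewrite /imF S0.
Qed.

Lemma test_sub J J' phi : J `<=` J' -> test_function J phi -> test_function J' phi.
Proof.
by move=> JJ' [? ? [S [cS SJ S0]]]; split => //; exists S; split => //; apply: subset_trans JJ'.
Qed.

Definition cpoly (p : {poly C}) : R -> C := fun x => p.[x%:C%C].

(** The powers of a real point are real, so taking the real part acts on the coefficients one by
    one. *)
Lemma Re_cpoly (p : {poly C}) x :
  complex.Re (cpoly p x) = (map_poly (@complex.Re R) p).[x].
Proof.
rewrite /cpoly horner_coef (@horner_coef_wide _ (size p)); last exact: size_poly.
rewrite (big_morph (@complex.Re R) Re_add (erefl : complex.Re 0 = 0)).
apply: eq_bigr => i _; rewrite coef_map_id0//.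
by rewrite -rmorphXn/= Re_mul/= mulr0 subr0.
Qed.

Lemma Im_cpoly (p : {poly C}) x :
  complex.Im (cpoly p x) = (map_poly (@complex.Im R) p).[x].
Proof.
rewrite /cpoly horner_coef (@horner_coef_wide _ (size p)); last exact: size_poly.
rewrite (big_morph (@complex.Im R) Im_add (erefl : complex.Im 0 = 0)).
apply: eq_bigr => i _; rewrite coef_map_id0//.
by rewrite -rmorphXn/= Im_mul/= mulr0 add0r.
Qed.

Lemma csmooth_cpoly (p : {poly C}) : csmooth (cpoly p).
Proof.
split.
  rewrite (_ : reF _ = fun x => (map_poly (@complex.Re R) p).[x]).
    exact: smooth_horner.
  by apply/funext => x; exact: Re_cpoly.
rewrite (_ : imF _ = fun x => (map_poly (@complex.Im R) p).[x]).
  exact: smooth_horner.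
by apply/funext => x; exact: Im_cpoly.
Qed.

Lemma cderive_cpoly (p : {poly C}) : cderive (cpoly p) = cpoly p^`()%R.
Proof.
have part (P : {additive C -> R}) : map_poly P (p^`()%R) = (map_poly P p)^`()%R.
  by apply/polyP => i; rewrite coef_deriv !coef_map_id0 ?raddf0// coef_deriv raddfMn.
apply/funext => x; apply: complexP => /=.
  rewrite Re_cpoly (part (@complex.Re R)) derivE; congr (derive1 _ x).
  by apply/funext => y; exact: Re_cpoly.
rewrite Im_cpoly (part (@complex.Im R)) derivE; congr (derive1 _ x).
by apply/funext => y; exact: Im_cpoly.
Qed.

Definition cexp (z : C) : R -> C := fun x =>
  Complex (expR (complex.Re z * x) * cos (complex.Im z * x))
          (expR (complex.Re z * x) * sin (complex.Im z * x)).

(** The span of the real and imaginary parts of the exponential is stable under derivation, which is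
    the form that [smooth_coind] requires. *)
Let is_derive_exp_trig (a b c d x : R) :
  is_derive x 1 (fun x => expR (a * x) * (c * cos (b * x) + d * sin (b * x)))
    (expR (a * x) * ((a * c + b * d) * cos (b * x) + (a * d - b * c) * sin (b * x))).
Proof.
apply: is_derive_eq; rewrite /GRing.scale/=; ring.
Qed.

Lemma csmooth_cexp z : csmooth (cexp z).
Proof.
have H := @smooth_coind R [set f | exists c d, f = fun x =>
  expR (complex.Re z * x) * (c * cos (complex.Im z * x) + d * sin (complex.Im z * x))].
have {}H : forall c d : R, smooth (fun x => expR (complex.Re z * x) *
   (c * cos (complex.Im z * x) + d * sin (complex.Im z * x))).
  move=> c d; apply: H; last by exists c, d.
  move=> _ [c1 [d1 ->]]; split => [x|].
    exact: (@ex_derive _ _ _ _ _ _ _ (is_derive_exp_trig _ _ _ _ _)).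
  do 2 eexists; apply/funext => x; rewrite derive1E.
  exact: (@derive_val _ _ _ _ _ _ _ (is_derive_exp_trig _ _ _ _ _)).
split.
  have := H 1 0; congr smooth; apply/funext => x.
  by rewrite mul1r mul0r addr0.
have := H 0 1; congr smooth; apply/funext => x.
by rewrite mul1r mul0r add0r.
Qed.

Lemma cderive_cexp z : cderive (cexp z) = fun x => z * cexp z x.
Proof.
apply/funext => x; apply: complexP; rewrite /= ?Re_mul ?Im_mul/=.
  rewrite (_ : reF _ = fun x => expR (complex.Re z * x) *
     (1 * cos (complex.Im z * x) + 0 * sin (complex.Im z * x))).
    rewrite derive1E (@derive_val _ _ _ _ _ _ _ (is_derive_exp_trig _ _ _ _ _)).
    by ring.
  by apply/funext => y; rewrite mul1r mul0r addr0.
rewrite (_ : imF _ = fun x => expR (complex.Re z * x) *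
   (0 * cos (complex.Im z * x) + 1 * sin (complex.Im z * x))).
  rewrite derive1E (@derive_val _ _ _ _ _ _ _ (is_derive_exp_trig _ _ _ _ _)).
  by ring.
by apply/funext => y; rewrite mul1r mul0r add0r.
Qed.

(** For [l = 0] a double primitive serves. Otherwise, if [w] solves the equation with right-hand
    side [p''], then [(w - p) / l] solves it for [p], and [p''] has smaller size. Unfolded, this is
    the Neumann series in the second derivative divided by [l], which is finite on polynomials. *)
Lemma poly_resolvent (l : C) (p : {poly C}) :
  exists w : {poly C}, w^`()^`() - l *: w = p.
Proof.
have [->|l0] := eqVneq l 0.
  pose prim (p : {poly C}) : {poly C} := \poly_(i < (size p).+1) (p`_i.-1 / i%:R).
  have primK q : (prim q)^`() = q.
    apply/polyP => i; rewrite coef_deriv coef_poly ltnS; case: ltnP => iq.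
      by rewrite -[LHS]mulr_natr divfK// pnatr_eq0.
    by rewrite nth_default// mul0rn.
  by exists (prim (prim p)); rewrite scale0r subr0 !primK.
have [n] := ubnP (size p); elim: n p => // n IH p; rewrite ltnS => pn.
have [p0|p0] := eqVneq p 0.
  by exists 0; rewrite !derivC scaler0 subr0 p0.
have [|w wE] := IH p^`()^`().
  have [q0|q0] := eqVneq p^`() 0.
    by rewrite q0 derivC size_poly0; apply: leq_trans pn; rewrite size_poly_gt0.
  by apply: (leq_trans (ltn_trans _ (lt_size_deriv p0))) pn; exact: lt_size_deriv.
exists (l^-1 *: (w - p)).
rewrite !derivZ !derivB scalerA divff// scale1r.
rewrite (_ : w^`()^`() - p^`()^`() = l *: w); last first.
  by rewrite -wE opprB addrC subrK.
by rewrite scalerA mulVf// scale1r opprB [_ + (p - w)]addrC subrK.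
Qed.

End ComplexCalculus.

(** * Integrals and square norms of complex-valued functions *)

Section ComplexIntegrals.
Context {R : realType}.
Local Notation C := R[i].
Notation mu := (@lebesgue_measure R).
Implicit Types (f g w phi : R -> C) (D J : set R) (z : C).

Definition cintegrable D f :=
  mu.-integrable D (EFin \o reF f) /\ mu.-integrable D (EFin \o imF f).

Lemma cintegralD D f g : measurable D -> cintegrable D f -> cintegrable D g ->
  cintegral D (f \+ g) = cintegral D f + cintegral D g.
Proof.
move=> mD [fr fi] [gr gi]; rewrite /cintegral reF_add imF_add.
by apply: complexP => /=; rewrite RintegralD.
Qed.

Lemma cintegralB D f g : measurable D -> cintegrable D f -> cintegrable D g ->
  cintegral D (f \- g) = cintegral D f - cintegral D g.
Proof.
move=> mD [fr fi] [gr gi]; rewrite /cintegral reF_sub imF_sub.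
by apply: complexP => /=; rewrite RintegralB.
Qed.

Lemma cintegralZ D z f : measurable D -> cintegrable D f ->
  cintegral D (fun x => z * f x) = z * cintegral D f.
Proof.
move=> mD [fr fi].
have zr (c : R) (g : R -> R) : mu.-integrable D (EFin \o g) ->
    mu.-integrable D (EFin \o (fun x => c * g x)).
  exact: (integrable_scale mu mD).
have Zl c (g : R -> R) : mu.-integrable D (EFin \o g) ->
    \int[mu]_(x in D) (c * g x) = c * \int[mu]_(x in D) g x.
  by move=> ig; rewrite RintegralZl.
rewrite /cintegral; apply: complexP; rewrite /= ?Re_mul ?Im_mul/= -!Zl//.
  rewrite -RintegralB; [|exact: mD|exact: zr|exact: zr].
  by apply: eq_Rintegral => x _; rewrite /reF Re_mul.
rewrite -RintegralD; [|exact: mD|exact: zr|exact: zr].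
by apply: eq_Rintegral => x _; rewrite /imF Im_mul.
Qed.

Lemma eq_cintegral D f g : (forall x, D x -> f x = g x) ->
  cintegral D f = cintegral D g.
Proof.
move=> fg; rewrite /cintegral; congr Complex; apply: eq_Rintegral => x /set_mem Dx;
by rewrite /reF /imF fg.
Qed.

Lemma cintegral_subset A D f : A `<=` D -> (forall x, D x -> ~ A x -> f x = 0) ->
  cintegral D f = cintegral A f.
Proof.
move=> AD f0; rewrite /cintegral.
have H (P : C -> R) : P 0 = 0 ->
    \int[mu]_(x in D) P (f x) = \int[mu]_(x in A) P (f x).
  move=> P0; rewrite [LHS]Rintegral_mkcond [RHS]Rintegral_mkcond.
  apply: eq_Rintegral => x _; rewrite !patchE.
  case: (pselect (A x)) => Ax; first by rewrite !mem_set//; exact: AD.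
  rewrite (memNset Ax); case: (pselect (D x)) => Dx; last by rewrite memNset.
  by rewrite mem_set// f0.
by congr Complex; apply: H.
Qed.

Lemma cintegral0 D f : (forall x, D x -> f x = 0) -> cintegral D f = 0.
Proof.
move=> f0; rewrite (@cintegral_subset set0)//; last by move=> x Dx _; exact: f0.
by rewrite /cintegral !Rintegral_set0.
Qed.

Lemma ae_eq_cintegral D f g : measurable D -> cmeasurable D f -> cmeasurable D g ->
  (\forall x \ae mu, D x -> f x = g x) -> cintegral D f = cintegral D g.
Proof.
move=> mD [fr fi] [gr gi] fg; rewrite /cintegral; congr Complex; congr fine;
apply: ae_eq_integral => //; try exact/measurable_EFinP;
by apply: aeS fg => x xE Dx; rewrite /reF /imF xE.
Qed.

(** Real-valued counterpart of [L2sqnorm]; by [L2sqnormE] the two agree on [L2], so that estimates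
    can be made in [R] instead of the extended reals. *)
Definition sqn D f : R := ip mu D (reF f) (reF f) + ip mu D (imF f) (imF f).

Lemma sqn_ge0 D f : 0 <= sqn D f.
Proof. by rewrite addr_ge0// ip_ge0. Qed.

Lemma L2sqnorm_sqint D f : measurable D ->
  sqint mu D (reF f) -> sqint mu D (imF f) -> L2sqnorm D f = (sqn D f)%:E.
Proof.
move=> mD fr fi; rewrite /sqn EFinD !EFin_ip// -ge0_integralD//.
- by move=> x _; rewrite lee_fin -expr2 sqr_ge0.
- by apply/measurable_EFinP; apply: measurable_funM; case: fr.
- by move=> x _; rewrite lee_fin -expr2 sqr_ge0.
- by apply/measurable_EFinP; apply: measurable_funM; case: fi.
Qed.

Lemma L2P D f : measurable D ->
  L2 D f <-> sqint mu D (reF f) /\ sqint mu D (imF f).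
Proof.
move=> mD; split=> [[[fr fi]]|[fr fi]]; last first.
  split; first by split; [case: fr|case: fi].
  by rewrite L2sqnorm_sqint// ltry.
rewrite /L2sqnorm => f2; split; apply: sqintP => //; apply: le_lt_trans f2;
  apply: ge0_le_integral => //.
- by move=> x _; rewrite lee_fin -expr2 sqr_ge0.
- by apply/measurable_EFinP; exact: measurable_funM.
- exact: cmeasurable_csqr.
- by move=> x _; rewrite lee_fin /csqr -expr2 lerDl sqr_ge0.
- by move=> x _; rewrite lee_fin -expr2 sqr_ge0.
- by apply/measurable_EFinP; exact: measurable_funM.
- exact: cmeasurable_csqr.
- by move=> x _; rewrite lee_fin /csqr -expr2 lerDr sqr_ge0.
Qed.

Lemma L2sqnormE D f : measurable D -> L2 D f -> L2sqnorm D f = (sqn D f)%:E.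
Proof. by move=> mD /(L2P _ mD)[fr fi]; exact: L2sqnorm_sqint. Qed.

Lemma L2_measurable D f : L2 D f -> cmeasurable D f. Proof. by case. Qed.

Lemma cmeasurable_mul D f g : cmeasurable D f -> cmeasurable D g ->
  cmeasurable D (f \* g).
Proof.
move=> [fr fi] [gr gi]; split; rewrite ?reF_mul ?imF_mul.
  by apply: measurable_funB; exact: measurable_funM.
by apply: measurable_funD; exact: measurable_funM.
Qed.

Lemma L2_mul_cintegrable D f g : measurable D -> L2 D f -> L2 D g ->
  cintegrable D (f \* g).
Proof.
move=> mD /(L2P _ mD)[fr fi] /(L2P _ mD)[gr gi].
split; rewrite ?reF_mul ?imF_mul.
  exact: (integrable_sub mu mD (sqint_mul mu mD fr gr) (sqint_mul mu mD fi gi)).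
exact: (integrable_add mu mD (sqint_mul mu mD fr gi) (sqint_mul mu mD fi gr)).
Qed.

Lemma L2B D f g : measurable D -> L2 D f -> L2 D g -> L2 D (f \- g).
Proof.
move=> mD /(L2P _ mD)[fr fi] /(L2P _ mD)[gr gi].
by apply/L2P => //; rewrite reF_sub imF_sub; split; exact: sqintB.
Qed.

(** Cauchy-Schwarz is applied to the four real products of real and imaginary parts; the factor [2]
    comes from the squares of a sum and of a difference of two such integrals. *)
Lemma csqr_cintegral_le D f g : measurable D -> L2 D f -> L2 D g ->
  csqr (cintegral D (f \* g)) <= 2 * (sqn D f * sqn D g).
Proof.
move=> mD /(L2P _ mD)[fr fi] /(L2P _ mD)[gr gi].
rewrite /csqr /cintegral/= reF_mul imF_mul.
rewrite (@RintegralB _ _ _ mu D _ _ mD (sqint_mul mu mD fr gr) (sqint_mul mu mD fi gi)).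
rewrite (@RintegralD _ _ _ mu D _ _ mD (sqint_mul mu mD fr gi) (sqint_mul mu mD fi gr)).
have := ip_CS mu mD fr gr; have := ip_CS mu mD fi gi.
have := ip_CS mu mD fr gi; have := ip_CS mu mD fi gr.
have arith (A B E F p q r s : R) : F ^+ 2 <= q * r -> E ^+ 2 <= p * s ->
    B ^+ 2 <= q * s -> A ^+ 2 <= p * r ->
    (A - B) ^+ 2 + (E + F) ^+ 2 <= 2 * ((p + q) * (r + s)).
  by have := sqr_ge0 (A + B); have := sqr_ge0 (E - F); nra.
exact: arith.
Qed.

Lemma sqn_comb D f g (t : R) : measurable D -> L2 D f -> L2 D g ->
  sqn D (fun x => f x + t%:C%C * g x) = sqn D f +
   2 * t * (ip mu D (reF f) (reF g) + ip mu D (imF f) (imF g)) + t ^+ 2 * sqn D g.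
Proof.
move=> mD /(L2P _ mD)[fr fi] /(L2P _ mD)[gr gi]; rewrite /sqn.
have -> : reF (fun x => f x + t%:C%C * g x) = fun x => reF f x + t * reF g x.
  by apply/funext => x; rewrite /reF Re_add Re_mul/= mul0r subr0.
have -> : imF (fun x => f x + t%:C%C * g x) = fun x => imF f x + t * imF g x.
  by apply/funext => x; rewrite /imF Im_add Im_mul/= mul0r addr0.
rewrite (ip_comb mu mD t fr gr) (ip_comb mu mD t fi gi).
by ring.
Qed.

Lemma L2normE D f : measurable D -> L2 D f -> L2norm D f = Num.sqrt (sqn D f).
Proof. by move=> mD lf; rewrite /L2norm L2sqnormE. Qed.

Lemma L2normD D f g : measurable D -> L2 D f -> L2 D g ->
  L2norm D (f \+ g) <= L2norm D f + L2norm D g.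
Proof.
move=> mD lf lg; have lfg : L2 D (f \+ g) by exact: L2_D.
rewrite !L2normE// -ler_sqr ?nnegrE ?sqrtr_ge0 ?addr_ge0 ?sqrtr_ge0//.
rewrite sqr_sqrtr ?sqn_ge0// sqrrD !sqr_sqrtr ?sqn_ge0//.
have := @sqn_comb D f g 1 mD lf lg.
rewrite (_ : (fun x => _) = f \+ g); last by apply/funext => x /=; rewrite mul1r.
move=> ->; rewrite expr1n mul1r mulr1 lerD2r lerD2l -[leRHS]mulr_natl ler_wpM2l//.
set i := (X in X <= _).
have CS : i ^+ 2 <= sqn D f * sqn D g.
  apply: quadratic_ge0; first exact: sqn_ge0.
  by move=> t; rewrite -sqn_comb// sqn_ge0.
apply: le_trans (ler_norm i) _; rewrite -sqrtrM ?sqn_ge0//.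
by rewrite -sqrtr_sqr ler_wsqrtr.
Qed.

Lemma sqnZ D z f : measurable D -> L2 D f ->
  sqn D (fun x => z * f x) = csqr z * sqn D f.
Proof.
move=> mD lf; have lzf : L2 D (fun x => z * f x) by exact: L2_Z.
apply: EFin_inj; rewrite -L2sqnormE// /L2sqnorm.
under eq_integral do rewrite csqrM EFinM.
rewrite ge0_integralZl//.
- by rewrite EFinM -L2sqnormE.
- by apply: cmeasurable_csqr; case: lf.
- by move=> x _; rewrite lee_fin csqr_ge0.
- by rewrite lee_fin csqr_ge0.
Qed.

Lemma L2_mul_bounded D f g (M : R) : measurable D -> L2 D f -> cmeasurable D g ->
  (forall x, D x -> csqr (g x) <= M ^+ 2) ->
  L2 D (f \* g) /\ sqn D (f \* g) <= M ^+ 2 * sqn D f.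
Proof.
move=> mD lf mg gM; have [mf f2] := lf.
have mfg := cmeasurable_mul mf mg.
have le : (L2sqnorm D (f \* g)%R <= (M ^+ 2 * sqn D f)%:E)%E.
  rewrite EFinM -L2sqnormE// /L2sqnorm -ge0_integralZl//.
  - apply: ge0_le_integral => //.
    + by move=> x _; rewrite lee_fin csqr_ge0.
    + exact: cmeasurable_csqr.
    + by apply: measurable_funeM; exact: cmeasurable_csqr.
    + move=> x Dx; rewrite -EFinM lee_fin csqrM mulrC ler_wpM2r ?csqr_ge0//.
      exact: gM.
  - exact: cmeasurable_csqr.
  - by move=> x _; rewrite lee_fin csqr_ge0.
  - by rewrite lee_fin sqr_ge0.
have lfg : L2 D (f \* g) by split => //; apply: le_lt_trans le (ltry _).
by split => //; rewrite -lee_fin -L2sqnormE.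
Qed.

Lemma ae_eq_sqn D f g : measurable D -> L2 D f -> L2 D g ->
  (\forall x \ae mu, D x -> f x = g x) -> sqn D f = sqn D g.
Proof.
move=> mD lf lg fg; apply: EFin_inj; rewrite -!L2sqnormE//.
have := cmeasurable_csqr lf.1; have := cmeasurable_csqr lg.1 => mg mf.
apply: ae_eq_integral => //.
by apply: aeS fg => x xE Dx; rewrite xE.
Qed.

Lemma sqn_subset A D f : measurable A -> measurable D -> A `<=` D -> L2 D f ->
  L2 A f /\ sqn A f <= sqn D f.
Proof.
move=> mA mD AD lf; have [[fr fi] f2] := lf.
have le : (L2sqnorm A f <= L2sqnorm D f)%E.
  apply: ge0_subset_integral => //; first by exact: cmeasurable_csqr.
  by move=> x _; rewrite lee_fin csqr_ge0.
have lA : L2 A f.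
  split; last exact: le_lt_trans le f2.
  by split; [exact: measurable_funS fr|exact: measurable_funS fi].
by split => //; rewrite -lee_fin -!L2sqnormE.
Qed.

Lemma sqn_extend A D f : measurable A -> measurable D -> A `<=` D ->
  (forall x, D x -> ~ A x -> f x = 0) -> L2 A f -> L2 D f /\ sqn D f = sqn A f.
Proof.
move=> mA mD AD f0 lf; have [[fr fi] f2] := lf.
have resE (P : C -> R) : P 0 = 0 -> measurable_fun A (P \o f) ->
    measurable_fun D (P \o f).
  move=> P0 mf; have : measurable_fun D ((P \o f) \_ A).
    by apply/(measurable_restrict _ mA mD); rewrite setIidr.
  apply: eq_measurable_fun => x /set_mem Dx; rewrite patchE.
  by case: ifPn => // /negP xA /=; rewrite f0// => Ax; apply: xA; exact: mem_set.
have sE : L2sqnorm D f = L2sqnorm A f.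
  rewrite /L2sqnorm [LHS]integral_mkcond [RHS]integral_mkcond.
  apply: eq_integral => x _; rewrite !patchE.
  case: (pselect (A x)) => Ax; first by rewrite !mem_set//; exact: AD.
  rewrite (memNset Ax); case: (pselect (D x)) => Dx; last by rewrite memNset.
  by rewrite mem_set// f0// /csqr expr0n addr0.
have lD : L2 D f.
  by split; [split; exact: resE|rewrite sE].
by split => //; apply: EFin_inj; rewrite -!L2sqnormE.
Qed.

Lemma csmooth_measurable D f : csmooth f -> cmeasurable D f.
Proof.
by move=> [fr fi]; split; apply: measurable_funTS; apply: continuous_measurable_fun;
exact: smooth_continuous.
Qed.

Lemma csmooth_itv_bounded f (a b : R) : csmooth f ->
  exists M : R, 0 < M /\ forall x, a <= x <= b -> csqr (f x) <= M ^+ 2.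
Proof.
move=> [fr fi]; have [M [M0 HM]] := smooth_itv_bounded a b fr.
have [N [N0 HN]] := smooth_itv_bounded a b fi.
exists (M + N); split; first exact: addr_gt0.
move=> x xab; rewrite /csqr -(real_normK (num_real (complex.Re _))).
rewrite -(real_normK (num_real (complex.Im _))).
have := HM x xab; have := HN x xab; have := normr_ge0 (reF f x); have := normr_ge0 (imF f x).
by rewrite /reF /imF; nra.
Qed.

Lemma test_bounded J phi : test_function J phi ->
  exists M : R, 0 < M /\ forall x, csqr (phi x) <= M ^+ 2.
Proof.
move=> [fr fi [S [cS SJ S0]]].
have [|M [M0 HM]] := smooth_compact_bounded fr cS.
  by move=> x Sx; rewrite /reF S0.
have [|N [N0 HN]] := smooth_compact_bounded fi cS.
  by move=> x Sx; rewrite /imF S0.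
exists (M + N); split; first exact: addr_gt0.
move=> x; rewrite /csqr -(real_normK (num_real (complex.Re _))).
rewrite -(real_normK (num_real (complex.Im _))).
have := HM x; have := HN x; have := normr_ge0 (reF phi x); have := normr_ge0 (imF phi x).
by rewrite /reF /imF; nra.
Qed.

Lemma csmooth_L2 (a b : R) f : csmooth f -> L2 `[a, b] f.
Proof.
move=> [fr fi]; apply/L2P; first exact: measurable_itv.
by split; apply: sqint_continuous; exact: smooth_continuous.
Qed.

Lemma test_L2 D J phi : measurable D -> test_function J phi -> L2 D phi.
Proof.
move=> mD tphi; have [_ _ [S [cS _ S0]]] := tphi.
have [M [_ SM]] := compact_bounded_interval cS.
have lphi : L2 setT phi.
  apply: (proj1 (@sqn_extend `[- M, M] setT phi _ _ _ _ _)) => //.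
    by move=> x _ xM; apply: S0 => /SM.
  by apply: csmooth_L2; exact: csmooth_test tphi.
by have [] := sqn_subset mD measurableT (@subsetT _ D) lphi.
Qed.

Lemma integral_test_derive (a b : R) phi : a < b -> test_function `]a, b[ phi ->
  cintegral `]a, b[ (cderive phi) = 0.
Proof.
move=> ab [fr fi [S [cS SJ S0]]].
have Sa : ~ S a by move=> /SJ; rewrite /= in_itv/= ltxx.
have Sb : ~ S b by move=> /SJ; rewrite /= in_itv/= ltxx andbF.
rewrite /cintegral; apply: complexP => /=; rewrite Rintegral_derive1//.
  by rewrite /reF !S0// subrr.
by rewrite /imF !S0// subrr.
Qed.

Lemma integration_by_parts_test (a b : R) phi w : a < b ->
  test_function `]a, b[ phi -> csmooth w ->
  cintegral `]a, b[ (w \* cderive phi) = - cintegral `]a, b[ (cderive w \* phi).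
Proof.
move=> ab tphi sw; have sphi := csmooth_test tphi.
have sw' := csmooth_derive sw; have sphi' := csmooth_derive sphi.
have mJ : measurable `]a, b[%classic by exact: measurable_itv.
have L2J f : csmooth f -> L2 `]a, b[ f.
  have mI : measurable `[a, b]%classic by exact: measurable_itv.
  have JI : `]a, b[ `<=` `[a, b] by apply: subset_itv; rewrite bnd_simp.
  by move=> sf; have [] := sqn_subset mJ mI JI (csmooth_L2 a b sf).
have tw : test_function `]a, b[ (w \* phi).
  have := test_mul tphi sw; congr test_function.
  by apply/funext => x /=; rewrite mulrC.
have := integral_test_derive ab tw; rewrite cderive_mul// cintegralD//.
- by move/eqP; rewrite addrC addr_eq0 => /eqP.
- by apply: L2_mul_cintegrable => //; exact: L2J.
- by apply: L2_mul_cintegrable => //; exact: L2J.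
Qed.

Lemma cintegral_poly_annihilator (a b : R) f : a < b -> L2 `[a, b] f ->
  (forall p : {poly C}, cintegral `[a, b] (f \* cpoly p) = 0) ->
  \forall x \ae mu, `[a, b]%classic x -> f x = 0.
Proof.
move=> ab lf H; have mD : measurable `[a, b]%classic by exact: measurable_itv.
have [sr si] := (L2P f mD).1 lf.
have int (g : R -> R) : sqint mu `[a, b] g -> mu.-integrable `[a, b] (EFin \o g).
  move=> sg; have := sqint_mul mu mD sg (sqint_continuous a b (@cst_continuous _ _ (1 : R))).
  by congr (_.-integrable _ _); apply/funext => x /=; rewrite mulr1.
have cpolyr (p : {poly R}) x : cpoly (map_poly (real_complex R) p) x = (p.[x])%:C%C.
  by rewrite /cpoly horner_map.
have fr := poly_annihilator ab (int _ sr) _.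
have {}fr : \forall x \ae mu, `[a, b]%classic x -> reF f x = 0.
  apply: fr => p; have := congr1 (@complex.Re R) (H (map_poly (real_complex R) p)).
  rewrite /cintegral/= => h; rewrite -[RHS]h; apply: eq_Rintegral => x _.
  by rewrite /reF Re_mul cpolyr/= mulr0 subr0.
have fi := poly_annihilator ab (int _ si) _.
have {}fi : \forall x \ae mu, `[a, b]%classic x -> imF f x = 0.
  apply: fi => p; have := congr1 (@complex.Im R) (H (map_poly (real_complex R) p)).
  rewrite /cintegral/= => h; rewrite -[RHS]h; apply: eq_Rintegral => x _.
  by rewrite /imF Im_mul cpolyr/= mulr0 add0r.
by apply: aeS2 fr fi => x xr xi xab; apply: complexP; [exact: xr|exact: xi].
Qed.

Lemma cpoly_dense (a b : R) f (e : R) : a < b -> L2 `[a, b] f -> 0 < e ->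
  exists p : {poly C}, sqn `[a, b] (f \- cpoly p) < e.
Proof.
move=> ab lf e0; have mD : measurable `[a, b]%classic by exact: measurable_itv.
have [sr si] := (L2P f mD).1 lf.
have e2 : 0 < e / 2 by rewrite divr_gt0.
have [p pe] := poly_dense ab sr e2; have [q qe] := poly_dense ab si e2.
exists (map_poly (real_complex R) p + 'i%C *: map_poly (real_complex R) q).
rewrite /sqn [ltRHS]splitr reF_sub imF_sub.
rewrite (_ : reF (cpoly _) = fun x => p.[x]); last first.
  apply/funext => x; rewrite /reF /cpoly hornerD hornerZ !horner_map.
  by rewrite Re_add Re_mul/= !mul0r mulr0 subrr addr0.
rewrite (_ : imF (cpoly _) = fun x => q.[x]); last first.
  apply/funext => x; rewrite /imF /cpoly hornerD hornerZ !horner_map.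
  by rewrite Im_add Im_mul/= mul0r mul1r !add0r.
exact: ltrD.
Qed.

End ComplexIntegrals.

(** * Classes of functions and weak derivatives *)

Section QuotientRepresentatives.
Local Open Scope quotient_scope.
Context (K : pzRingType) (V : lmodType K) (P N : submodClosed V).
Local Notation Q := (quotient_module P N).

Definition qclass (f : V) (fP : f \in P) : Q := \pi_Q (Sub f fP : submodule P).

Lemma quotient_reprP (x : Q) : quotient_repr x \in P.
Proof. exact: valP. Qed.

Lemma qclass_eq (u v : submodule P) : val u - val v \in N -> \pi_Q u = \pi_Q v :> Q.
Proof.
move=> uv; apply/eqmodP => /=; rewrite /Quotient.equiv.
by rewrite -[u - v \in _]/(val (u - v) \in N) raddfB.
Qed.

Lemma qclass_eqP (u v : submodule P) : \pi_Q u = \pi_Q v :> Q -> val u - val v \in N.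
Proof.
move/eqmodP => /=; rewrite /Quotient.equiv.
by rewrite -[u - v \in _]/(val (u - v) \in N) raddfB.
Qed.

Lemma quotient_repr_eq (x y : Q) :
  quotient_repr x - quotient_repr y \in N -> x = y.
Proof. by move=> /qclass_eq; rewrite !reprK. Qed.

Lemma quotient_repr_class f (fP : f \in P) : quotient_repr (qclass fP) - f \in N.
Proof.
rewrite -[X in _ - X](SubK (submodule P) fP).
by apply: qclass_eqP; rewrite reprK.
Qed.

Lemma quotient_reprD (x y : Q) :
  quotient_repr (x + y) - (quotient_repr x + quotient_repr y) \in N.
Proof.
rewrite /quotient_repr -raddfD; apply: qclass_eqP; rewrite reprK.
by rewrite (Quotient.pi_add (inner_pred P N)) !reprK.
Qed.

Lemma quotient_reprZ (a : K) (x : Q) :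
  quotient_repr (a *: x) - a *: quotient_repr x \in N.
Proof. by rewrite /quotient_repr -linearZ; apply: qclass_eqP; rewrite reprK. Qed.

End QuotientRepresentatives.

(** * Compact exhaustion and cut-off functions *)

Section Exhaustion.
Context {R : realType} (J : set R) (E : exhaustion J).
Local Notation C := R[i].
Notation mu := (@lebesgue_measure R).

Definition exh n : set R := `[lend E n, rend E n].

Let exhE : J = \bigcup_n exh n. Proof. exact: exhaustion_cover. Qed.

Lemma exh_succ n : exh n `<=` `]lend E n.+1, rend E n.+1[.
Proof. exact: exhaustion_sub. Qed.

Lemma exh_le n m : (n <= m)%N -> exh n `<=` exh m.
Proof.
elim: m => [|m IH]; first by rewrite leqn0 => /eqP ->.
rewrite leq_eqVlt ltnS => /predU1P[->//|/IH nm].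
by move=> x /nm/exh_succ; apply: subset_itv; rewrite bnd_simp.
Qed.

Lemma exh_sub n : exh n `<=` J.
Proof. by move=> x nx; rewrite [X in X _]exhE; exists n. Qed.

Lemma exh_cover x : J x -> exists n, exh n x.
Proof. by rewrite [X in X _]exhE => -[n _ nx]; exists n. Qed.

Lemma compact_exh n : compact (exh n).
Proof. exact: segment_compact. Qed.

Lemma compact_sub_exh (S : set R) : compact S -> S `<=` J -> exists n, S `<=` exh n.
Proof.
rewrite compact_cover => cS SJ.
have [|x Sx|D _ SD] := cS nat setT (fun n => `]lend E n.+1, rend E n.+1[%classic).
- by move=> i _; exact: itv_open.
- have [n /exh_succ nx] := exh_cover (SJ _ Sx).
  by exists n.
(* The member of the cover with index [i] is the interior of [exh i.+1], hence the successor. *)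
exists (\max_(i <- finmap.enum_fset D) i).+1 => x /SD[i /= iD ix].
apply: (@exh_le i.+1).
  by rewrite ltnS; exact: (@leq_bigmax_seq _ _ xpredT id).
by move: ix; apply: subset_itv; rewrite bnd_simp.
Qed.

Lemma cutoff_testJ n : test_function J (cutoff E n).
Proof.
apply: test_sub (cutoff_test E n) => x nx; apply: (@exh_sub n.+1).
by move: nx; apply: subset_itv; rewrite bnd_simp.
Qed.

Lemma cutoff_near1 n m x : (n < m)%N -> exh n x -> \forall y \near x, cutoff E m y = 1.
Proof.
move=> nm /exh_succ nx.
have oI : open `]lend E n.+1, rend E n.+1[%classic by exact: itv_open.
apply: filterS (open_nbhs_nbhs (conj oI nx)) => y ny; apply: cutoff_eq1.
have : exh n.+1 y by move: ny; apply: subset_itv; rewrite bnd_simp.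
exact: exh_le.
Qed.

Lemma cutoff_out n x : ~ exh n.+1 x -> cutoff E n x = 0.
Proof.
move=> nx; have [_ _ [S [_ SI S0]]] := cutoff_test E n; apply: S0 => /SI xI.
by apply: nx; move: xI; apply: subset_itv; rewrite bnd_simp.
Qed.

Lemma L2loc_exh f n : f \in L2loc_pred J -> L2 (exh n) f.
Proof. by rewrite inE => fJ; apply: fJ; [exact: compact_exh|exact: exh_sub]. Qed.

Lemma L2loc_cmeasurable f : f \in L2loc_pred J -> cmeasurable J f.
Proof.
move=> fJ; rewrite [X in cmeasurable X _]exhE.
split; apply/measurable_fun_bigcup => n; try exact: measurable_itv.
  by have [[]] := L2loc_exh n fJ.
by have [[]] := L2loc_exh n fJ.
Qed.

Lemma L2loc_test_L2 f phi : f \in L2loc_pred J -> test_function J phi ->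
  L2 setT (f \* phi).
Proof.
move=> fJ tphi; have [_ _ [S [cS SJ S0]]] := tphi; have [n Sn] := compact_sub_exh cS SJ.
have mn : measurable (exh n) by exact: measurable_itv.
have [M [M0 HM]] := test_bounded tphi.
have mphi := csmooth_measurable (exh n) (csmooth_test tphi).
have [l _] := L2_mul_bounded mn (L2loc_exh n fJ) mphi (fun x _ => HM x).
apply: (proj1 (sqn_extend mn measurableT (@subsetT _ _) _ l)) => x _ nx /=.
by rewrite S0 ?mulr0// => /Sn.
Qed.

Lemma L2_L2loc f : measurable J -> L2 J f -> f \in L2loc_pred J.
Proof.
move=> mJ lf; rewrite inE => S cS SJ.
by have [] := sqn_subset (compact_measurable cS) mJ SJ lf.
Qed.

Lemma L2T_L2loc f : L2 setT f -> f \in L2loc_pred J.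
Proof.
move=> lf; rewrite inE => S cS SJ.
by have [] := sqn_subset (compact_measurable cS) measurableT (@subsetT _ _) lf.
Qed.

Lemma ae_bigcup (P : nat -> R -> Prop) : (forall n, \forall x \ae mu, P n x) ->
  \forall x \ae mu, forall n, P n x.
Proof.
move=> aP; have := @ae_foralln _ _ _ mu P.
by apply.
Qed.

(** A cut-off times a polynomial is a test function. Hence [f] times the cut-off annihilates all
    polynomials on the compact interval [exh n.+1], which contains the support of the cut-off, and
    it coincides with [f] on [exh n]. *)
Lemma test_annihilator f : f \in L2loc_pred J ->
  (forall phi, test_function J phi -> cintegral J (f \* phi) = 0) ->
  \forall x \ae mu, J x -> f x = 0.
Proof.
move=> fJ H.
have {H} aen n : \forall x \ae mu, exh n x -> f x = 0.
  pose th := cutoff E n.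
  have mn : measurable (exh n.+1) by exact: measurable_itv.
  have l : L2 (exh n.+1) (f \* th).
    have [] // := sqn_subset mn measurableT (@subsetT _ _) (L2loc_test_L2 fJ (cutoff_testJ n)).
  have := cintegral_poly_annihilator (lend_lt_rend E n.+1) l _.
  move=> h; have {}h : \forall x \ae mu, exh n.+1 x -> (f \* th) x = 0.
    apply: h => p.
    rewrite -(H _ (test_mul (cutoff_testJ n) (csmooth_cpoly p))).
    rewrite (cintegral_subset (@exh_sub n.+1)); last first.
      by move=> x _ nx; rewrite /= cutoff_out// mul0r mulr0.
    by apply: eq_cintegral => x _ /=; rewrite mulrA.
  apply: aeS h => x xE nx; have := xE (exh_le (leqnSn n) nx).
  by rewrite /= /th cutoff_eq1// mulr1.
by apply: aeS (ae_bigcup aen) => x xE /exh_cover[n nx]; exact: xE nx.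
Qed.

End Exhaustion.

Section Classes.
Context {R : realType} (J : set R).
Local Notation C := R[i].
Notation mu := (@lebesgue_measure R).
Implicit Types (u v : L2loc J) (g h : L2c J).

Lemma L2loc_funP u : (u : R -> C) \in L2loc_pred J.
Proof. exact: quotient_reprP. Qed.

Lemma L2loc_eq u v : (\forall x \ae mu, J x -> u x = v x) -> u = v.
Proof.
move=> uv; apply: quotient_repr_eq; rewrite inE; apply: aeS uv => x xE Jx.
by apply/eqP; rewrite subr_eq0; apply/eqP; exact: xE.
Qed.

Definition L2loc_class f (fJ : f \in L2loc_pred J) : L2loc J := qclass (aezero_pred J) fJ.

Lemma L2loc_classE f (fJ : f \in L2loc_pred J) :
  \forall x \ae mu, J x -> L2loc_class fJ x = f x.
Proof.
have := quotient_repr_class (aezero_pred J) fJ; rewrite inE.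
by apply: aeS => x xE Jx; apply/eqP; rewrite -subr_eq0; apply/eqP; exact: xE.
Qed.

Lemma L2loc_addE u v : \forall x \ae mu, J x -> (u + v : L2loc J) x = u x + v x.
Proof.
have := quotient_reprD u v; rewrite inE.
by apply: aeS => x xE Jx; apply/eqP; rewrite -subr_eq0; apply/eqP; exact: xE.
Qed.

Lemma L2loc_scaleE (z : C) u : \forall x \ae mu, J x -> (z *: u : L2loc J) x = z * u x.
Proof.
have := quotient_reprZ z u; rewrite inE.
by apply: aeS => x xE Jx; apply/eqP; rewrite -subr_eq0; apply/eqP; exact: xE.
Qed.

Lemma L2loc_subE u v : \forall x \ae mu, J x -> (u - v : L2loc J) x = u x - v x.
Proof.
have := L2loc_addE u (- v); have := L2loc_scaleE (-1) v; rewrite scaleN1r.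
by apply: aeS2 => x nE aE Jx; rewrite aE// nE// mulN1r.
Qed.

Lemma L2loc_combE (z : C) u v :
  \forall x \ae mu, J x -> (z *: u - v : L2loc J) x = z * u x - v x.
Proof.
have := L2loc_subE (z *: u) v; have := L2loc_scaleE z u.
by apply: aeS2 => x nE aE Jx; rewrite aE// nE.
Qed.

Lemma L2c_funP g : L2 setT (g : R -> C) /\ ae_compact_support J g.
Proof. by have := quotient_reprP g; rewrite inE. Qed.

Lemma L2c_eq g h : (\forall x \ae mu, g x = h x) -> g = h.
Proof.
move=> gh; apply: quotient_repr_eq; rewrite inE; apply: aeS gh => x xE _.
by apply/eqP; rewrite subr_eq0; apply/eqP; exact: xE.
Qed.

Definition L2c_class f (fJ : f \in L2c_pred J) : L2c J := qclass (aezero_pred setT) fJ.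

Lemma L2c_classE f (fJ : f \in L2c_pred J) :
  \forall x \ae mu, L2c_class fJ x = f x.
Proof.
have := quotient_repr_class (aezero_pred setT) fJ; rewrite inE.
by apply: aeS => x xE; apply/eqP; rewrite -subr_eq0; apply/eqP; exact: xE.
Qed.

Lemma L2c_addE g h : \forall x \ae mu, (g + h : L2c J) x = g x + h x.
Proof.
have := quotient_reprD g h; rewrite inE.
by apply: aeS => x xE; apply/eqP; rewrite -subr_eq0; apply/eqP; exact: xE.
Qed.

Lemma L2c_scaleE (z : C) g : \forall x \ae mu, (z *: g : L2c J) x = z * g x.
Proof.
have := quotient_reprZ z g; rewrite inE.
by apply: aeS => x xE; apply/eqP; rewrite -subr_eq0; apply/eqP; exact: xE.
Qed.

Lemma L2c_combE (z : C) g h : \forall x \ae mu, (z *: g - h : L2c J) x = z * g x - h x.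
Proof.
have a1 := L2c_addE (z *: g) (- h); have a2 := L2c_scaleE z g.
have := L2c_scaleE (-1) h; rewrite scaleN1r => a3.
by apply: aeS2 (aeS2 (fun x p q => conj p q) a1 a2) a3 => x [-> ->] ->; rewrite mulN1r.
Qed.

End Classes.

Lemma sum3_lt (R : realType) (x y z t : R) : x + y + z < t ->
  0 <= x -> 0 <= y -> 0 <= z -> x < t /\ z < t.
Proof. by lra. Qed.

(** The closing estimate of [H20_integration_by_parts]: [s] and [t] are the squared norms of the two
    fixed factors, [p] and [q] the squared approximation errors. The weight [4] is the [2] of
    [csqr_cintegral_le] times the [2] of [csqrD]. *)
Lemma weighted_sum_le (R : realType) (A B p q s t e : R) : 0 <= s -> 0 <= t ->
  0 < e -> p < e / (4 * (s + t) + 1) -> q < e / (4 * (s + t) + 1) ->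
  A <= 2 * (s * q) -> B <= 2 * (t * p) -> 2 * A + 2 * B <= e.
Proof.
move=> s0 t0 e0 pe qe hA hB; have M0 : 0 < 4 * (s + t) + 1 by lra.
have eE : e = (4 * (s + t) + 1) * (e / (4 * (s + t) + 1)) by field; lra.
have r0 : 0 < e / (4 * (s + t) + 1) by exact: divr_gt0.
move: (e / _) eE pe qe r0 => r -> pr qr r0.
have h1 := ler_wpM2l s0 (ltW qr); have h2 := ler_wpM2l t0 (ltW pr).
by lra.
Qed.

(** * Weak derivatives, and integration by parts on the closure of test functions *)

Section WeakDerivatives.
Context {R : realType} (a b : R) (ab : a < b).
Local Notation J := (`]a, b[%classic).
Context (E : exhaustion J).
Local Notation C := R[i].
Notation mu := (@lebesgue_measure R).
Implicit Types (u v : L2loc J) (phi f g w : R -> C).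

Let mJ : measurable J. Proof. exact: measurable_itv. Qed.

Lemma csmooth_L2J f : csmooth f -> L2 J f.
Proof.
have mI : measurable `[a, b]%classic by exact: measurable_itv.
have JI : `]a, b[ `<=` `[a, b] by apply: subset_itv; rewrite bnd_simp.
by move=> sf; have [] := sqn_subset mJ mI JI (csmooth_L2 a b sf).
Qed.

Lemma L2loc_test_cintegrable f phi : f \in L2loc_pred J -> test_function J phi ->
  cintegrable J (f \* phi).
Proof.
move=> fJ tphi; have [_ _ [S [cS SJ S0]]] := tphi.
have [n Sn] := compact_sub_exh E cS SJ.
rewrite (_ : f \* phi = (f \* cutoff E n) \* phi).
  apply: L2_mul_cintegrable => //; last exact: test_L2 tphi.
  have l := L2loc_test_L2 E fJ (cutoff_testJ E n).
  by have [] := sqn_subset mJ measurableT (@subsetT _ _) l.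
apply/funext => x /=; case: (pselect (S x)) => Sx.
  by rewrite cutoff_eq1 ?mulr1//; exact: Sn.
by rewrite S0// !mulr0.
Qed.

Lemma ae_cintegral_mul f f' phi : (\forall x \ae mu, J x -> f x = f' x) ->
  cmeasurable J f -> cmeasurable J f' -> cmeasurable J phi ->
  cintegral J (f \* phi) = cintegral J (f' \* phi).
Proof.
move=> ff' mf mf' mphi; apply: ae_eq_cintegral => //; try exact: cmeasurable_mul.
by apply: aeS ff' => x xE Jx /=; rewrite xE.
Qed.

Lemma weak_derivative_ae f f' g g' :
  (\forall x \ae mu, J x -> f x = f' x) -> (\forall x \ae mu, J x -> g x = g' x) ->
  cmeasurable J f -> cmeasurable J f' -> cmeasurable J g -> cmeasurable J g' ->
  weak_derivative J f g -> weak_derivative J f' g'.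
Proof.
move=> ff' gg' mf mf' mg mg' fg phi tphi.
have m1 := csmooth_measurable J (csmooth_test tphi).
have m2 := csmooth_measurable J (csmooth_test (test_derive tphi)).
rewrite -(ae_cintegral_mul ff' mf mf' m2) -(ae_cintegral_mul gg' mg mg' m1).
exact: fg.
Qed.

Lemma test_separates f f' : f \in L2loc_pred J -> f' \in L2loc_pred J ->
  (forall phi, test_function J phi ->
    cintegral J (f \* phi) = cintegral J (f' \* phi)) ->
  \forall x \ae mu, J x -> f x = f' x.
Proof.
move=> fJ fJ' H.
have sJ : f - f' \in L2loc_pred J by rewrite rpredB.
have : \forall x \ae mu, J x -> (f - f') x = 0.
  apply: (test_annihilator E sJ) => phi tphi.
  rewrite (_ : (f - f') \* phi = (f \* phi) \- (f' \* phi)); last first.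
    by apply/funext => x /=; rewrite -mulrBl.
  rewrite cintegralB//; try exact: L2loc_test_cintegrable.
  by rewrite H// subrr.
by apply: aeS => x xE Jx; apply/eqP; rewrite -subr_eq0; apply/eqP; exact: xE.
Qed.

(** The class of [f] shows that [xget] does not fall back on its default, and whatever weak
    derivative it selects agrees with [f] because test functions separate [L2loc]. *)
Lemma L2loc_deriveE u f : f \in L2loc_pred J -> weak_derivative J u f ->
  \forall x \ae mu, J x -> L2loc_derive u x = f x.
Proof.
move=> fJ uf; have cE := L2loc_classE fJ; rewrite /L2loc_derive.
case: xgetP => [v _ /= uv|nv].
  apply: test_separates => //; first exact: L2loc_funP.
  by move=> phi tphi; apply: oppr_inj; rewrite -uv// uf.
exfalso; apply: (nv (L2loc_class fJ)) => /=.
apply: (@weak_derivative_ae u u f (L2loc_class fJ) _ _ _ _ _ _ uf).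
- exact: aeW.
- by apply: aeS cE => x xE Jx; rewrite xE.
- exact: (L2loc_cmeasurable E (L2loc_funP _)).
- exact: (L2loc_cmeasurable E (L2loc_funP _)).
- exact: (L2loc_cmeasurable E fJ).
- exact: (L2loc_cmeasurable E (L2loc_funP _)).
Qed.

Local Notation Delta := (Laplacian E).

Lemma LaplacianE u f1 f2 : H2_jet J u f1 f2 ->
  \forall x \ae mu, J x -> (Delta u : L2loc J) x = f2 x.
Proof.
move=> [lu l1 l2 uf1 f12].
have d1 := L2loc_deriveE (L2_L2loc mJ l1) uf1.
apply: L2loc_deriveE; first exact: L2_L2loc.
apply: (@weak_derivative_ae f1 (L2loc_derive u) f2 f2 _ _ _ _ _ _ f12).
- by apply: aeS d1 => x xE Jx; rewrite xE.
- exact: aeW.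
- exact: (L2loc_cmeasurable E (L2_L2loc mJ l1)).
- exact: (L2loc_cmeasurable E (L2loc_funP _)).
- exact: (L2loc_cmeasurable E (L2_L2loc mJ l2)).
- exact: (L2loc_cmeasurable E (L2_L2loc mJ l2)).
Qed.

Lemma ae_L2 D f f' : measurable D -> cmeasurable D f' ->
  (\forall x \ae mu, D x -> f x = f' x) -> L2 D f -> L2 D f'.
Proof.
move=> mD mf' ff' [mf lf]; split => //; apply: le_lt_trans lf.
rewrite le_eqVlt; apply/orP; left; apply/eqP; rewrite /L2sqnorm.
have := cmeasurable_csqr mf; have := cmeasurable_csqr mf' => m1 m2.
by apply: ae_eq_integral => //; apply: aeS ff' => x xE Dx; rewrite xE.
Qed.

Lemma H20_approx u : H20 J u -> [/\ L2 J u, L2 J (Delta u : L2loc J) &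
  forall e : R, 0 < e -> exists phi, [/\ test_function J phi,
    sqn J ((u : R -> C) \- phi) < e &
    sqn J (((Delta u : L2loc J) : R -> C) \- cderive (cderive phi)) < e]].
Proof.
move=> [f1 [f2 [jet dens]]]; have [lu l1 l2 _ _] := jet.
have dE := LaplacianE jet.
have mD : cmeasurable J (Delta u : L2loc J).
  exact: (L2loc_cmeasurable E (L2loc_funP _)).
have lD : L2 J (Delta u : L2loc J).
  by apply: (ae_L2 mJ mD _ l2); apply: aeS dE => x xE Jx; rewrite xE.
split => // e e0; have [phi [tphi]] := dens _ e0.
have t2 := test_derive (test_derive tphi).
have lphi := test_L2 mJ tphi; have l1phi := test_L2 mJ (test_derive tphi).
have l2phi := test_L2 mJ t2.
have d0 := L2B mJ lu lphi; have d1 := L2B mJ l1 l1phi; have d2 := L2B mJ l2 l2phi.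
rewrite !L2sqnormE// -!EFinD lte_fin => lt; exists phi.
have p0 := sqn_ge0 J ((u : R -> C) \- phi); have p1 := sqn_ge0 J (f1 \- cderive phi).
have p2 := sqn_ge0 J (f2 \- cderive (cderive phi)).
have [lt0 lt2] := sum3_lt lt p0 p1 p2.
split; [exact: tphi|exact: lt0|].
rewrite (_ : sqn J _ = sqn J (f2 \- cderive (cderive phi))); first exact: lt2.
apply: ae_eq_sqn; [exact: mJ|exact: L2B|exact: d2|].
by apply: aeS dE => x xE Jx /=; rewrite xE.
Qed.

Lemma csqr_eq0 (z : C) : csqr z = 0 -> z = 0.
Proof.
case: z => x y /= /eqP; rewrite /csqr paddr_eq0 ?sqr_ge0// !sqrf_eq0.
by move=> /andP[/= /eqP -> /eqP ->].
Qed.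

(** Both sides are continuous in [u] and [u''] for the [L2] norms, and they agree on test functions.
    The absence of boundary terms is thus inherited from the approximating test functions, whatever
    [w] does at the endpoints. *)
Lemma H20_integration_by_parts w w2 u : L2 J w -> L2 J w2 ->
  (forall phi, test_function J phi ->
    cintegral J (w \* cderive (cderive phi)) = cintegral J (w2 \* phi)) ->
  H20 J u -> cintegral J (w \* (Delta u : L2loc J)) = cintegral J (w2 \* u).
Proof.
move=> lw lw2 H Hu; have [lu lD dens] := H20_approx Hu.
apply/eqP; rewrite -subr_eq0; apply/eqP; apply: csqr_eq0; apply/eqP.
rewrite eq_le csqr_ge0 andbT; apply/ler_addgt0Pl => e e0; rewrite addr0.
pose M := 4 * (sqn J w + sqn J w2) + 1.
have M0 : 0 < M.
  by rewrite ltr_wpDl// mulr_ge0// addr_ge0// sqn_ge0.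
have [phi [tphi h1 h2]] := dens _ (divr_gt0 e0 M0).
have lphi := test_L2 mJ tphi; have l2phi := test_L2 mJ (test_derive (test_derive tphi)).
have lb := L2B mJ lu lphi; have lb2 := L2B mJ lD l2phi.
(* Subtracting the identity for [phi] leaves only integrals of the approximation errors. *)
have -> : cintegral J (w \* (Delta u : L2loc J)) - cintegral J (w2 \* u) =
    cintegral J (w \* (((Delta u : L2loc J) : R -> C) \- cderive (cderive phi))) +
    - cintegral J (w2 \* ((u : R -> C) \- phi)).
  have dist (f g h : R -> C) : f \* (g \- h) = (f \* g) \- (f \* h).
    by apply/funext => x /=; rewrite mulrBr.
  rewrite !dist !cintegralB//; try exact: L2_mul_cintegrable.
  by rewrite H//; ring.
apply: (le_trans (csqrD _ _)).
have csqrN z : csqr (- z) = csqr z by case: z => ? ?; rewrite /csqr/= !sqrrN.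
rewrite csqrN.
exact: (weighted_sum_le (sqn_ge0 J w) (sqn_ge0 J w2) e0 h1 h2
  (csqr_cintegral_le mJ lw lb2) (csqr_cintegral_le mJ lw2 lb)).
Qed.

Lemma test_H20 phi : test_function J phi -> exists u : L2loc J,
  [/\ H20 J u, \forall x \ae mu, J x -> u x = phi x &
    \forall x \ae mu, J x -> (Delta u : L2loc J) x = cderive (cderive phi) x].
Proof.
move=> tphi; have lphi := test_L2 mJ tphi.
have t1 := test_derive tphi; have t2 := test_derive t1.
have phiJ := L2_L2loc mJ lphi.
have cE := L2loc_classE phiJ; set u := L2loc_class phiJ in cE.
have mu_ : cmeasurable J u by exact: (L2loc_cmeasurable E (L2loc_funP _)).
have lu : L2 J u by apply: (ae_L2 mJ mu_ _ lphi); apply: aeS cE => x xE Jx; rewrite xE.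
have wd psi : test_function J psi -> weak_derivative J psi (cderive psi).
  by move=> tpsi eta teta; apply: integration_by_parts_test => //; exact: csmooth_test tpsi.
have jet : H2_jet J u (cderive phi) (cderive (cderive phi)).
  split; [exact: lu|exact: (test_L2 mJ t1)|exact: (test_L2 mJ t2)| |exact: wd].
  apply: (@weak_derivative_ae phi u (cderive phi) (cderive phi) _ _ _ _ _ _ (wd _ tphi)).
  - by apply: aeS cE => x xE Jx; rewrite xE.
  - exact: aeW.
  - exact: csmooth_measurable (csmooth_test tphi).
  - exact: mu_.
  - exact: csmooth_measurable (csmooth_test t1).
  - exact: csmooth_measurable (csmooth_test t1).
exists u; split => //; last exact: LaplacianE jet.
exists (cderive phi), (cderive (cderive phi)); split => // e e0; exists phi; split => //.
have z (f : R -> C) : L2 J f -> (\forall x \ae mu, J x -> f x = 0) -> L2sqnorm J f = 0%E.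
  move=> lf f0; rewrite L2sqnormE// (@ae_eq_sqn _ J f (fun=> 0))//; last exact: L2_0.
  rewrite -L2sqnormE//; last exact: L2_0.
  by rewrite /L2sqnorm integral0_eq// => x _; rewrite /csqr expr0n addr0.
rewrite z; last 2 first.
- exact: L2B.
- by apply: aeS cE => x xE Jx /=; rewrite xE// subrr.
rewrite z; last 2 first.
- by apply: L2B => //; exact: (test_L2 mJ t1).
- by apply: aeW => x _ /=; rewrite subrr.
rewrite z; last 2 first.
- by apply: L2B => //; exact: (test_L2 mJ t2).
- by apply: aeW => x _ /=; rewrite subrr.
by rewrite !add0e lte_fin.
Qed.

End WeakDerivatives.

(** Finitely many strict inequalities leave a common margin; this is what makes balls for finitely
    many seminorms open. *)
Lemma uniform_gap (R : realType) (F : nat -> R) n (e : R) :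
  (forall j, (j <= n)%N -> F j < e) ->
  exists d, 0 < d /\ forall j, (j <= n)%N -> F j + d <= e.
Proof.
elim: n => [|n IH] H.
  exists (e - F 0%N); rewrite subr_gt0 H//; split => // j.
  by rewrite leqn0 => /eqP ->; rewrite addrC subrK.
have [j jn|d [d0 dH]] := IH; first by apply: H; rewrite leqW.
exists (Num.min d (e - F n.+1)); rewrite lt_min d0 subr_gt0 H//; split => // j.
rewrite leq_eqVlt ltnS -lerBrDl ge_min => /predU1P[->|/dH jd].
  by rewrite lexx orbT.
by rewrite lerBrDl jd.
Qed.

(** * Seminorms and neighbourhoods in the space of locally square-integrable functions *)

Section LocalTopology.
Context {R : realType} (J : set R) (E : exhaustion J).
Local Notation C := R[i].
Notation mu := (@lebesgue_measure R).
Local Notation X := (L2loc_space E).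
Local Notation P := (L2loc_seminorm E).
Implicit Types (u v : L2loc J).

Lemma cutoff_L2 n u : L2 setT (cutoff E n \* u).
Proof.
rewrite (_ : cutoff E n \* u = (u : R -> C) \* cutoff E n).
  by apply: (L2loc_test_L2 E (L2loc_funP u)); exact: cutoff_testJ.
by apply/funext => x /=; rewrite mulrC.
Qed.

Lemma cutoff_ae n (f f' : R -> C) : (\forall x \ae mu, J x -> f x = f' x) ->
  \forall x \ae mu, setT x -> (cutoff E n \* f) x = (cutoff E n \* f') x.
Proof.
apply: aeS => x xE _ /=; case: (pselect (J x)) => Jx; first by rewrite xE.
by rewrite cutoff_out ?mul0r// => /exh_sub.
Qed.

Lemma L2loc_seminorm_ge0 n u : 0 <= P n u.
Proof. exact: sqrtr_ge0. Qed.

Lemma L2loc_seminormE n u : P n u ^+ 2 = sqn (exh E n.+1) (cutoff E n \* u).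
Proof.
have mn : measurable (exh E n.+1) by exact: measurable_itv.
have [l _] := sqn_subset mn measurableT (@subsetT _ _) (cutoff_L2 n u).
rewrite /L2loc_seminorm L2normE//; last exact: cutoff_L2.
rewrite sqr_sqrtr ?sqn_ge0//; apply: (proj2 (sqn_extend mn _ _ _ l)) => //.
by move=> x _ nx /=; rewrite cutoff_out// mul0r.
Qed.

Lemma L2loc_seminormD n u v : P n (u + v) <= P n u + P n v.
Proof.
apply: le_trans (L2normD measurableT (cutoff_L2 n u) (cutoff_L2 n v)).
rewrite le_eqVlt; apply/orP; left; apply/eqP.
rewrite /L2loc_seminorm !L2normE//; last 2 first.
- by apply: L2_D => //; exact: cutoff_L2.
- exact: cutoff_L2.
congr Num.sqrt; apply: ae_eq_sqn => //; first exact: cutoff_L2.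
  by apply: L2_D => //; exact: cutoff_L2.
have := cutoff_ae n (L2loc_addE u v).
by apply: aeS => x xE Tx; rewrite xE//= mulrDr.
Qed.

Lemma nbhs_L2loc (u : X) (U : set X) : nbhs u U <-> exists n (e : R), 0 < e /\
  forall v : X, (forall j, (j <= n)%N -> P j (v - u) < e) -> U v.
Proof.
rewrite nbhsE; split=> [[B [oB Bu] BU]|[n [e [e0 H]]]].
  have [n [e [e0 H]]] := oB u Bu; exists n, e; split => // v vu.
  by apply: BU; exact: H.
pose ball := [set v : X | forall j, (j <= n)%N -> P j (v - u) < e].
exists ball; last by move=> v; exact: H.
split; last first.
  move=> j _; rewrite subrr (_ : P j 0 = 0)//.
  apply/eqP; rewrite -sqrf_eq0 L2loc_seminormE; apply/eqP.
  have mn : measurable (exh E j.+1) by exact: measurable_itv.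
  have [l _] := sqn_subset mn measurableT (@subsetT _ _) (cutoff_L2 j 0).
  (* The chosen representative of the class [0] vanishes only almost everywhere; it is compared with
     [0] scaled by [0], whose norm is given by [sqnZ]. *)
  have z : sqn (exh E j.+1) (fun=> 0 * 0 : C) = 0.
    have l0 := @L2_0 R _ mn.
    rewrite (sqnZ 0 mn l0) /csqr expr0n addr0 mul0r//.
  rewrite -[RHS]z; apply: ae_eq_sqn => //.
    exact: (L2_Z 0 mn (@L2_0 R _ mn)).
  have := L2loc_scaleE 0 (0 : L2loc J); rewrite scale0r => /(cutoff_ae j).
  by apply: aeS => x xE Dx; rewrite xE//= !mul0r mulr0.
move=> v bv; have [d [d0 dH]] := uniform_gap bv.
exists n, d; split => // w wv j jn.
rewrite -(subrK v w) -addrA (le_lt_trans (L2loc_seminormD _ _ _))//.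
by apply: lt_le_trans (dH j jn); rewrite [ltRHS]addrC ltrD2r; exact: wv.
Qed.

Lemma cutoff_bounded n : exists M : R, 0 < M /\
  forall j, (j <= n)%N -> forall x, csqr (cutoff E j x) <= M ^+ 2.
Proof.
elim: n => [|n [M [M0 HM]]].
  have [M [M0 HM]] := test_bounded (cutoff_testJ E 0).
  by exists M; split => // j; rewrite leqn0 => /eqP ->.
have [N [N0 HN]] := test_bounded (cutoff_testJ E n.+1).
exists (M + N); split; first exact: addr_gt0.
move=> j; rewrite leq_eqVlt => /predU1P[->|jn] x.
  by apply: le_trans (HN x) _; rewrite ler_sqr ?nnegrE ?addr_ge0 ?ltW// ltrDr.
by apply: le_trans (HM j jn x) _; rewrite ler_sqr ?nnegrE ?addr_ge0 ?ltW// ltrDl.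
Qed.

(** With [L2loc_seminorm_ge], this trades the seminorms for plain [L2] norms on the intervals of the
    exhaustion. The shift to [n.+1] arises because the cut-off of index [j] lives on
    [exh E j.+1]. *)
Lemma L2loc_seminorm_le n j (M : R) u : 0 < M -> (j <= n)%N ->
  (forall x, csqr (cutoff E j x) <= M ^+ 2) ->
  P j u ^+ 2 <= M ^+ 2 * sqn (exh E n.+1) u.
Proof.
move=> M0 jn HM; rewrite L2loc_seminormE.
have mj k : measurable (exh E k) by exact: measurable_itv.
have lu k := L2loc_exh E k (L2loc_funP u).
have mc := csmooth_measurable (exh E j.+1) (csmooth_test (cutoff_testJ E j)).
have [_ le1] := L2_mul_bounded (mj _) (lu _) mc (fun x _ => HM x).
rewrite (_ : cutoff E j \* u = (u : R -> C) \* cutoff E j); last first.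
  by apply/funext => x /=; rewrite mulrC.
apply: (le_trans le1); rewrite ler_wpM2l ?sqr_ge0//.
by have [] := sqn_subset (mj j.+1) (mj n.+1) (@exh_le _ _ E j.+1 n.+1 jn) (lu n.+1).
Qed.

Lemma L2loc_seminorm_ge n u : sqn (exh E n) u <= P n u ^+ 2.
Proof.
have mj k : measurable (exh E k) by exact: measurable_itv.
have [l le1] := sqn_subset (mj n) measurableT (@subsetT _ _) (cutoff_L2 n u).
rewrite /L2loc_seminorm L2normE//; last exact: cutoff_L2.
rewrite sqr_sqrtr ?sqn_ge0//; apply: le_trans le1.
rewrite le_eqVlt; apply/orP; left; apply/eqP; apply: ae_eq_sqn => //.
  exact: L2loc_exh (L2loc_funP u).
by apply: aeW => x nx /=; rewrite cutoff_eq1// mul1r.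
Qed.

End LocalTopology.

(** * Spectrum of the Laplacian *)

Section LaplacianSpectrum.
Context {R : realType} (a b : R) (ab : a < b).
Local Notation J := (`]a, b[%classic).
Context (E : exhaustion J).
Local Notation C := R[i].
Notation mu := (@lebesgue_measure R).
Implicit Types (u v : L2loc J) (phi f w : R -> C) (l z : C).
Local Notation Delta := (Laplacian E).

Let mJ : measurable J. Proof. exact: measurable_itv. Qed.

Let mexh n : measurable (exh E n). Proof. exact: measurable_itv. Qed.

Lemma cpolyE l (w p : {poly C}) x : w^`()^`() - l *: w = p ->
  cderive (cderive (cpoly w)) x - l * cpoly w x = cpoly p x.
Proof. by move=> <-; rewrite !cderive_cpoly /cpoly hornerD hornerN hornerZ. Qed.

(** Polynomial density is available on compact intervals, so the difference is first extended by [0]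
    to the closed interval. Square integrability up to the endpoints is what allows polynomials here
    without a cut-off. *)
Lemma L2_poly_separates f f' : L2 J f -> L2 J f' ->
  (forall p : {poly C}, cintegral J (f \* cpoly p) = cintegral J (f' \* cpoly p)) ->
  \forall x \ae mu, J x -> f x = f' x.
Proof.
move=> lf lf' H.
have mI : measurable `[a, b]%classic by exact: measurable_itv.
have JI : J `<=` `[a, b] by apply: subset_itv; rewrite bnd_simp.
pose g x := if x \in J then f x - f' x else 0.
have gJ x : J x -> g x = f x - f' x by move=> Jx; rewrite /g mem_set.
have g0 x : ~ J x -> g x = 0 by move=> Jx; rewrite /g memNset.
have lB := L2B mJ lf lf'.
have mg : cmeasurable J g.
  have [[mr mi] _] := lB.
  by split; [move: mr|move: mi]; apply: eq_measurable_fun => x /set_mem Jx;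
    rewrite /reF /imF gJ.
have lgJ : L2 J g.
  by apply: (ae_L2 mJ mg _ lB); apply: aeW => x Jx; rewrite gJ.
have [lg _] := sqn_extend mJ mI JI (fun x _ => @g0 x) lgJ.
have : \forall x \ae mu, `[a, b]%classic x -> g x = 0.
  apply: cintegral_poly_annihilator => // p.
  rewrite (cintegral_subset JI); last by move=> x _ Jx; rewrite /= g0// mul0r.
  rewrite (eq_cintegral (g := (f \* cpoly p) \- (f' \* cpoly p))); last first.
    by move=> x Jx /=; rewrite gJ// mulrBl.
  have lp := csmooth_L2J a b (csmooth_cpoly p).
  rewrite cintegralB//; try exact: L2_mul_cintegrable.
  by rewrite H subrr.
apply: aeS => x xE Jx; apply/eqP; rewrite -subr_eq0 -gJ//; apply/eqP.
by apply: xE; exact: JI.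
Qed.

Lemma Laplacian_by_parts u w : H20 J u -> csmooth w ->
  cintegral J (w \* (Delta u : L2loc J)) = cintegral J (cderive (cderive w) \* u).
Proof.
move=> Hu sw; have sw' := csmooth_derive sw; have sw2 := csmooth_derive sw'.
apply: H20_integration_by_parts => //; try exact: csmooth_L2J.
move=> phi tphi; rewrite integration_by_parts_test//; last exact: test_derive.
by rewrite integration_by_parts_test// opprK.
Qed.

Lemma pencil_poly l u (w p : {poly C}) : w^`()^`() - l *: w = p -> H20 J u ->
  cintegral J (u \* cpoly p) =
  - cintegral J (cpoly w \* (pencil Delta l u : L2loc J)).
Proof.
move=> wp Hu; have [lu lD _] := H20_approx E Hu.
have sw := csmooth_cpoly w; have lw := csmooth_L2J a b sw.
have lw2 := csmooth_L2J a b (csmooth_derive (csmooth_derive sw)).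
have lp := csmooth_L2J a b (csmooth_cpoly p).
have -> : cintegral J (cpoly w \* (pencil Delta l u : L2loc J)) =
    l * cintegral J (cpoly w \* u) - cintegral J (cpoly w \* (Delta u : L2loc J)).
  rewrite -cintegralZ//; last exact: L2_mul_cintegrable.
  rewrite -cintegralB//; last first.
  - exact: L2_mul_cintegrable.
  - rewrite (_ : (fun x => _) = (l *: cpoly w) \* u).
      by apply: L2_mul_cintegrable => //; exact: L2_Z.
    by apply/funext => x /=; rewrite mulrA.
  have mJc v := L2loc_cmeasurable E (L2loc_funP v).
  have mw := csmooth_measurable J sw.
  apply: ae_eq_cintegral => //; first exact: cmeasurable_mul.
    have -> : (fun x => l * (cpoly w \* u) x) \- (cpoly w \* (Delta u : L2loc J)) =
        cpoly w \* ((l *: (u : R -> C)) \- (Delta u : L2loc J)).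
      by apply/funext => x /=; rewrite [X in _ = _ * (X - _)](_ : _ = l * u x)//; ring.
    apply: cmeasurable_mul => //.
    exact: (L2_measurable (L2B mJ (L2_Z l mJ lu) lD)).
  have := L2loc_combE l u (Delta u).
  by apply: aeS => x xE Jx /=; rewrite /pencil xE//; ring.
rewrite Laplacian_by_parts// opprB -cintegralZ//; last exact: L2_mul_cintegrable.
rewrite -cintegralB//.
- by apply: eq_cintegral => x Jx /=; rewrite -(cpolyE x wp); ring.
- exact: L2_mul_cintegrable.
- rewrite (_ : (fun x => _) = (l *: cpoly w) \* u).
    by apply: L2_mul_cintegrable => //; exact: L2_Z.
  by apply/funext => x /=; rewrite mulrA.
Qed.

Lemma Laplacian_pencil_inj l : pencil_inj Delta l.
Proof.
move=> u v /set_mem Hu /set_mem Hv uv.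
have [lu _ _] := H20_approx E Hu; have [lv _ _] := H20_approx E Hv.
apply: L2loc_eq; apply: L2_poly_separates; [exact: lu|exact: lv|] => p.
have [w wp] := poly_resolvent l p.
by rewrite (pencil_poly wp Hu) (pencil_poly wp Hv) uv.
Qed.

Lemma test_pencil l phi : test_function J phi -> exists u : L2loc J,
  [/\ H20 J u, \forall x \ae mu, J x -> u x = phi x &
    \forall x \ae mu, J x ->
      (pencil Delta l u : L2loc J) x = l * phi x - cderive (cderive phi) x].
Proof.
move=> tphi; have [u [Hu uE dE]] := test_H20 ab E tphi.
exists u; split => //; have := L2loc_combE l u (Delta u).
by apply: aeS2 (aeS2 (fun x p q => conj p q) uE dE) => x [ux dx] cx Jx;
  rewrite cx// ux// dx.
Qed.

(** Derivatives are local and [exh E n] lies in the interior of [exh E n.+1], so for [m > n] the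
    cut-off is [1] on a whole neighbourhood of each point of [exh E n]. *)
Lemma cderive2_cutoff n m w x : (n < m)%N -> exh E n x ->
  cderive (cderive (cutoff E m \* w)) x = cderive (cderive w) x.
Proof.
move=> nm nx; have := exh_succ nx => nx'.
have oI : open `]lend E n.+1, rend E n.+1[%classic by exact: itv_open.
have eq1 y : `]lend E n.+1, rend E n.+1[%classic y -> (cutoff E m \* w) y = w y.
  move=> ny /=; rewrite cutoff_eq1 ?mul1r//.
  by apply: (@exh_le _ _ E n.+1) => //; move: ny; apply: subset_itv; rewrite bnd_simp.
apply: cderive_near; apply: filterS (open_nbhs_nbhs (conj oI nx')) => y ny.
by apply: cderive_near; apply: filterS (open_nbhs_nbhs (conj oI ny)) => t /eq1.
Qed.

Lemma Laplacian_pencil_dense l : pencil_dense Delta l.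
Proof.
apply/seteqP; split => // f _ U /nbhs_L2loc[n [e [e0 HU]]].
have [M [M0 HM]] := cutoff_bounded E n.
have e1 : 0 < e ^+ 2 / M ^+ 2 by rewrite divr_gt0// exprn_gt0.
pose fL : L2loc J := f.
have lf := L2loc_exh E n.+1 (L2loc_funP fL).
have [p pe] := cpoly_dense (lend_lt_rend E n.+1) lf e1.
(* The pencil is [l - Delta], the opposite of the operator in [poly_resolvent]; hence [- p]. *)
have [w wp] := poly_resolvent l (- p).
have sw := csmooth_cpoly w.
(* The seminorms up to index [n] see [exh E n.+1], and the next cut-off is the first one known to be
   [1] in a neighbourhood of it. *)
have [u [Hu _ pE]] := test_pencil l (test_mul (cutoff_testJ E n.+2) sw).
exists (pencil Delta l u); split; first by exists u.
apply: HU => j jn; rewrite -ltr_sqr ?nnegrE ?L2loc_seminorm_ge0 ?(ltW e0)//.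
apply: le_lt_trans (L2loc_seminorm_le _ M0 jn (HM j jn)) _.
rewrite mulrC -ltr_pdivlMr ?exprn_gt0//; apply: le_lt_trans pe.
set q : L2loc J := pencil Delta l u - fL.
have lq := L2loc_exh E n.+1 (L2loc_funP q).
have lp := csmooth_L2 (lend E n.+1) (rend E n.+1) (csmooth_cpoly p).
have lB := L2B (mexh n.+1) lf lp.
have -> : sqn (exh E n.+1) ((fL : R -> C) \- cpoly p) =
    sqn (exh E n.+1) (fun x => (-1) * ((fL : R -> C) \- cpoly p) x).
  by rewrite sqnZ//; rewrite /csqr/= oppr0 expr0n addr0 sqrrN expr1n mul1r.
rewrite le_eqVlt; apply/orP; left; apply/eqP; apply: ae_eq_sqn => //.
  exact: (L2_Z (-1) (mexh n.+1) lB).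
have := L2loc_subE (pencil Delta l u) fL.
apply: aeS2 pE => x px qx nx; have Jx := exh_sub nx.
rewrite qx// px// (cderive2_cutoff (cpoly w) (ltnSn _) nx) /=.
rewrite (cutoff_eq1 (j := n.+2)); last by apply: exh_le nx.
have := cpolyE x wp; rewrite mul1r => h.
rewrite -[l * _ - _]opprB h /cpoly hornerN; ring.
Qed.

Lemma cexpV z x : cexp z x * cexp (- z) x = 1.
Proof.
have [rz iz] : complex.Re (- z) = - complex.Re z /\ complex.Im (- z) = - complex.Im z.
  by case: z.
have ee : expR (complex.Re z * x) * expR (- (complex.Re z * x)) = 1.
  by rewrite -expRD subrr expR0.
have cs := cos2Dsin2 (complex.Im z * x).
apply: complexP; rewrite ?Re_mul ?Im_mul/= rz iz !mulNr cosN sinN; last by ring.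
transitivity ((expR (complex.Re z * x) * expR (- (complex.Re z * x))) *
  (cos (complex.Im z * x) ^+ 2 + sin (complex.Im z * x) ^+ 2)); first by ring.
by rewrite ee cs mul1r.
Qed.

(** The product with the bounded function [cexp (- z)] is [1], so the length of the interval is at
    most a constant times this norm. *)
Lemma sqn_cexp_gt0 z (c d : R) : c < d -> 0 < sqn `[c, d] (cexp z).
Proof.
move=> cd; have mI : measurable `[c, d]%classic by exact: measurable_itv.
have [M [M0 HM]] := csmooth_itv_bounded c d (csmooth_cexp (- z)).
have HM' x : `[c, d]%classic x -> csqr (cexp (- z) x) <= M ^+ 2.
  by rewrite /= in_itv/=; exact: HM.
have mc := csmooth_measurable `[c, d] (csmooth_cexp (- z)).
have [l1 le1] := L2_mul_bounded mI (csmooth_L2 c d (csmooth_cexp z)) mc HM'.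
have : sqn `[c, d] (cexp z \* cexp (- z)) = d - c.
  rewrite (_ : _ \* _ = fun=> 1); last by apply/funext => x /=; rewrite cexpV.
  have i1 : ip mu `[c, d] (fun=> 1) (fun=> 1) = d - c.
    by rewrite /ip mulr1 Rintegral_cst// mul1r /= lebesgue_measure_itv/= lte_fin cd.
  have i0 : ip mu `[c, d] (fun=> 0) (fun=> 0) = 0.
    by rewrite /ip mulr0 Rintegral_cst// mul0r.
  rewrite -[LHS]/(ip mu `[c, d] (fun=> 1) (fun=> 1) +
    ip mu `[c, d] (fun=> 0) (fun=> 0)).
  by rewrite i1 i0 addr0.
move=> h; rewrite h in le1; rewrite -(pmulr_rgt0 _ (exprn_gt0 2 M0)).
by apply: lt_le_trans le1; rewrite subr_gt0.
Qed.

(** [Delta] is made of choices of weak derivatives, so its value at [0] is computed by viewing [0]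
    as the class of the zero test function. *)
Lemma L2loc_pencil0 l : pencil Delta l (0 : L2loc_space E) = 0 /\ H20 J (0 : L2loc J).
Proof.
have t0 : test_function J (fun=> 0 : C).
  split; [exact: smooth_cst|exact: smooth_cst|exists set0].
  by split => //; exact: compact0.
have [u [Hu uE pE]] := test_pencil l t0.
have z0 : \forall x \ae mu, J x -> (0 : L2loc J) x = 0.
  by have := L2loc_scaleE 0 (0 : L2loc J); rewrite scale0r;
    apply: aeS => x xE Jx; rewrite xE// mul0r.
have u0 : u = 0.
  by apply: L2loc_eq; apply: aeS2 uE z0 => x ux zx Jx; rewrite ux// zx.
rewrite u0 in Hu pE; split => //; apply: L2loc_eq.
apply: aeS2 pE z0 => x px zx Jx; rewrite px// zx// mulr0 !cderive_cst subr0//.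
Qed.

Lemma cderive_scale z f : csmooth f -> cderive (fun x => z * f x) = fun x => z * cderive f x.
Proof.
move=> sf; have -> : (fun x => z * f x) = (fun=> z) \* f by [].
rewrite (cderive_mul (csmooth_cst z) sf).
by apply/funext => x /=; rewrite cderive_cst mul0r add0r.
Qed.

(** The exponential with exponent a square root of [l], which also covers [l = 0] as a constant. The
    lower bound on [exh E 0] serves twice: it keeps preimages away from [0], and it excludes that
    [w] vanishes almost everywhere. *)
Lemma eigenfunction l : exists2 w, csmooth w &
  (forall x, cderive (cderive w) x = l * w x) /\ 1 <= sqn (exh E 0) w.
Proof.
pose m := sqn (exh E 0) (cexp (sqrtC l)).
have m0 : 0 < m by apply: sqn_cexp_gt0; exact: lend_lt_rend.
(* The squared norm is multiplied by the square of this factor and becomes [m^-1 + 2 + m], which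
   exceeds [1]; no square root of [m] is involved. *)
pose t : C := (m^-1 + 1)%:C%C.
have sc := csmooth_cexp (sqrtC l).
exists (fun x => t * cexp (sqrtC l) x).
  exact: (csmooth_mul (csmooth_cst t) sc).
split=> [x|].
  have D c : cderive (fun x => c * cexp (sqrtC l) x) =
      fun x => c * sqrtC l * cexp (sqrtC l) x.
    by rewrite (cderive_scale c sc) cderive_cexp; apply/funext => y; rewrite mulrA.
  by rewrite D D -(mulrA t) -expr2 sqrtCK mulrA (mulrC l).
rewrite sqnZ//; last exact: csmooth_L2.
rewrite -/m /csqr /= expr0n addr0.
have -> : (m^-1 + 1) ^+ 2 * m = m^-1 + 2 + m by field; rewrite gt_eqF.
have i0 : 0 < m^-1 by rewrite invr_gt0.
move: (m^-1) i0 => k k0; lra.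
Qed.

Lemma Laplacian_inverse_not_continuous l : ~ pencil_inv_continuous Delta l.
Proof.
have [p0 H0] := L2loc_pencil0 l.
move=> /subspace_continuousP /(_ (pencil Delta l 0)).
have r0 : pencil_range Delta l (pencil Delta l 0) by exists 0.
move=> /(_ r0); set inv := 'pinv_ _ _ _.
have invK u : H20 J u -> inv (pencil Delta l u) = u.
  by move=> Hu; apply: pinvKV; [exact: Laplacian_pencil_inj|exact: mem_set].
have i0 : inv (pencil Delta l 0) = (0 : L2loc_space E) := invK _ H0.
move=> cv0; have cv (V : set (L2loc_space E)) : nbhs (0 : L2loc_space E) V ->
    within (pencil_range Delta l) (nbhs (0 : L2loc_space E)) (inv @^-1` V).
  move=> nV; have nV' : nbhs (inv (pencil Delta l 0)) V by rewrite i0.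
  by have := cv0 V nV'; rewrite p0.
(* This neighbourhood is fixed before [n] and [e]. The element built from them has its image in the
   given neighbourhood of [0], yet its own seminorm of index [0] is at least [1]. *)
have V : nbhs (0 : L2loc_space E) [set v | L2loc_seminorm E 0 v < 1].
  apply/nbhs_L2loc; exists 0%N, 1; split => // v /(_ 0%N (leqnn _)).
  by rewrite subr0.
have /nbhs_L2loc[n [e [e0 H]]] := cv _ V.
have [w sw [w2 wgt]] := eigenfunction l.
have [u [Hu uE pE]] := test_pencil l (test_mul (cutoff_testJ E n.+2) sw).
have pu0 j : (j <= n)%N -> L2loc_seminorm E j (pencil Delta l u - 0) < e.
  move=> jn; have [M [M0 HM]] := cutoff_bounded E n.
  rewrite subr0 -ltr_sqr ?nnegrE ?L2loc_seminorm_ge0 ?(ltW e0)//.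
  apply: le_lt_trans (L2loc_seminorm_le _ M0 jn (HM j jn)) _.
  have lp := L2loc_exh E n.+1 (L2loc_funP (pencil Delta l u)).
  have l0 := @L2_0 R _ (mexh n.+1).
  have -> : sqn (exh E n.+1) (pencil Delta l u : L2loc J) = 0.
    rewrite (ae_eq_sqn (mexh n.+1) lp (L2_Z 0 (mexh n.+1) l0)); last first.
      apply: aeS pE => x px nx; rewrite (px (exh_sub nx)).
      rewrite (cderive2_cutoff w (ltnSn _) nx) w2 /= cutoff_eq1 ?mul1r; last exact: exh_le nx.
      by rewrite subrr; apply/esym; exact: mul0r.
    by rewrite (sqnZ 0 (mexh n.+1) l0) /csqr expr0n addr0 mul0r.
  by rewrite mulr0 exprn_gt0.
have := H (pencil Delta l u) pu0 (ex_intro2 _ _ u Hu erefl).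
rewrite /= invK// -ltr_sqr ?nnegrE ?L2loc_seminorm_ge0//.
apply/negP; rewrite -leNgt expr1n; apply: le_trans (L2loc_seminorm_ge E 0 u).
rewrite (ae_eq_sqn (f := u) (g := w) (mexh 0));
  [exact: wgt|exact: L2loc_exh (L2loc_funP u)|exact: csmooth_L2|].
apply: aeS uE => x ux nx; rewrite (ux (exh_sub nx)) /= cutoff_eq1 ?mul1r//.
exact: exh_le nx.
Qed.

End LaplacianSpectrum.

(** * Neighbourhoods of complex numbers *)

Section ComplexTopology.
Context {R : realType}.
Local Notation C := R[i].

Lemma csqrB_ltP (z w : C) (e : R) : 0 < e ->
  (`|z - w| < e%:C%C) = (csqr (z - w) < e ^+ 2).
Proof.
move=> e0; move: (z - w) => [x y].
rewrite normc_def ltcR /csqr /= -[in RHS](@sqr_sqrtr _ (x ^+ 2 + y ^+ 2)).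
  by rewrite ltr_sqr ?nnegrE ?sqrtr_ge0 ?ltW.
by rewrite addr_ge0 ?sqr_ge0.
Qed.

Lemma nbhs_csqr (z : C^o) (U : set C^o) : nbhs z U <->
  exists e : R, 0 < e /\ forall w, csqr (w - z) < e -> U w.
Proof.
split=> [/nbhs_ballP[[e y] /= ey H]|[e [e0 H]]].
  (* The radius of a ball over [C] is itself a complex number; positivity forces its imaginary part
     to vanish. *)
  have [e0 y0] : 0 < e /\ y = 0 by move: ey; rewrite ltcE/= => /andP[/eqP -> ->].
  exists (e ^+ 2); split; first exact: exprn_gt0.
  move=> w wz; apply: H; rewrite /ball/= distrC y0 -[Complex e 0]/(e%:C%C).
  by rewrite csqrB_ltP.
apply/nbhs_ballP; exists ((Num.sqrt e)%:C)%C; first by rewrite /= ltcR sqrtr_gt0.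
move=> w; rewrite /ball/= distrC csqrB_ltP ?sqrtr_gt0// sqr_sqrtr ?ltW//.
exact: H.
Qed.

End ComplexTopology.

(** * Integrals of functions with compact support *)

Section CompactSupport.
Context {R : realType} (J : set R) (E : exhaustion J).
Local Notation C := R[i].
Notation mu := (@lebesgue_measure R).
Implicit Types (u v : L2loc J) (g h : L2c J).

Let mexh n : measurable (exh E n). Proof. exact: measurable_itv. Qed.

Lemma L2c_support g : exists n, \forall x \ae mu, ~ exh E n x -> g x = 0.
Proof.
have [_ [S [cS SJ S0]]] := L2c_funP g; have [n Sn] := compact_sub_exh E cS SJ.
by exists n; apply: aeS S0 => x xE nx; apply: xE => /Sn.
Qed.

Lemma exh_L2c n (f : R -> C) : L2 setT f -> (forall x, ~ exh E n x -> f x = 0) ->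
  f \in L2c_pred J.
Proof.
move=> lf f0; rewrite inE; split => //; exists (exh E n).
by split; [exact: compact_exh|exact: exh_sub|exact: aeW].
Qed.

Lemma L2c_L2 D g : measurable D -> L2 D (g : R -> C).
Proof.
by move=> mD; have [] := sqn_subset mD measurableT (@subsetT _ _) (L2c_funP g).1.
Qed.

Lemma support_cintegral n (f k : R -> C) D : measurable D -> exh E n `<=` D ->
  cmeasurable D f -> cmeasurable D k ->
  (\forall x \ae mu, ~ exh E n x -> f x = 0) ->
  cintegral D (f \* k) = cintegral (exh E n) (f \* k).
Proof.
move=> mD nD mf mk f0.
(* [f] vanishes off [exh E n] only almost everywhere; [f'] does so everywhere, and the domain of
   integration can then be shrunk pointwise. *)
pose f' x := if x \in exh E n then f x else 0.
have f'E x : exh E n x -> f' x = f x by move=> nx; rewrite /f' mem_set.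
have f'0 x : ~ exh E n x -> f' x = 0 by move=> nx; rewrite /f' memNset.
have mf' : cmeasurable D f'.
  have resE (P : C -> R) : P 0 = 0 -> measurable_fun D (P \o f) ->
      measurable_fun D (P \o f').
    move=> P0 mPf; have : measurable_fun D ((P \o f) \_ (exh E n)).
      apply/(measurable_restrict _ (mexh n) mD).
      exact: measurable_funS mPf.
    apply: eq_measurable_fun => x _; rewrite patchE /f' /=.
    by case: ifPn.
  by case: mf => mr mi; split; exact: resE.
rewrite (@ae_eq_cintegral _ D (f \* k) (f' \* k) mD); last first.
- apply: aeS f0 => x xE Dx /=; case: (pselect (exh E n x)) => nx.
    by rewrite f'E.
  by rewrite f'0// xE.
- exact: cmeasurable_mul.
- exact: cmeasurable_mul.
rewrite (cintegral_subset nD); last by move=> x _ nx; rewrite /= f'0// mul0r.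
by apply: eq_cintegral => x nx /=; rewrite f'E.
Qed.

(** The tool for inserting and removing cut-offs, and for passing between integrals over the
    interval and over the line, next to a compactly supported factor. *)
Lemma support_cintegral_eq n (f k k' : R -> C) D D' :
  measurable D -> measurable D' -> exh E n `<=` D -> exh E n `<=` D' ->
  cmeasurable setT f -> cmeasurable setT k -> cmeasurable setT k' ->
  (\forall x \ae mu, ~ exh E n x -> f x = 0) ->
  (forall x, exh E n x -> k x = k' x) ->
  cintegral D (f \* k) = cintegral D' (f \* k').
Proof.
move=> mD mD' nD nD' mf mk mk' f0 kk'.
have sub (h : R -> C) (B : set R) : cmeasurable setT h -> cmeasurable B h.
  by move=> [hr hi]; split; exact: measurable_funTS.
rewrite (@support_cintegral n f k D)//; try exact: sub.
rewrite (@support_cintegral n f k' D')//; try exact: sub.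
by apply: eq_cintegral => x nx /=; rewrite kk'.
Qed.

Lemma L2c_ae_out g : \forall x \ae mu, ~ J x -> g x = 0.
Proof.
have [n f0] := L2c_support g; apply: aeS f0 => x xE Jx; apply: xE.
by move=> /exh_sub.
Qed.

Lemma L2c_eqJ g h : (\forall x \ae mu, J x -> g x = h x) -> g = h.
Proof.
move=> gh; apply: L2c_eq.
have := aeS2 (fun x p q => conj p q) (L2c_ae_out g) (L2c_ae_out h).
apply: aeS2 gh => x gx [g0 h0]; case: (pselect (J x)) => Jx; first exact: gx.
by rewrite g0// h0.
Qed.

End CompactSupport.

(** * Primitives controlled by the square norm *)

Section SmoothPrimitives.
Context {R : realType}.
Local Notation C := R[i].
Notation mu := (@lebesgue_measure R).

Lemma derive1_subcst (G : R -> R) (c x : R) : derivable G x 1 ->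
  derivable (fun x => G x - c) x 1 /\ derive1 (fun x => G x - c) x = derive1 G x.
Proof.
move=> dG; have dc : derivable (fun=> c) x 1 by exact: derivable_cst.
split; first exact: derivableB dG dc.
by rewrite !derive1E (deriveB dG dc) derive_cst subr0.
Qed.

(** The primitive vanishing at [a], bounded by Cauchy-Schwarz against the constant [1] on the
    interval from [a] to [x]. *)
Lemma smooth_primitive (f : R -> R) (S : set R) (a b : R) : smooth f ->
  compact S -> (forall x, ~ S x -> f x = 0) ->
  exists F, [/\ smooth F, derive1 F = f &
    forall x, a <= x <= b -> F x ^+ 2 <= (b - a) * ip mu setT f f].
Proof.
move=> sf cS f0; have [M [M0 SM]] := compact_bounded_interval cS.
have cf := smooth_continuous sf.
have mT : measurable (setT : set R) by [].
have mI : measurable `[- M, M]%classic by exact: measurable_itv.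
have tf0 x : setT x -> ~ `[- M, M]%classic x -> f x = 0.
  by move=> _ xM; apply: f0 => /SM.
have sqf : sqint mu setT f.
  have mf : measurable_fun setT f by exact: continuous_measurable_fun.
  have [_ i] := sqint_continuous (- M) M cf; split => //.
  have := (@integrable_mkcond _ _ _ mu _ (EFin \o (fun x => f x * f x)) mI).1 i.
  apply: eq_integrable => // x _; rewrite patchE; case: ifPn => // /negP xM.
  by rewrite /= tf0 ?mulr0// => h; apply: xM; exact: mem_set.
have intf : mu.-integrable setT (EFin \o f).
  have i : mu.-integrable `[- M, M] (EFin \o f).
    apply: continuous_compact_integrable; first exact: segment_compact.
    exact: continuous_subspaceT.
  have := (@integrable_mkcond _ _ _ mu _ (EFin \o f) mI).1 i.
  apply: eq_integrable => // x _; rewrite patchE; case: ifPn => // /negP xM.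
  by rewrite /= tf0// => h; apply: xM; exact: mem_set.
(* Starting at minus infinity makes the fundamental theorem of calculus apply at every point, also
   to the left of [a]. *)
pose G x := \int[mu]_(t in [set` `]-oo, x]]) f t.
have dG x : derivable G x 1 /\ derive1 G x = f x.
  apply: (@continuous_FTC1 R f -oo%O x (x + 1)).
  - by rewrite ltrDl.
  - by apply: integrableS intf.
  - by rewrite ltNyr.
  - exact: cf.
pose F x := G x - G a.
have dF x : derivable F x 1 /\ derive1 F x = f x.
  by have [d1 <-] := dG x; exact: derive1_subcst.
have F'f : derive1 F = f by apply/funext => x; exact: (dF x).2.
exists F; split; [|exact: F'f|].
  move=> [|n] x; first exact: (dF x).1.
  by rewrite derive1Sn F'f; exact: sf.
move=> x /andP[ax xb].
have FE : F x = \int[mu]_(t in `]a, x]) f t.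
  rewrite /F /G Rintegral_itvB//.
  by apply: integrableS intf.
have mA : measurable `]a, x]%classic by exact: measurable_itv.
have sA : sqint mu `]a, x] f.
  case: sqf => [m i]; split; first exact: measurable_funTS.
  by apply: integrableS i.
have s1 : sqint mu `]a, x] (fun=> 1).
  apply: (@sqint_bounded _ _ _ 1) => //; last by move=> y _; rewrite normr1.
  by rewrite lebesgue_measure_itv; case: ifP => _; rewrite /= ?ltry// -EFinD ltry.
have := ip_CS mu mA sA s1.
have -> : ip mu `]a, x] f (fun=> 1) = F x.
  by rewrite FE; apply: eq_Rintegral => y _; rewrite mulr1.
move=> le1; apply: (le_trans le1); rewrite mulrC; apply: ler_pM.
- exact: ip_ge0.
- exact: ip_ge0.
- rewrite /ip mulr1 Rintegral_cst// mul1r /= lebesgue_measure_itv/= lte_fin.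
  case: ifP => h /=; last by rewrite subr_ge0 (le_trans ax xb).
  by rewrite lerD2r.
- rewrite -lee_fin !EFin_ip//; apply: ge0_subset_integral => //.
    by apply/measurable_EFinP; apply: measurable_funM; case: sqf.
  by move=> y _; rewrite lee_fin -expr2 sqr_ge0.
Qed.

Lemma test_primitive phi (a b : R) : test_function setT phi ->
  exists w, [/\ csmooth w, cderive w = phi &
    forall x, a <= x <= b -> csqr (w x) <= (b - a) * sqn setT phi].
Proof.
move=> [pr pim [S [cS _ S0]]].
have [|F [sF F' leF]] := @smooth_primitive (reF phi) S a b pr cS.
  by move=> x Sx; rewrite /reF S0.
have [|G [sG G' leG]] := @smooth_primitive (imF phi) S a b pim cS.
  by move=> x Sx; rewrite /imF S0.
exists (fun x => Complex (F x) (G x)); split; first by split; [exact: sF|exact: sG].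
  apply/funext => x; rewrite /cderive [reF _](_ : _ = F)// [imF _](_ : _ = G)//.
  by rewrite F' G' /reF /imF; case: (phi x).
move=> x xab; rewrite /csqr /sqn mulrDr; apply: lerD; [exact: leF|exact: leG].
Qed.

End SmoothPrimitives.

(** * The adjoint *)

Section AdjointDomain.
Context {R : realType} (a b : R) (ab : a < b).
Local Notation J := (`]a, b[%classic).
Context (E : exhaustion J).
Local Notation C := R[i].
Notation mu := (@lebesgue_measure R).
Implicit Types (u v : L2loc J) (g h : L2c J) (l z : C).
Local Notation Delta := (Laplacian E).
Local Notation AD := (Laplacian_adjoint E).

Let mJ : measurable J. Proof. exact: measurable_itv. Qed.

Let mexh n : measurable (exh E n). Proof. exact: measurable_itv. Qed.

Lemma L2c_measurable g : cmeasurable setT (g : R -> C).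
Proof. exact: L2_measurable (L2c_funP g).1. Qed.

Lemma pairing_ae g u f : cmeasurable J f -> (\forall x \ae mu, J x -> u x = f x) ->
  pairing g u = cintegral J (g \* f).
Proof.
move=> mf uf; rewrite /pairing; apply: ae_eq_cintegral; [exact: mJ| | |].
- apply: cmeasurable_mul; first exact: L2_measurable (L2c_L2 g mJ).
  exact: (L2loc_cmeasurable E (L2loc_funP u)).
- by apply: cmeasurable_mul => //; exact: L2_measurable (L2c_L2 g mJ).
- by apply: aeS uf => x xE Jx /=; rewrite xE.
Qed.

Lemma Laplacian0 : Delta 0 = 0.
Proof.
have [+ _] := L2loc_pencil0 ab E 0; rewrite /pencil scaler0 sub0r.
by move=> /(congr1 -%R); rewrite opprK oppr0.
Qed.

Lemma pairing0 g : pairing g (0 : L2loc J) = 0.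
Proof.
rewrite (@pairing_ae g 0 (fun=> 0)).
- by apply: cintegral0 => x _ /=; exact: mulr0.
- by split; exact: measurable_cst.
have := L2loc_scaleE 0 (0 : L2loc J); rewrite scale0r.
by apply: aeS => x xE Jx; rewrite xE// mul0r.
Qed.

Lemma csqr_inv_gt0 (s : R) : 0 < s -> csqr ((Num.sqrt s)^-1%:C%C) = s^-1.
Proof.
by move=> s0; rewrite /csqr /= expr0n addr0 exprVn sqr_sqrtr// ltW.
Qed.

(** Continuity at [0] is turned into an estimate by scaling. If [phi] violated it, dividing [phi] by
    the modulus of the integral would give an element of the neighbourhood of [0] whose image has
    modulus exactly [1]. The constant is [M ^+ 2 / e ^+ 2], with [M] bounding the cut-offs involved
    and [e] the radius in the seminorms. *)
Lemma adjoint_dom_bound g : op_dom AD g -> exists B : R, 0 < B /\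
  forall phi, test_function J phi ->
    csqr (cintegral J (g \* cderive (cderive phi))) <= B * sqn J phi.
Proof.
move=> /subspace_continuousP /(_ 0 (L2loc_pencil0 ab E 0).2).
move=> cv0; have cv (V : set C^o) : nbhs (0 : C^o) V ->
    within (op_dom Delta) (nbhs (0 : L2loc_space E)) (fun u => V (pairing g (Delta u))).
  move=> nV; have F0 : pairing g (Delta 0) = 0 by rewrite Laplacian0 pairing0.
  have nV' : nbhs (pairing g (Delta 0) : C^o) V by rewrite F0.
  exact: cv0 V nV'.
have V : nbhs (0 : C^o) [set z : C^o | csqr z < 1].
  by apply/nbhs_csqr; exists 1; split => // w; rewrite subr0.
have /nbhs_L2loc[n [e [e0 H]]] := cv _ V.
have [M [M0 HM]] := cutoff_bounded E n.
exists (M ^+ 2 / e ^+ 2); split; first by rewrite divr_gt0// exprn_gt0.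
move=> phi tphi; set s := csqr _; rewrite leNgt; apply/negP => lt.
have q0 := sqn_ge0 J phi.
have B0 : 0 <= M ^+ 2 / e ^+ 2 by rewrite divr_ge0// sqr_ge0.
have s0 : 0 < s by apply: le_lt_trans lt; exact: mulr_ge0.
pose t : C := (Num.sqrt s)^-1%:C%C.
have sphi := csmooth_test tphi; have sphi1 := csmooth_derive sphi.
have tt : test_function J (fun x => t * phi x).
  have := test_mul tphi (csmooth_cst t); congr test_function.
  by apply/funext => x /=; rewrite mulrC.
have [u [Hu uE dE]] := test_H20 ab E tt.
have dtt : cderive (cderive (fun x => t * phi x)) =
    fun x => t * cderive (cderive phi) x.
  by rewrite (cderive_scale t sphi) (cderive_scale t sphi1).
have lphi := test_L2 mJ tphi.
have lu := L2loc_exh E n.+1 (L2loc_funP u).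
have small j : (j <= n)%N -> L2loc_seminorm E j (u - 0) < e.
  move=> jn; rewrite subr0 -ltr_sqr ?nnegrE ?L2loc_seminorm_ge0 ?(ltW e0)//.
  apply: le_lt_trans (L2loc_seminorm_le _ M0 jn (HM j jn)) _.
  have [_ le1] := sqn_subset (mexh n.+1) mJ (@exh_sub _ _ E n.+1) (test_L2 mJ tt).
  rewrite (ae_eq_sqn (g := fun x => t * phi x) (mexh n.+1) lu); last 2 first.
  - exact: test_L2 (mexh n.+1) tt.
  - by apply: aeS uE => x xE nx; rewrite (xE (exh_sub nx)).
  rewrite mulrC -ltr_pdivlMr ?exprn_gt0//; apply: le_lt_trans le1 _.
  rewrite (sqnZ t mJ lphi) csqr_inv_gt0// mulrC ltr_pdivrMr//.
  rewrite -ltr_pdivrMl ?divr_gt0 ?exprn_gt0// invf_div mulrC.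
  by rewrite mulrC; exact: lt.
have := H u small Hu; rewrite /= (@pairing_ae g _ _ _ dE); last first.
  have m := csmooth_measurable J (csmooth_derive (csmooth_derive (csmooth_test tt))).
  exact: m.
rewrite dtt (eq_cintegral (g := fun x => t * (g \* cderive (cderive phi)) x)); last first.
  by move=> x _ /=; ring.
rewrite cintegralZ; last 2 first.
- exact: mJ.
- apply: L2_mul_cintegrable; [exact: mJ|exact: L2c_L2|].
  exact: (test_L2 mJ (test_derive (test_derive tphi))).
by rewrite csqrM csqr_inv_gt0// mulVf ?ltxx// gt_eqF.
Qed.

End AdjointDomain.

(** * Riesz representation of functionals on test functions *)

Section RieszTest.
Context {R : realType}.
Local Notation C := R[i].
Notation mu := (@lebesgue_measure R).
Implicit Types (f g phi : R -> C) (r s : R -> R) (k : nat).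

Let mT : measurable (setT : set R). Proof. by []. Qed.

Definition real_test r := test_function setT (fun x => (r x)%:C%C).

Lemma real_testP r : real_test r <-> smooth r /\
  exists S : set R, compact S /\ forall x, ~ S x -> r x = 0.
Proof.
split=> [[sr _ [S [cS _ S0]]]|[sr [S [cS S0]]]].
  by split; [exact: sr|exists S; split => // x /S0 /(congr1 (@complex.Re R))].
split; [exact: sr|exact: smooth_cst|exists S].
by split; [exact: cS|exact: subsetT|move=> x /S0 /= ->].
Qed.

Lemma real_test_sqint r : real_test r -> sqint mu setT r.
Proof. by move=> tr; have [+ _] := (L2P _ mT).1 (test_L2 mT tr). Qed.

Lemma real_test_derive r : real_test r -> real_test (derive1 r).
Proof.
move=> /real_testP[sr [S [cS S0]]]; apply/real_testP.
split; first exact: (smooth_derive1 sr).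
by exists S; split; [exact: cS|exact: derive1_near0 cS S0].
Qed.

Lemma real_test_derive1n k r : real_test r -> real_test (derive1n k r).
Proof. by elim: k => [//|k IH] tr; rewrite derive1nS; exact: real_test_derive (IH tr). Qed.

Lemma real_test_comb (c : R) r s : real_test r -> real_test s ->
  real_test (fun x => r x + c * s x).
Proof.
move=> /real_testP[sr [S [cS S0]]] /real_testP[ss [S' [cS' S0']]]; apply/real_testP.
have sc : smooth (fun=> c) by exact: smooth_cst.
split; first exact: (smooth_add sr (smooth_mul sc ss)).
exists (S `|` S'); split; first exact: compactU.
by move=> x /not_orP[/S0 -> /S0' ->]; rewrite mulr0 addr0.
Qed.

Lemma test_reF phi : test_function setT phi -> real_test (reF phi).
Proof.
move=> [sr _ [S [cS _ S0]]]; apply/real_testP; split; first exact: sr.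
by exists S; split => // x Sx; rewrite /reF S0.
Qed.

Lemma test_imF phi : test_function setT phi -> real_test (imF phi).
Proof.
move=> [_ si [S [cS _ S0]]]; apply/real_testP; split; first exact: si.
by exists S; split => // x Sx; rewrite /imF S0.
Qed.

Lemma derive1n_comb k (c : R) r s : smooth r -> smooth s ->
  derive1n k (fun x => r x + c * s x) = fun x => derive1n k r x + c * derive1n k s x.
Proof.
move=> sr ss; elim: k r s sr ss => [//|k IH] r s sr ss.
have sc : smooth (fun=> c) by exact: smooth_cst.
rewrite !derive1Sn (derive1_add sr (smooth_mul sc ss)).
rewrite (derive1_scale c ss).
exact: IH (smooth_derive1 sr) (smooth_derive1 ss).
Qed.

Lemma derive1n0 k : derive1n k (fun=> 0 : R) = fun=> 0.
Proof.
elim: k => [//|k IH]; rewrite derive1nS IH.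
by apply/funext => x; rewrite derive1_cst.
Qed.

Lemma reF_iter k phi : reF (iter k (@cderive R) phi) = derive1n k (reF phi).
Proof. by elim: k => [//|k IH]; rewrite derive1nS -IH. Qed.

Lemma imF_iter k phi : imF (iter k (@cderive R) phi) = derive1n k (imF phi).
Proof. by elim: k => [//|k IH]; rewrite derive1nS -IH. Qed.

Lemma riesz_real_test k (gamma : R -> R) (B : R) : sqint mu setT gamma -> 0 <= B ->
  (forall r, real_test r -> ip mu setT gamma (derive1n k r) ^+ 2 <= B * ip mu setT r r) ->
  exists h, sqint mu setT h /\
    forall r, real_test r -> ip mu setT gamma (derive1n k r) = ip mu setT h r.
Proof.
move=> sg B0 H.
have [|||||h [sh hE _]] := riesz mu mT real_test
  (fun r => ip mu setT gamma (derive1n k r)) B B0.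
- apply/real_testP; split; first exact: smooth_cst.
  by exists set0; split => //; exact: compact0.
- by move=> c r s tr ts; exact: real_test_comb.
- move=> c r s tr ts.
  have [sr _] := (real_testP r).1 tr; have [ss _] := (real_testP s).1 ts.
  have kr := real_test_sqint (real_test_derive1n k tr).
  have ks := real_test_sqint (real_test_derive1n k ts).
  by rewrite (derive1n_comb k c sr ss) (ipDr mu mT sg kr (sqintZ mu mT c ks)) (ipZr mu mT c sg ks).
- by move=> r; exact: real_test_sqint.
- exact: H.
by exists h.
Qed.

(** [riesz] is a real statement. It is applied to the real and the imaginary part of [g] on real
    test functions, and the two representing functions are recombined; the pairing is bilinear,
    without conjugation, so the recombination is the algebraic product. Only [k = 1] and [k = 2]
    occur later. *)
Lemma riesz_test k g (B : R) : L2 setT g -> 0 <= B ->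
  (forall phi, test_function setT phi ->
    csqr (cintegral setT (g \* iter k (@cderive R) phi)) <= B * sqn setT phi) ->
  exists f, L2 setT f /\ forall phi, test_function setT phi ->
    cintegral setT (g \* iter k (@cderive R) phi) = cintegral setT (f \* phi).
Proof.
move=> lg B0 H; have [gr gi] := (L2P g mT).1 lg.
have reE r : reF (fun x => (r x)%:C%C) = r by [].
have imE r : imF (fun x => (r x)%:C%C) = fun=> 0 by [].
have real r : real_test r -> cintegral setT (g \* iter k (@cderive R) (fun x => (r x)%:C%C)) =
    Complex (ip mu setT (reF g) (derive1n k r)) (ip mu setT (imF g) (derive1n k r)).
  move=> tr; rewrite /cintegral reF_mul imF_mul reF_iter imF_iter.
  rewrite reE imE derive1n0.
  congr Complex; apply: eq_Rintegral => x _; first by rewrite mulr0 subr0.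
  by rewrite mulr0 add0r.
have bound r : real_test r -> csqr (Complex (ip mu setT (reF g) (derive1n k r))
    (ip mu setT (imF g) (derive1n k r))) <= B * ip mu setT r r.
  move=> tr; rewrite -real//; apply: le_trans (H _ tr) _.
  rewrite ler_wpM2l// /sqn reE imE.
  by rewrite [X in _ + X](_ : _ = 0) ?addr0// /ip mulr0 Rintegral_cst// mul0r.
have [|hr [shr hrE]] := @riesz_real_test k (reF g) B gr B0.
  by move=> r tr; apply: le_trans (bound r tr); rewrite /csqr/= lerDl sqr_ge0.
have [|hi [shi hiE]] := @riesz_real_test k (imF g) B gi B0.
  by move=> r tr; apply: le_trans (bound r tr); rewrite /csqr/= lerDr sqr_ge0.
exists (fun x => Complex (hr x) (hi x)); split; first by apply/L2P.
move=> phi tphi; have tr := test_reF tphi; have ti := test_imF tphi.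
have kr := real_test_sqint (real_test_derive1n k tr).
have ki := real_test_sqint (real_test_derive1n k ti).
have sr := real_test_sqint tr; have si := real_test_sqint ti.
rewrite /cintegral !reF_mul !imF_mul reF_iter imF_iter.
rewrite (@RintegralB _ _ _ mu setT _ _ mT (sqint_mul mu mT gr kr) (sqint_mul mu mT gi ki)).
rewrite (@RintegralD _ _ _ mu setT _ _ mT (sqint_mul mu mT gr ki) (sqint_mul mu mT gi kr)).
rewrite (@RintegralB _ _ _ mu setT _ _ mT (sqint_mul mu mT shr sr) (sqint_mul mu mT shi si)).
rewrite (@RintegralD _ _ _ mu setT _ _ mT (sqint_mul mu mT shr si) (sqint_mul mu mT shi sr)).
have := hrE _ tr; have := hrE _ ti; have := hiE _ tr; have := hiE _ ti.
by rewrite /ip => -> -> -> ->.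
Qed.

End RieszTest.

(** * Domain and action of the adjoint *)

Section AdjointSpectrum.
Context {R : realType} (a b : R) (ab : a < b).
Local Notation J := (`]a, b[%classic).
Context (E : exhaustion J).
Local Notation C := R[i].
Notation mu := (@lebesgue_measure R).
Implicit Types (u v : L2loc J) (g h : L2c J) (l z : C) (phi w : R -> C).
Local Notation Delta := (Laplacian E).
Local Notation AD := (Laplacian_adjoint E).

Let mJ : measurable J. Proof. exact: measurable_itv. Qed.

Let mexh n : measurable (exh E n). Proof. exact: measurable_itv. Qed.

Let mT : measurable (setT : set R). Proof. by []. Qed.

Let mcs (f : R -> C) : csmooth f -> cmeasurable setT f.
Proof. exact: csmooth_measurable. Qed.

Let mc2 w : csmooth w -> cmeasurable setT (cderive (cderive w)).
Proof. by move=> sw; apply: mcs; exact: csmooth_derive (csmooth_derive sw). Qed.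

Lemma cutoff_csmooth n : csmooth (cutoff E n).
Proof. exact: csmooth_test (cutoff_testJ E n). Qed.

Lemma cderive_cutoff n m w x : (n < m)%N -> exh E n x ->
  cderive (cutoff E m \* w) x = cderive w x.
Proof.
move=> nm nx; apply: cderive_near; apply: filterS (cutoff_near1 nm nx) => y yE.
by rewrite /= yE mul1r.
Qed.

Lemma cutoff_mul1 n m w x : (n < m)%N -> exh E n x -> (cutoff E m \* w) x = w x.
Proof.
by move=> nm nx; rewrite /= cutoff_eq1 ?mul1r//; apply: exh_le nx; exact: ltnW.
Qed.

Lemma cutoff_mul_bound m : exists M : R, 0 < M /\
  forall w, L2 setT w -> csmooth w -> sqn J (cutoff E m \* w) <= M ^+ 2 * sqn setT w.
Proof.
have [M [M0 HM]] := test_bounded (cutoff_testJ E m).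
exists M; split => // w lw sw.
have [lJ le1] := sqn_subset mJ mT (@subsetT _ _) lw.
have [_ le2] := L2_mul_bounded mJ lJ (csmooth_measurable J (cutoff_csmooth m)) (fun x _ => HM x).
rewrite (_ : cutoff E m \* w = w \* cutoff E m); last first.
  by apply/funext => x /=; rewrite mulrC.
by apply: (le_trans le2); rewrite ler_wpM2l ?sqr_ge0.
Qed.

Lemma adjoint_dom_H2 g : op_dom AD g -> H2 setT g.
Proof.
move=> dg; have [B [B0 HB]] := adjoint_dom_bound ab dg.
have [n g0] := L2c_support E g; have [lg _] := L2c_funP g.
have mg := L2c_measurable g.
have nJ := @exh_sub _ _ E n; have nT := @subsetT _ (exh E n).
have [M [M0 HM]] := cutoff_mul_bound n.+1.
(* The bound from the domain concerns test functions of the interval. Since [g] lives on [exh E n],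
   it extends to every smooth [w] on the line, with the cut-off on the right-hand side only. *)
have bound w : csmooth w ->
    csqr (cintegral setT (g \* cderive (cderive w))) <= B * sqn J (cutoff E n.+1 \* w).
  move=> sw; have sthw := csmooth_mul (cutoff_csmooth n.+1) sw.
  rewrite -(@support_cintegral_eq _ _ E n g (cderive (cderive (cutoff E n.+1 \* w))) _ J setT);
    [|exact: mJ|exact: mT|exact: nJ|exact: nT|exact: mg|exact: mc2|exact: mc2|exact: g0|].
    by apply: HB; apply: test_mul sw; exact: cutoff_testJ.
  by move=> x nx; exact: (cderive2_cutoff w (ltnSn n) nx).
have C0 : 0 <= B * M ^+ 2 by rewrite mulr_ge0 ?sqr_ge0// ltW.
have [|f2 [l2 f2E]] := @riesz_test _ 2 g (B * M ^+ 2) lg C0.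
  move=> phi tphi; apply: (le_trans (bound _ (csmooth_test tphi))).
  rewrite -mulrA ler_wpM2l ?(ltW B0)//.
  exact: HM (test_L2 mT tphi) (csmooth_test tphi).
pose th := cutoff E n.+1; have lth : L2 J th := test_L2 mJ (cutoff_testJ E n.+1).
have D0 : 0 <= B * ((b - a) * sqn J th).
  by rewrite mulr_ge0 ?(ltW B0)// mulr_ge0 ?sqn_ge0// subr_ge0 ltW.
(* For the first derivative, [phi] is replaced by a primitive [w]: then [phi'] is [w''], and [bound]
   applies although [w] need not have compact support. *)
have [|k [lk kE]] := @riesz_test _ 1 g (B * ((b - a) * sqn J th)) lg D0.
  move=> phi tphi; have [w [sw w' wle]] := test_primitive a b tphi.
  rewrite -[iter 1 _ _]/(cderive phi) -w'; apply: (le_trans (bound _ sw)).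
  rewrite -mulrA ler_wpM2l ?(ltW B0)// -mulrA mulrCA mulrC.
  have q0 : 0 <= (b - a) * sqn setT phi.
    by rewrite mulr_ge0 ?sqn_ge0// subr_ge0 ltW.
  have [|_] := @L2_mul_bounded _ J th w (Num.sqrt ((b - a) * sqn setT phi)) mJ lth
    (csmooth_measurable J sw).
    move=> x; rewrite /= in_itv/= => /andP[ax xb]; rewrite sqr_sqrtr//.
    by apply: wle; rewrite !ltW.
  by rewrite sqr_sqrtr// w' => h; apply: (le_trans h); rewrite mulrAC mulrC mulrA.
(* The sign is that of the definition of [weak_derivative], since [k] represents the integral of
   [g * phi'] itself; [f2] needs none after two derivatives. *)
exists (fun x => (-1) * k x), f2.
have lk' : L2 setT (fun x => (-1) * k x) by exact: (L2_Z (-1) mT lk).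
have Nk phi : test_function setT phi ->
    cintegral setT ((fun x => (-1) * k x) \* phi) = - cintegral setT (k \* phi).
  move=> tphi; rewrite (eq_cintegral (g := fun x => (-1) * (k \* phi) x)).
    rewrite cintegralZ ?mulN1r//.
    exact: L2_mul_cintegrable mT lk (test_L2 mT tphi).
  by move=> x _ /=; rewrite mulrA.
split; [exact: lg|exact: lk'|exact: l2| |] => phi tphi.
  by rewrite Nk// opprK; exact: kE.
rewrite Nk; last exact: test_derive.
by rewrite -(kE _ (test_derive tphi)) -(f2E _ tphi).
Qed.

Lemma L2c_pred_cutoff n (f : R -> C) : L2 setT f -> cutoff E n \* f \in L2c_pred J.
Proof.
move=> lf; apply: (@exh_L2c _ _ E n.+1); last first.
  by move=> x nx; rewrite /= cutoff_out// mul0r.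
have := L2loc_test_L2 E (L2T_L2loc J lf) (cutoff_testJ E n); congr L2.
by apply/funext => x /=; rewrite mulrC.
Qed.

Lemma L2c_deriveE g h : weak_derivative setT g h -> L2c_derive g = h.
Proof.
move=> gh; rewrite /L2c_derive; case: xgetP => [k _ /= gk|nk]; last first.
  by exfalso; exact: nk h gh.
apply: (L2c_eqJ E); apply: (test_separates E).
- exact: L2T_L2loc (L2c_funP k).1.
- exact: L2T_L2loc (L2c_funP h).1.
move=> phi tphi; have tT : test_function setT phi by apply: test_sub tphi.
have := gk _ tT; rewrite gh// => /oppr_inj hk.
have [_ _ [S [_ SJ S0]]] := tphi.
have out (f : R -> C) : cintegral setT (f \* phi) = cintegral J (f \* phi).
  apply: cintegral_subset; first exact: subsetT.
  by move=> x _ Jx; rewrite /= S0 ?mulr0// => /SJ.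
by rewrite -!out.
Qed.

Lemma pairing_separates h h' :
  (forall u, H20 J u -> pairing h u = pairing h' u) -> h = h'.
Proof.
move=> H; apply: (L2c_eqJ E); apply: (test_separates E).
- exact: L2T_L2loc (L2c_funP h).1.
- exact: L2T_L2loc (L2c_funP h').1.
move=> phi tphi; have [u [Hu uE _]] := test_H20 ab E tphi.
have mphi := csmooth_measurable J (csmooth_test tphi).
by rewrite -(pairing_ae E h mphi uE) -(pairing_ae E h' mphi uE); exact: H.
Qed.

(** The derivatives supplied by [H2] are functions on the line, not yet known to lie in
    [L2c_pred J]. Multiplying them by a cut-off equal to [1] near the support of [g] puts them
    there, and the cut-off can be moved onto the test function. One [h] then represents both the
    second weak derivative and the functional defining the adjoint. *)
Lemma H2c_dual g : H2 setT g -> exists h,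
  L2c_derive (L2c_derive g) = h /\
  forall u, H20 J u -> pairing h u = pairing g (Delta u).
Proof.
move=> [f1 [f2 [lg l1 l2 gf1 f12]]].
have [n g0] := L2c_support E g; have mg := L2c_measurable g.
have nJ := @exh_sub _ _ E n; have nT := @subsetT _ (exh E n).
pose th := cutoff E n.+1.
have sth : csmooth th := cutoff_csmooth n.+1.
have thT phi : csmooth phi -> test_function setT (th \* phi).
  move=> sphi; apply: (@test_sub _ J); first exact: subsetT.
  by apply: test_mul sphi; exact: cutoff_testJ.
have c1 := L2c_pred_cutoff n.+1 l1; have c2 := L2c_pred_cutoff n.+1 l2.
have d1E := L2c_classE c1; have d2E := L2c_classE c2.
set d1 := L2c_class c1 in d1E; set d2 := L2c_class c2 in d2E.
have swap (d : L2c J) (f phi : R -> C) : (\forall x \ae mu, d x = (th \* f) x) ->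
    L2 setT f -> cmeasurable setT phi ->
    cintegral setT (d \* phi) = cintegral setT (f \* (th \* phi)).
  move=> dE lf mphi; have mth := mcs sth; have [mf _] := lf.
  rewrite (@ae_eq_cintegral _ setT (d \* phi) ((th \* f) \* phi) mT).
  - by apply: eq_cintegral => x _ /=; ring.
  - by apply: cmeasurable_mul => //; exact: L2c_measurable.
  - by apply: cmeasurable_mul => //; exact: cmeasurable_mul.
  - by apply: aeS dE => x xE _ /=; rewrite xE.
have gd1 : weak_derivative setT g d1.
  move=> phi tphi; have sphi := csmooth_test tphi.
  rewrite (swap _ _ _ d1E l1 (mcs sphi)) -(gf1 _ (thT _ sphi)).
  apply: (@support_cintegral_eq _ _ E n);
    [exact: mT|exact: mT|exact: nT|exact: nT|exact: mg
    |exact: mcs (csmooth_derive sphi)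
    |exact: mcs (csmooth_derive (csmooth_mul sth sphi))|exact: g0|].
  by move=> x nx; rewrite (cderive_cutoff phi (ltnSn n) nx).
have key w : csmooth w -> cintegral setT (g \* cderive (cderive w)) =
    cintegral setT (f2 \* (th \* w)).
  move=> sw; have e1 := f12 _ (thT _ sw).
  have e2 := gf1 _ (test_derive (thT _ sw)); rewrite e1 opprK in e2.
  rewrite -e2.
  apply: (@support_cintegral_eq _ _ E n);
    [exact: mT|exact: mT|exact: nT|exact: nT|exact: mg|exact: mc2
    |exact: mc2 (csmooth_mul sth sw)|exact: g0|].
  by move=> x nx; rewrite (cderive2_cutoff w (ltnSn n) nx).
have d12 : weak_derivative setT d1 d2.
  move=> phi tphi; have sphi := csmooth_test tphi.
  have g2 := gd1 _ (test_derive tphi).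
  by rewrite (swap _ _ _ d2E l2 (mcs sphi)) -(key _ sphi) g2 opprK.
exists d2; split; first by rewrite (L2c_deriveE gd1) (L2c_deriveE d12).
move=> u Hu; apply/esym; apply: H20_integration_by_parts; [exact: L2c_L2|exact: L2c_L2| |exact: Hu].
move=> phi tphi; have sphi := csmooth_test tphi; have [_ _ [S [_ SJ S0]]] := tphi.
have out (f phi' : R -> C) : (forall x, ~ J x -> phi' x = 0) ->
    cintegral J (f \* phi') = cintegral setT (f \* phi').
  move=> p0; apply/esym; apply: cintegral_subset; first exact: subsetT.
  by move=> x _ Jx; rewrite /= p0 ?mulr0.
have p0 x : ~ J x -> phi x = 0 by move=> Jx; apply: S0 => /SJ.
have [_ _ [S2 [_ S2J S20]]] := test_derive (test_derive tphi).
have p2 x : ~ J x -> cderive (cderive phi) x = 0 by move=> Jx; apply: S20 => /S2J.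
by rewrite (out _ _ p0) (out _ _ p2) key// (swap _ _ _ d2E l2 (mcs sphi)).
Qed.

(** The choice made by [xget] is forced, as test functions belong to [H20] and separate [L2c]. *)
Lemma adjoint_eq g h : (forall u, H20 J u -> pairing h u = pairing g (Delta u)) ->
  AD g = h.
Proof.
move=> H; rewrite /Laplacian_adjoint /adjoint /=.
case: xgetP => [k _ /= kE|nk]; last by exfalso; exact: nk h H.
by apply: pairing_separates => u Hu; rewrite kE// H.
Qed.

Lemma H2_adjoint_dom g : H2 setT g -> op_dom AD g.
Proof.
move=> Hg; have [h [_ hE]] := H2c_dual Hg.
have [n h0] := L2c_support E h.
apply/subspace_continuousP => u Hu V /= nV.
have {nV}[e [e0 HV]] := (nbhs_csqr _ _).1 nV.
(* The factor [2] is that of [csqr_cintegral_le], and [+ 1] makes [q] positive when [h] vanishes. *)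
pose q := 2 * sqn (exh E n) h + 1.
have q0 : 0 < q by rewrite ltr_wpDl// mulr_ge0// sqn_ge0.
have d0 : 0 < Num.sqrt (e / q) by rewrite sqrtr_gt0 divr_gt0.
apply/nbhs_L2loc; exists n, (Num.sqrt (e / q)); split => // v vu Hv.
have Fu := hE _ Hu; have Fv := hE _ Hv.
have HV' (z1 z2 : C) : z1 = pairing g (Delta u) -> z2 = pairing g (Delta v) ->
    csqr (z2 - z1) < e -> V (pairing g (Delta v)).
  by move=> -> ->; exact: HV.
apply: (HV' _ _ Fu Fv) => {Fu Fv HV HV'}.
have lv := L2loc_exh E n (L2loc_funP v); have lu := L2loc_exh E n (L2loc_funP u).
have lh := L2c_L2 h (mexh n).
have loc (x : L2loc J) : pairing h x = cintegral (exh E n) (h \* x).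
  apply: (@support_cintegral _ _ E n h x J); [exact: mJ|exact: exh_sub| | |exact: h0].
    exact: L2_measurable (L2c_L2 h mJ).
  exact: (L2loc_cmeasurable E (L2loc_funP x)).
rewrite !loc -cintegralB; [|exact: mexh|exact: L2_mul_cintegrable|exact: L2_mul_cintegrable].
pose vL : L2loc J := v; pose uL : L2loc J := u; pose d : L2loc J := vL - uL.
have ld := L2loc_exh E n (L2loc_funP d).
have -> : cintegral (exh E n) ((h \* vL) \- (h \* uL)) = cintegral (exh E n) (h \* d).
  apply: ae_eq_cintegral; [exact: mexh| | |].
  - rewrite (_ : _ \- _ = h \* ((vL : R -> C) \- uL)); last first.
      by apply/funext => x /=; rewrite mulrBr.
    apply: cmeasurable_mul; first exact: L2_measurable lh.
    exact: L2_measurable (L2B (mexh n) lv lu).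
  - by apply: cmeasurable_mul; [exact: L2_measurable lh|exact: L2_measurable ld].
  - by apply: aeS (L2loc_subE vL uL) => x xE nx /=; rewrite xE ?mulrBr//; exact: exh_sub nx.
apply: (le_lt_trans (csqr_cintegral_le (mexh n) lh ld)).
have small : sqn (exh E n) d < e / q.
  apply: le_lt_trans (L2loc_seminorm_ge E n d) _.
  rewrite -[ltRHS]sqr_sqrtr ?divr_ge0 ?ltW//.
  rewrite ltr_sqr ?nnegrE ?L2loc_seminorm_ge0 ?sqrtr_ge0//.
  exact: vu.
have h1 := sqn_ge0 (exh E n) h; have h2 := sqn_ge0 (exh E n) d.
rewrite mulrA; apply: (@le_lt_trans _ _ (q * sqn (exh E n) d)).
  by rewrite ler_wpM2r// lerDl.
by rewrite mulrC -ltr_pdivlMr.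
Qed.

End AdjointSpectrum.

(** * The pencil of the adjoint *)

Section AdjointResolvent.
Context {R : realType} (a b : R) (ab : a < b).
Local Notation J := (`]a, b[%classic).
Context (E : exhaustion J).
Local Notation C := R[i].
Notation mu := (@lebesgue_measure R).
Implicit Types (u v : L2loc J) (g h : L2c J) (l z : C) (phi w : R -> C).
Local Notation Delta := (Laplacian E).
Local Notation AD := (Laplacian_adjoint E).

Let mJ : measurable J. Proof. exact: measurable_itv. Qed.

Let mT : measurable (setT : set R). Proof. by []. Qed.

Lemma adjoint_dual g u : H2 setT g -> H20 J u ->
  pairing (AD g) u = pairing g (Delta u).
Proof.
move=> Hg; have [h [_ hE]] := H2c_dual E Hg.
by rewrite (adjoint_eq ab hE); exact: hE.
Qed.

Lemma adjoint_pencil_test l g u : H2 setT g -> H20 J u ->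
  pairing (pencil AD l g) u = l * pairing g u - pairing g (Delta u).
Proof.
move=> Hg Hu; rewrite -(adjoint_dual Hg Hu); set h := AD g.
have [lu _ _] := H20_approx E Hu.
have lg := L2c_L2 g mJ; have lh := L2c_L2 (h : L2c J) mJ.
have lp := L2c_L2 (pencil AD l g : L2c J) mJ.
have ig := L2_mul_cintegrable mJ lg lu; have ih := L2_mul_cintegrable mJ lh lu.
have izg : cintegrable J (fun x => l * (g \* u) x).
  rewrite (_ : (fun x => _) = (l *: (g : R -> C)) \* u).
    exact: L2_mul_cintegrable mJ (L2_Z l mJ lg) lu.
  by apply/funext => x /=; rewrite mulrA.
rewrite /pairing -(cintegralZ l mJ ig) -(cintegralB mJ izg ih).
have E1 : (fun x => l * (g \* u) x) \- ((h : L2c J) \* u) =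
    ((l *: (g : R -> C)) \- (h : L2c J)) \* u.
  apply/funext => x; rewrite /= mulrA -mulrBl.
  by [].
rewrite E1; apply: ae_eq_cintegral; [exact: mJ| | |].
- exact: cmeasurable_mul (L2_measurable lp) (L2_measurable lu).
- apply: cmeasurable_mul (L2_measurable lu).
  exact: L2_measurable (L2B mJ (L2_Z l mJ lg) lh).
- by apply: aeS (L2c_combE l g h) => x xE _ /=; congr (_ * _); exact: xE.
Qed.

(** Duality with [H20] is extended to smooth [w] of arbitrary behaviour at the endpoints: [g] and
    its image vanish off a common [exh E n], so [w] may be replaced by its product with the cut-off
    of index [n.+1]. *)
Lemma adjoint_pencil_smooth l g w : H2 setT g -> csmooth w ->
  cintegral J ((pencil AD l g : L2c J) \* w) =
  cintegral J (g \* (fun x => l * w x - cderive (cderive w) x)).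
Proof.
move=> Hg sw; set y := pencil AD l g : L2c J.
have [n1 y0] := L2c_support E y; have [n2 g0] := L2c_support E g.
pose n := maxn n1 n2.
have yn : \forall x \ae mu, ~ exh E n x -> y x = 0.
  apply: aeS y0 => x xE nx; apply: xE => n1x; apply: nx.
  by apply: exh_le n1x; exact: leq_maxl.
have gn : \forall x \ae mu, ~ exh E n x -> g x = 0.
  apply: aeS g0 => x xE nx; apply: xE => n2x; apply: nx.
  by apply: exh_le n2x; exact: leq_maxr.
pose phi := cutoff E n.+1 \* w.
have tphi : test_function J phi by apply: test_mul sw; exact: cutoff_testJ.
have sphi := csmooth_test tphi; have sphi2 := csmooth_derive (csmooth_derive sphi).
have sw2 := csmooth_derive (csmooth_derive sw).
have [u [Hu uE dE]] := test_H20 ab E tphi.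
have nJ := @exh_sub _ _ E n.
have lphi := test_L2 mJ tphi.
have lphi2 := test_L2 mJ (test_derive (test_derive tphi)).
have lg := L2c_L2 g mJ.
transitivity (cintegral J (y \* phi)).
  apply: (@support_cintegral_eq _ _ E n); [exact: mJ|exact: mJ|exact: nJ|exact: nJ
    |exact: L2c_measurable|exact: csmooth_measurable|exact: csmooth_measurable|exact: yn|].
  by move=> x nx; rewrite /phi (cutoff_mul1 w (ltnSn n) nx).
rewrite -(pairing_ae E y (csmooth_measurable J sphi) uE).
rewrite (adjoint_pencil_test l Hg Hu).
rewrite (pairing_ae E g (csmooth_measurable J sphi) uE).
rewrite (pairing_ae E g (csmooth_measurable J sphi2) dE).
have c1 : cintegral J (g \* phi) = cintegral J (g \* w).
  apply: (@support_cintegral_eq _ _ E n); [exact: mJ|exact: mJ|exact: nJ|exact: nJ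
    |exact: L2c_measurable|exact: csmooth_measurable|exact: csmooth_measurable|exact: gn|].
  by move=> x nx; rewrite /phi (cutoff_mul1 w (ltnSn n) nx).
have c2 : cintegral J (g \* cderive (cderive phi)) = cintegral J (g \* cderive (cderive w)).
  apply: (@support_cintegral_eq _ _ E n); [exact: mJ|exact: mJ|exact: nJ|exact: nJ
    |exact: L2c_measurable|exact: csmooth_measurable|exact: csmooth_measurable|exact: gn|].
  by move=> x nx; rewrite /phi (cderive2_cutoff w (ltnSn n) nx).
have i1 := L2_mul_cintegrable mJ lg (csmooth_L2J a b sw).
have i2 := L2_mul_cintegrable mJ lg (csmooth_L2J a b sw2).
have il : cintegrable J (fun x => l * (g \* w) x).
  rewrite (_ : (fun x => _) = (l *: (g : R -> C)) \* w).
    exact: L2_mul_cintegrable mJ (L2_Z l mJ lg) (csmooth_L2J a b sw).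
  by apply/funext => x /=; rewrite mulrA.
rewrite c1 c2 -(cintegralZ l mJ i1) -(cintegralB mJ il i2).
by apply: eq_cintegral => x _ /=; rewrite mulrBr mulrCA.
Qed.

Lemma adjoint_pencil_inj l : pencil_inj AD l.
Proof.
move=> g g' /set_mem/(adjoint_dom_H2 ab) Hg /set_mem/(adjoint_dom_H2 ab) Hg' gg'.
apply: (L2c_eqJ E).
apply: (L2_poly_separates ab (L2c_L2 (g : L2c J) mJ) (L2c_L2 (g' : L2c J) mJ)) => p.
have [w wp] := poly_resolvent l (- p); have sw := csmooth_cpoly w.
have wE : (fun x => l * cpoly w x - cderive (cderive (cpoly w)) x) = cpoly p.
  apply/funext => x; have := cpolyE x wp; rewrite /cpoly hornerN => h.
  by rewrite -opprB h opprK.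
by rewrite -wE -(adjoint_pencil_smooth l Hg sw) -(adjoint_pencil_smooth l Hg' sw) gg'.
Qed.

(** The weak* topology is initial for the map into a product, and evaluation at [v] is a projection
    of that product. *)
Lemma continuous_pairing v : continuous (fun g : L2c_space J => pairing g v : C^o).
Proof.
move=> g; apply: (@continuous_comp _ _ _
  (@pairing R J : L2c_space J -> {ptws L2loc J -> C^o}) (fun f => f v)).
  exact: initial_continuous.
exact: (@proj_continuous _ (fun=> C^o) v).
Qed.

Lemma adjoint_pencil_not_dense l : ~ pencil_dense AD l.
Proof.
have [w sw [w2 wgt]] := eigenfunction E l.
have wJ := L2_L2loc mJ (csmooth_L2J a b sw).
have vE := L2loc_classE wJ; set v := L2loc_class wJ in vE.
have mw := csmooth_measurable J sw.
move=> dense.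
have all0 h : pairing h v = 0.
  (* A weak* closed hyperplane containing the range. Density would make it the whole space, and
     pairing [v] with test functions would then force [w] to vanish almost everywhere. *)
  pose Z := [set g : L2c_space J | pairing g v = 0 :> C^o].
  have cZ : closed Z.
    apply: (@closed_comp _ _ (fun g : L2c_space J => pairing g v : C^o) [set 0]).
      by move=> g _; exact: continuous_pairing.
    by apply/accessible_closed_set1/hausdorff_accessible; exact: norm_hausdorff.
  have sub : pencil_range AD l `<=` Z.
    move=> _ [g /(adjoint_dom_H2 ab) Hg <-]; rewrite /Z /= (pairing_ae E _ mw vE).
    rewrite (adjoint_pencil_smooth l Hg sw); apply: cintegral0 => x _ /=.
    by rewrite w2 subrr; exact: mulr0.
  have : Z (h : L2c_space J).
    by apply: cZ; apply: (closureS sub); rewrite dense.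
  by [].
have w0 : \forall x \ae mu, J x -> w x = 0.
  apply: (test_annihilator E wJ) => phi tphi.
  have [_ _ [S [cS SJ S0]]] := tphi.
  have pc : phi \in L2c_pred J.
    rewrite inE; split; first exact: test_L2 mT tphi.
    by exists S; split; [exact: cS|exact: SJ|apply: aeW; exact: S0].
  rewrite -(all0 (L2c_class pc)) (pairing_ae E _ mw vE).
  apply: ae_eq_cintegral; [exact: mJ| | |].
  - exact: cmeasurable_mul mw (csmooth_measurable J (csmooth_test tphi)).
  - exact: cmeasurable_mul (L2_measurable (L2c_L2 _ mJ)) mw.
  - by apply: aeS (L2c_classE pc) => x xE Jx /=; rewrite xE mulrC.
move: wgt; apply/negP; rewrite -ltNge.
have m0 : measurable (exh E 0) by exact: measurable_itv.
rewrite (@ae_eq_sqn _ (exh E 0) w (fun x => 0 * w x) m0).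
- by rewrite (sqnZ 0 m0 (csmooth_L2 _ _ sw)) /csqr expr0n addr0 mul0r.
- exact: csmooth_L2.
- exact: (L2_Z 0 m0 (csmooth_L2 _ _ sw)).
- by apply: aeS w0 => x xE nx; rewrite (xE (exh_sub nx)) mulr0.
Qed.

End AdjointResolvent.

Theorem corollary2p13 (R : realType) (E : exhaustion `]0, (pi : R)[%classic) :
  (op_dom (Laplacian_adjoint E) = H2c_space /\
   forall g : L2c_space `]0, (pi : R)[%classic, H2c_space g ->
     Laplacian_adjoint E g = L2c_derive (L2c_derive g)) /\
  (resolvent_set (Laplacian E) = set0 /\
   resolvent_set (Laplacian_adjoint E) = set0) /\
  (point_spectrum (Laplacian E) = set0 /\
   point_spectrum (Laplacian_adjoint E) = set0) /\
  (residual_spectrum (Laplacian E) = set0 /\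
   continuous_spectrum (Laplacian_adjoint E) = set0) /\
  (continuous_spectrum (Laplacian E) = setT /\
   residual_spectrum (Laplacian_adjoint E) = setT).
Proof.
have ab : 0 < (pi : R) := pi_gt0 R.
split; first split.
- by apply/seteqP; split=> [g /(adjoint_dom_H2 ab)|g /H2_adjoint_dom].
- move=> g Hg; have [h [hd hE]] := H2c_dual E Hg.
  by have AE := adjoint_eq ab hE; rewrite hd -AE.
split; first split.
- by rewrite -subset0 => l [_ _ /(Laplacian_inverse_not_continuous ab)].
- by rewrite -subset0 => l [_ /(adjoint_pencil_not_dense ab)].
split; first split.
- by rewrite -subset0 => l; apply; exact: Laplacian_pencil_inj.
- by rewrite -subset0 => l; apply; exact: adjoint_pencil_inj.
split; first split.
- by rewrite -subset0 => l [_]; apply; exact: Laplacian_pencil_dense.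
- by rewrite -subset0 => l [_ /(adjoint_pencil_not_dense ab)].
split; rewrite -subTset => l _.
- split; [exact: Laplacian_pencil_inj|exact: Laplacian_pencil_dense|].
  exact: Laplacian_inverse_not_continuous.
- split; [exact: adjoint_pencil_inj|exact: adjoint_pencil_not_dense].
Qed.
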